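(* Let $\varphi(z)=\frac{az+b}{cz+d}$ be a fractional linear map with $|a|^2+|b|^2+2|\bar a b-\bar c d|\le|c|^2+|d|^2$ and $|c|\le|d|$ (so that $\varphi$ maps $\mathbb{D}$ into $\mathbb{D}$), and consider $C_\varphi$ acting on the Hardy space $H^2$. Then, with $K=\overline{\varphi(\mathbb{D})}$, the limit $\beta(C_\varphi)=\lim_{n\to\infty}[a_n(C_\varphi)]^{1/n}$ exists and $\beta(C_\varphi)=\exp(-1/\operatorname{Cap}(K))$ (with the conventions $e^{-1/\infty}=1$, $e^{-1/0}=0$).
   Context: $H^2$ is the Hardy space of the unit disk $\mathbb{D}$; $C_\varphi f=f\circ\varphi$. Approximation numbers: $a_n(T)=\inf\{\|T-R\| : \operatorname{rank}R<n\}$. Green capacity: with $g(z,w)=\log\left|\frac{1-\bar w z}{z-w}\right|$, energy $I(\mu)=\iint g\,d\mu\,d\mu$, $V(E)=\inf I(\mu)$ over probability measures supported by a compact subset of $E\subseteq\mathbb{D}$, and $\operatorname{Cap}(E)=1/V(E)$. *)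

(* Defs.v *)
From HB Require Import structures.
From mathcomp Require Import all_boot all_order all_algebra.
From mathcomp Require Import all_classical all_reals all_analysis.
From mathcomp Require Import complex.
Import Order.TTheory GRing.Theory Num.Theory.
Import numFieldNormedType.Exports.
Set Implicit Arguments. Unset Strict Implicit. Unset Printing Implicit Defensive.
Local Open Scope ring_scope.
Local Open Scope classical_set_scope.

Section Defs.
Variable R : realType.

Definition cabs (z : R[i]) : R :=
  Num.sqrt (complex.Re z ^+ 2 + complex.Im z ^+ 2).

Definition disk : set R[i] := [set z | cabs z < 1].

Definition flm (a b c d : R[i]) (z : R[i]) : R[i] := (a * z + b) / (c * z + d).

(** ---------- The Hardy space H^2, in its Taylor-coefficient model ----------
   f(z) = sum_k x_k z^k with ||f||^2 = sum_k |x_k|^2 < oo. *)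
Definition seqC := nat -> R[i].

Definition h2norm2 (x : seqC) : \bar R :=
  (\sum_(0 <= k <oo) ((cabs (x k)) ^+ 2)%:E)%E.

Definition h2norm (x : seqC) : \bar R :=
  match h2norm2 x with
  | EFin r => (Num.sqrt r)%:E
  | _ => +oo%E
  end.

Definition inH2 (x : seqC) : Prop := (h2norm2 x < +oo)%E.

Definition h2eval (x : seqC) (z : R[i]) : R[i] :=
  limn ((fun n => \sum_(k < n) x k * z ^+ k) : nat -> R[i]^o).

(** composition operator C_phi f = f o phi on H^2 : the (unique) element of
    H^2 whose function is f o phi on the disk. *)
Definition compop (phi : R[i] -> R[i]) (x : seqC) : seqC :=
  xget (fun _ : nat => (0 : R[i]))
    [set y : nat -> R[i] | inH2 y /\ forall z, disk z -> h2eval y z = h2eval x (phi z)].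

Definition opnorm (S : seqC -> seqC) : \bar R :=
  ereal_sup [set h2norm (S x) | x in [set x | (h2norm x <= 1)%E]].

Definition finite_rank_lt (n : nat) (S : seqC -> seqC) : Prop :=
  (forall x, inH2 x -> inH2 (S x)) /\
  (forall x y, inH2 x -> inH2 y -> S (fun k => x k + y k) = (fun k => S x k + S y k)) /\
  (forall (c : R[i]) x, inH2 x -> S (fun k => c * x k) = (fun k => c * S x k)) /\
  exists m, (m < n)%N /\ exists v : 'I_m -> seqC,
    (forall i, inH2 (v i)) /\
    forall x, inH2 x -> exists cf : 'I_m -> R[i],
      S x = (fun k => \sum_(i < m) cf i * v i k).

Definition approx_num (n : nat) (T : seqC -> seqC) : \bar R :=
  ereal_inf [set opnorm (fun x k => T x k - S x k) | S in finite_rank_lt n].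

(** the plane, as R * R (with its product = Borel sigma-algebra) *)
Definition toC (p : R * R) : R[i] := (p.1 +i* p.2)%C.

Definition green (z w : R[i]) : \bar R :=
  if z == w then +oo%E
  else (ln (cabs (1 - conjc w * z) / cabs (z - w)))%:E.

Definition energy (mu : probability (R * R)%type R) : \bar R :=
  (\int[mu]_p \int[mu]_q green (toC p) (toC q))%E.

Definition supported_compact_in (E : set R[i]) (mu : probability (R * R)%type R) :=
  exists A : set R[i]^o, compact A /\ A `<=` E `&` disk /\
    mu (~` (toC @^-1` A)) = 0%E.

Definition Vcap (E : set R[i]) : \bar R :=
  ereal_inf [set energy mu | mu in supported_compact_in E].

Definition Cap (E : set R[i]) : \bar R :=
  match Vcap E with
  | EFin v => if v == 0 then +oo%E else (v^-1)%:E
  | +oo%E => 0%E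
  | -oo%E => -oo%E
  end.

Definition exp_neg_inv (C : \bar R) : R :=
  match C with
  | EFin c => if c == 0 then 0 else expR (- c^-1)
  | +oo%E => 1
  | -oo%E => 0
  end.

End Defs.

(* Main.v *)
(** A non-constant [phi] maps the disk onto a disk [K]. If [K] is compactly
    contained in the unit disk, there are points [s], [w] such that
    [phi] becomes multiplication by a constant [rho] in the coordinates
    [bl s z = (z - s) / (1 - conj s * z)] and [bl w]; hence [C_phi] maps the
    orthogonal system [k_w (bl w)^j] to [rho^j] times an invertible multiple of
    the orthogonal system [k_s (bl s)^j], and [a_n] is comparable to [|rho|^n].
    If [K] is tangent to the circle, the maps [z |-> phi (t z)], [t -> 1],
    reduce the lower bound to that case with [|rho| -> 1], and the upper bound is
    the boundedness of [C_phi] (Littlewood subordination).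

    On the capacity side the Green function is
    [g = 1/2 sum_(n >= 1) Q^n / n] with
    [Q(z, w) = (1 - |z|^2) (1 - |w|^2) / |1 - conj w z|^2]. Every [Q^n] is a
    nonnegative positive definite kernel, so the energy satisfies
    [I(mu) >= 2 I(mu, nu) - I(nu)]; taking for [nu] the image of the normalised
    circle [|z| = r], whose potential is computed from
    [int_0^1 ln |1 - x e^(2 i pi t)| dt = 0] for [|x| < 1], gives
    [V(K) = - ln |rho|]. *)
Require Import Defs.
From HB Require Import structures.
From mathcomp Require Import all_boot all_order all_algebra.
From mathcomp Require Import all_classical all_reals all_analysis.
From mathcomp Require Import measurable_realfun complex ring lra.
Import Order.TTheory GRing.Theory Num.Theory.
Import numFieldNormedType.Exports.
Set Implicit Arguments. Unset Strict Implicit. Unset Printing Implicit Defensive.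
Local Open Scope ring_scope.
Local Open Scope classical_set_scope.

(** * Complex moduli and limits *)

(** On the operator side there are no boundary values: a function is its coefficient sequence, norm
    bounds are bounds on all partial sums, and a Moebius symbol acts through formal division by c z
    + d, bounded because |c| < |d|. Write A = |c|^2 - |a|^2, D = |d|^2 - |b|^2, m = |conj a b - conj
    c d|. The hypothesis reads 2m <= A + D, and tangency is equality: s and w come from a quadratic
    equation of discriminant (A + D)^2 - 4m^2. On the capacity side the obstacle is that the Green
    kernel is unbounded. Kernels are cut off to |z|^2 <= rho < 1, where Q is a uniform limit of
    finite sums of products F(p) F(q), so that positive definiteness becomes 2xy <= x^2 + y^2.
    Comparison circles are slightly larger than K for the lower bound and slightly smaller for the
    upper one, so potentials are computed off the circle or only bounded on it. Constant maps are
    treated apart. If the constant has modulus 1, the series in [h2eval] may diverge, [compop] is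
    not additive and the approximation numbers are +oo, which [fine] turns into 0. *)

Section ComplexModulus.
Variable R : realType.
Local Notation C := R[i].
Implicit Types (z w : C).

Definition n2 (z : C) : R := complex.Re z ^+ 2 + complex.Im z ^+ 2.

Lemma n2_ge0 z : 0 <= n2 z.
Proof. by rewrite addr_ge0// sqr_ge0. Qed.

Lemma n2M z w : n2 (z * w) = n2 z * n2 w.
Proof. case: z w => [a b] [c d]; rewrite /n2 /=; ring. Qed.

Lemma n2_0 : n2 0 = 0.
Proof. by rewrite /n2 /= expr0n addr0. Qed.

Lemma n2_1 : n2 1 = 1.
Proof. by rewrite /n2 /= expr1n expr0n addr0. Qed.

Lemma n2N z : n2 (- z) = n2 z.
Proof. by case: z => a b; rewrite /n2 /= !sqrrN. Qed.

Lemma n2J z : n2 (conjc z) = n2 z.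
Proof. by case: z => a b; rewrite /n2 /= sqrrN. Qed.

Lemma n2R (x : R) : n2 x%:C%C = x ^+ 2.
Proof. by rewrite /n2 /= expr0n addr0. Qed.

Lemma n2_eq0 z : (n2 z == 0) = (z == 0).
Proof.
case: z => a b; rewrite /n2 /= paddr_eq0 ?sqr_ge0// !sqrf_eq0.
by rewrite eq_complex.
Qed.

Lemma n2_gt0 z : (0 < n2 z) = (z != 0).
Proof. by rewrite lt0r n2_eq0 n2_ge0 andbT. Qed.

Lemma n2V z : n2 z^-1 = (n2 z)^-1.
Proof.
have [->|z0] := eqVneq z 0; first by rewrite invr0 n2_0 invr0.
apply: (mulfI (x := n2 z)); first by rewrite n2_eq0.
by rewrite -n2M divff// n2_1 divff// n2_eq0.
Qed.

Lemma n2X z n : n2 (z ^+ n) = n2 z ^+ n.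
Proof. by elim: n => [|n IH]; rewrite ?expr0 ?n2_1// !exprS n2M IH. Qed.

Lemma n2D_le z w : n2 (z + w) <= 2 * n2 z + 2 * n2 w.
Proof.
rewrite -subr_ge0; have -> : 2 * n2 z + 2 * n2 w - n2 (z + w) = n2 (z - w).
  by case: z w => [a b] [c d]; rewrite /n2 /=; ring.
exact: n2_ge0.
Qed.

Lemma mulcJ z : z * conjc z = (n2 z)%:C%C.
Proof.
by case: z => a b; apply/eqP; rewrite eq_complex /n2 /=; apply/andP; split;
  apply/eqP; ring.
Qed.

Lemma cabsE z : cabs z = Num.sqrt (n2 z). Proof. by []. Qed.

Lemma cabs_ge0 z : 0 <= cabs z. Proof. exact: sqrtr_ge0. Qed.

Lemma cabs_sqr z : cabs z ^+ 2 = n2 z.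
Proof. by rewrite sqr_sqrtr ?n2_ge0. Qed.

Lemma normc_cabs z : `|z| = (cabs z)%:C%C.
Proof. by rewrite normc_def. Qed.

Lemma cabsM z w : cabs (z * w) = cabs z * cabs w.
Proof. by rewrite !cabsE n2M sqrtrM// n2_ge0. Qed.

Lemma cabsN z : cabs (- z) = cabs z.
Proof. by rewrite !cabsE n2N. Qed.

Lemma cabsJ z : cabs (conjc z) = cabs z.
Proof. by rewrite !cabsE n2J. Qed.

Lemma cabsV z : cabs z^-1 = (cabs z)^-1.
Proof. by rewrite !cabsE n2V sqrtrV// n2_ge0. Qed.

Lemma cabs_eq0 z : (cabs z == 0) = (z == 0).
Proof. by rewrite -sqrf_eq0 cabs_sqr n2_eq0. Qed.

Lemma cabs_gt0 z : (0 < cabs z) = (z != 0).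
Proof. by rewrite lt0r cabs_eq0 cabs_ge0 andbT. Qed.

Lemma cabsD z w : cabs (z + w) <= cabs z + cabs w.
Proof. by rewrite -lecR raddfD /= -!normc_cabs ler_normD. Qed.

Lemma cabs_lt z (r : R) : 0 <= r -> (cabs z < r) = (n2 z < r ^+ 2).
Proof.
by move=> r0; rewrite -cabs_sqr ltr_pXn2r// nnegrE ?cabs_ge0.
Qed.

Lemma cabs_le z (r : R) : 0 <= r -> (cabs z <= r) = (n2 z <= r ^+ 2).
Proof.
by move=> r0; rewrite -cabs_sqr ler_pXn2r// nnegrE ?cabs_ge0.
Qed.

Lemma diskE z : disk z <-> n2 z < 1.
Proof. by rewrite /disk /= cabs_lt// expr1n. Qed.

Lemma Re_cabs z : `|complex.Re z| <= cabs z.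
Proof.
by rewrite -sqrtr_sqr /cabs ler_sqrt ?lerDl ?sqr_ge0// addr_ge0// sqr_ge0.
Qed.

Lemma Im_cabs z : `|complex.Im z| <= cabs z.
Proof.
by rewrite -sqrtr_sqr /cabs ler_sqrt ?lerDr ?sqr_ge0// addr_ge0// sqr_ge0.
Qed.

Lemma ReD z w : complex.Re (z + w) = complex.Re z + complex.Re w.
Proof. by case: z w => [a b] [c d]. Qed.

Lemma ImD z w : complex.Im (z + w) = complex.Im z + complex.Im w.
Proof. by case: z w => [a b] [c d]. Qed.

Lemma ReM z w : complex.Re (z * w) =
  complex.Re z * complex.Re w - complex.Im z * complex.Im w.
Proof. by case: z w => [a b] [c d]. Qed.

Lemma ImM z w : complex.Im (z * w) =
  complex.Re z * complex.Im w + complex.Im z * complex.Re w.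
Proof. by case: z w => [a b] [c d]. Qed.

Lemma Re_sum n (F : nat -> C) :
  complex.Re (\sum_(k < n) F k) = \sum_(k < n) complex.Re (F k).
Proof. by elim/big_ind2: _ => // x1 x2 y1 y2 <- <-; rewrite ReD. Qed.

Lemma Im_sum n (F : nat -> C) :
  complex.Im (\sum_(k < n) F k) = \sum_(k < n) complex.Im (F k).
Proof. by elim/big_ind2: _ => // x1 x2 y1 y2 <- <-; rewrite ImD. Qed.

Lemma conjcM z w : conjc (z * w) = conjc z * conjc w.
Proof. exact: rmorphM. Qed.

Lemma conjcD z w : conjc (z + w) = conjc z + conjc w.
Proof. exact: rmorphD. Qed.

Lemma conjcN z : conjc (- z) = - conjc z.
Proof. exact: rmorphN. Qed.

Lemma conjcB z w : conjc (z - w) = conjc z - conjc w.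
Proof. exact: rmorphB. Qed.

Lemma conjcR (x : R) : conjc x%:C%C = x%:C%C.
Proof. by rewrite /= oppr0. Qed.

End ComplexModulus.

Section ComplexLimit.
Variable R : realType.
Local Notation C := R[i].
Implicit Types (u v : nat -> C) (l m z : C).

(** Componentwise, so that the real limit calculus applies; [ccvg_lim] returns to the [limn] over
    [C^o] used by [h2eval]. *)
Definition ccvg u l :=
  ((fun n => complex.Re (u n)) @ \oo --> complex.Re l) /\
  ((fun n => complex.Im (u n)) @ \oo --> complex.Im l).

Lemma ccvg_cabs u l : ccvg u l ->
  forall e : R, 0 < e -> \forall n \near \oo, cabs (l - u n) <= e.
Proof.
move=> [uR uI] e e0.
have aux (p q : C) : `|complex.Re p - complex.Re q| <= e / 2 ->
    `|complex.Im p - complex.Im q| <= e / 2 -> n2 (p - q) <= e ^+ 2.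
  case: p q => [a b] [c d]; rewrite /n2 /= -(real_normK (num_real (a - c))).
  rewrite -(real_normK (num_real (b - d))).
  by have := normr_ge0 (a - c); have := normr_ge0 (b - d); nra.
have e20 : 0 < e / 2 by rewrite divr_gt0.
move/cvgrPdist_le : uR => /(_ _ e20) uR.
move/cvgrPdist_le : uI => /(_ _ e20) uI.
near=> n.
have h1 : `|complex.Re l - complex.Re (u n)| <= e / 2 by near: n.
have h2 : `|complex.Im l - complex.Im (u n)| <= e / 2 by near: n.
by rewrite cabs_le ?(ltW e0)//; exact: aux.
Unshelve. all: by end_near. Qed.

Lemma cvg_cabs u l : (u : nat -> C^o) @ \oo --> (l : C^o) <->
  forall e : R, 0 < e -> \forall n \near \oo, cabs (l - u n) <= e.
Proof.
split.
  move/cvgrPdist_le => h e e0; have e0' : (0 : C) < e%:C%C by rewrite ltcR.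
  have := h _ e0'; apply: filter_app; near=> n.
  by rewrite normc_cabs lecR.
move=> h; apply/cvgrPdist_le => e e0.
have e0R : 0 < complex.Re e by move: e0; rewrite ltcE => /andP[].
(* The norm and hence the tolerance are complex; a positive element of [R[i]] has zero imaginary
   part. *)
have eE : e = (complex.Re e)%:C%C.
  by move: e0; case: (e) => x y; rewrite ltcE /= => /andP[/eqP -> _].
have := h _ e0R; apply: filter_app; near=> n.
by rewrite eE normc_cabs lecR.
Unshelve. all: by end_near. Qed.

Lemma ccvg_lim u l : ccvg u l -> limn (u : nat -> C^o) = l.
Proof.
by move=> /ccvg_cabs h; apply: cvg_lim; [exact: norm_hausdorff|apply/cvg_cabs].
Qed.

Lemma ccvg_unique u l m : ccvg u l -> ccvg u m -> l = m.
Proof. by move=> /ccvg_lim <- /ccvg_lim. Qed.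

Lemma ccvgD u v l m : ccvg u l -> ccvg v m ->
  ccvg (fun n => u n + v n) (l + m).
Proof.
move=> [a b] [c d]; split; rewrite ?ReD ?ImD.
  by under eq_fun do rewrite ReD; exact: cvgD.
by under eq_fun do rewrite ImD; exact: cvgD.
Qed.

Lemma ccvg_cst l : ccvg (fun=> l) l.
Proof. by split; exact: cvg_cst. Qed.

Lemma ccvgM u v l m : ccvg u l -> ccvg v m ->
  ccvg (fun n => u n * v n) (l * m).
Proof.
move=> [a b] [c d]; split; rewrite ?ReM ?ImM.
  by under eq_fun do rewrite ReM; apply: cvgB; exact: cvgM.
by under eq_fun do rewrite ImM; apply: cvgD; exact: cvgM.
Qed.

Lemma ccvg_unshift u l : ccvg (fun n => u n.+1) l -> ccvg u l.
Proof.
by move=> [a b]; split; rewrite -cvg_shiftS.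
Qed.

Lemma n2_ccvg u l : ccvg u l -> (fun n => n2 (u n)) @ \oo --> n2 l.
Proof.
move=> [a b]; rewrite /n2.
by apply: (@cvgD R R^o); rewrite ?expr2; under eq_fun do rewrite ?expr2; exact: cvgM.
Qed.

Lemma ccvg_n2_le u l (M : R) : ccvg u l -> (forall n, n2 (u n) <= M) ->
  n2 l <= M.
Proof.
move=> /n2_ccvg ul uM; rewrite -(cvg_lim _ ul)//.
apply: limr_le; first by apply/cvg_ex; exists (n2 l).
exact: nearW.
Qed.

Lemma cvg_le_bound (f : nat -> R) (l M : R) : f @ \oo --> l ->
  (forall n, f n <= M) -> l <= M.
Proof.
move=> fl fM; rewrite -(cvg_lim _ fl)//.
apply: limr_le; first by apply/cvg_ex; exists l.
exact: nearW.
Qed.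

Lemma cvg_ge_bound (f : nat -> R) (l M : R) : f @ \oo --> l ->
  (forall n, M <= f n) -> M <= l.
Proof.
move=> fl fM; rewrite -(cvg_lim _ fl)//.
apply: limr_ge; first by apply/cvg_ex; exists l.
exact: nearW.
Qed.

Lemma cvg0_of_le (f g : nat -> R) : (forall n, 0 <= f n <= g n) ->
  g @ \oo --> (0 : R) -> f @ \oo --> (0 : R).
Proof.
move=> fg g0; apply: (@squeeze_cvgr _ _ _ _ (fun=> 0) g f) => //.
- by near=> n.
- exact: cvg_cst.
Unshelve. all: by end_near. Qed.

Lemma ccvg_of_n2 u l : (fun n => n2 (l - u n)) @ \oo --> (0 : R) -> ccvg u l.
Proof.
move=> h; have h1 : (fun n => cabs (l - u n)) @ \oo --> (0:R).
  rewrite -(@sqrtr0 R); exact: (cvg_comp _ _ h (@sqrt_continuous R 0)).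
split; apply/cvgrPdist_le => e e0;
  move/cvgrPdist_le : h1 => /(_ _ e0); apply: filter_app; near=> n;
  rewrite sub0r normrN ger0_norm ?cabs_ge0//; apply: le_trans.
- by move: (Re_cabs (l - u n)); rewrite ReD; case: (u n) => [a b].
- by move: (Im_cabs (l - u n)); rewrite ImD; case: (u n) => [a b].
Unshelve. all: by end_near. Qed.

End ComplexLimit.

(** * The Hardy space norm *)

Section HardySpace.
Variable R : realType.
Local Notation C := R[i].
Local Notation seqC := (nat -> C).
Implicit Types (x y : seqC) (z w : C) (M : R).

Definition ssum n x : R := \sum_(k < n) n2 (x k).

Definition hn2 x : R := fine (h2norm2 x).

Lemma ssumS n x : ssum n.+1 x = ssum n x + n2 (x n).
Proof. exact: big_ord_recr. Qed.

Lemma ssum_recl n x : ssum n.+1 x = n2 (x 0%N) + ssum n (fun k => x k.+1).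
Proof. exact: big_ord_recl. Qed.

Lemma ssum0 x : ssum 0 x = 0. Proof. exact: big_ord0. Qed.

Lemma ssum_ge0 n x : 0 <= ssum n x.
Proof. by apply: sumr_ge0 => k _; exact: n2_ge0. Qed.

Lemma ssum_homo x : {homo ssum^~ x : m n / (m <= n)%N >-> m <= n}.
Proof.
by apply/nondecreasing_seqP => n; rewrite ssumS lerDl n2_ge0.
Qed.

Lemma h2norm2E x : h2norm2 x = limn (fun n => (ssum n x)%:E).
Proof.
rewrite /h2norm2; congr (limn _); apply/funext => n.
rewrite big_mkord sumEFin; congr (_%:E).
by apply: eq_bigr => k _; rewrite cabs_sqr.
Qed.

(** The terms are nonnegative, so the series is the supremum of its partial sums. Later norm
    estimates are proved in this form, uniformly in [n]. *)
Lemma h2norm2_leP x M : (h2norm2 x <= M%:E)%E <-> forall n, ssum n x <= M.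
Proof.
rewrite h2norm2E; have h : {homo (fun n => (ssum n x)%:E) : m n / (m <= n)%N >-> (m <= n)%E}.
  by move=> m n mn; rewrite lee_fin ssum_homo.
have /cvg_lim -> // := ereal_nondecreasing_cvgn h.
split.
  by move=> sM n; rewrite -lee_fin; apply: le_trans sM; apply: ereal_sup_ubound; exists n.
by move=> H; apply: ge_ereal_sup => _ [n _ <-]; rewrite lee_fin.
Qed.

Lemma h2norm2_ge0 x : (0 <= h2norm2 x)%E.
Proof. by apply: nneseries_ge0 => n _ _; rewrite lee_fin sqr_ge0. Qed.

Lemma hn2_ge0 x : 0 <= hn2 x.
Proof. by apply: fine_ge0; exact: h2norm2_ge0. Qed.

Lemma hn2_fin x : inH2 x -> h2norm2 x = (hn2 x)%:E.
Proof.
by move=> xH; rewrite fineK// ge0_fin_numE ?h2norm2_ge0.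
Qed.

Lemma ssum_hn2 n x : inH2 x -> ssum n x <= hn2 x.
Proof. by move=> /hn2_fin xE; move: n; apply/h2norm2_leP; rewrite xE. Qed.

Lemma inH2_bound x M : (forall n, ssum n x <= M) -> inH2 x.
Proof. by move=> /h2norm2_leP h; apply: (le_lt_trans h); rewrite ltry. Qed.

Lemma hn2_le x M : (forall n, ssum n x <= M) -> hn2 x <= M.
Proof.
move=> h; have xH := inH2_bound h.
by move/h2norm2_leP : h; rewrite hn2_fin.
Qed.

Lemma hn2_cvg x : inH2 x -> ssum^~ x @ \oo --> hn2 x.
Proof.
move=> xH.
have h : cvgn (ssum^~ x).
  apply: nondecreasing_is_cvgn; first exact: ssum_homo.
  by exists (hn2 x) => _ [n _ <-]; exact: ssum_hn2.
suff -> : hn2 x = limn (ssum^~ x) by [].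
by rewrite /hn2 h2norm2E EFin_lim.
Qed.

Lemma h2normE x : inH2 x -> h2norm x = (Num.sqrt (hn2 x))%:E.
Proof. by move=> xH; rewrite /h2norm hn2_fin. Qed.

Lemma h2norm_leP x M : 0 <= M ->
  (h2norm x <= M%:E)%E <-> forall n, ssum n x <= M ^+ 2.
Proof.
move=> M0; rewrite -h2norm2_leP /h2norm.
have := h2norm2_ge0 x; case: (h2norm2 x) => [s| |]//=; rewrite !lee_fin => s0.
by rewrite -{2}(sqr_sqrtr s0) ler_pXn2r// nnegrE sqrtr_ge0.
Qed.

Lemma h2norm_ge0 x : (0 <= h2norm x)%E.
Proof. by rewrite /h2norm; case: h2norm2 => [s| |]//=; rewrite lee_fin sqrtr_ge0. Qed.

Lemma hn2_eq x M : (ssum^~ x) @ \oo --> M -> inH2 x /\ hn2 x = M.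
Proof.
move=> h; have xH : inH2 x.
  apply: (@inH2_bound _ M) => n; rewrite -(cvg_lim _ h)//.
  by apply: nondecreasing_cvgn_le; [exact: ssum_homo|apply/cvg_ex; exists M].
by split => //; rewrite -(cvg_lim _ h)// (cvg_lim _ (hn2_cvg xH)).
Qed.

Lemma inH2_0 : inH2 (fun=> 0 : C).
Proof.
by apply: (@inH2_bound _ 0) => n; rewrite /ssum big1// => k _; rewrite n2_0.
Qed.

Lemma ssumD_le n x y : ssum n (fun k => x k + y k) <= 2 * ssum n x + 2 * ssum n y.
Proof.
rewrite /ssum !mulr_sumr -big_split; apply: ler_sum => k _; exact: n2D_le.
Qed.

Lemma inH2D x y : inH2 x -> inH2 y -> inH2 (fun k => x k + y k).
Proof.
move=> xH yH; apply: (@inH2_bound _ (2 * hn2 x + 2 * hn2 y)) => n.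
apply: (le_trans (ssumD_le n x y)); apply: lerD; rewrite ler_pM2l//; exact: ssum_hn2.
Qed.

Lemma ssumZ n (c : C) x : ssum n (fun k => c * x k) = n2 c * ssum n x.
Proof. by rewrite /ssum mulr_sumr; apply: eq_bigr => k _; rewrite n2M. Qed.

Lemma inH2Z (c : C) x : inH2 x -> inH2 (fun k => c * x k).
Proof.
move=> xH; apply: (@inH2_bound _ (n2 c * hn2 x)) => n; rewrite ssumZ.
by apply: ler_wpM2l; [exact: n2_ge0|exact: ssum_hn2].
Qed.

Lemma hn2Z (c : C) x : inH2 x -> hn2 (fun k => c * x k) = n2 c * hn2 x.
Proof.
move=> xH; apply: (proj2 (hn2_eq _)); under eq_fun do rewrite ssumZ.
by apply: cvgMr; exact: hn2_cvg.
Qed.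

Lemma inH2B x y : inH2 x -> inH2 y -> inH2 (fun k => x k - y k).
Proof.
move=> xH yH; have := inH2D xH (inH2Z (-1) yH).
by under eq_fun do rewrite mulN1r.
Qed.

Lemma inH2_sum m (v : 'I_m -> seqC) : (forall i, inH2 (v i)) ->
  inH2 (fun k => \sum_(i < m) v i k).
Proof.
elim: m v => [|m IH] v vH.
  by under eq_fun do rewrite big_ord0; exact: inH2_0.
under eq_fun do rewrite big_ord_recr /=.
by apply: inH2D => //; apply: IH.
Qed.

Lemma ssum_shift_le n x : ssum n (fun k => x k.+1) <= ssum n.+1 x.
Proof. by rewrite ssum_recl lerDr n2_ge0. Qed.

Lemma inH2_shift x : inH2 x -> inH2 (fun k => x k.+1).
Proof.
move=> xH; apply: (@inH2_bound _ (hn2 x)) => n.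
by apply: le_trans (ssum_hn2 n.+1 xH); exact: ssum_shift_le.
Qed.

Lemma hn2_shift x : inH2 x -> hn2 x = n2 (x 0%N) + hn2 (fun k => x k.+1).
Proof.
move=> xH; have h := hn2_cvg xH; move: h; rewrite -(@cvg_shiftS R^o) => h.
have h2 : (fun n => n2 (x 0%N) + ssum n (fun k => x k.+1)) @ \oo -->
   n2 (x 0%N) + hn2 (fun k => x k.+1).
  by apply: (@cvgD R R^o); [exact: cvg_cst|exact: hn2_cvg (inH2_shift xH)].
rewrite -(cvg_lim _ h)// -(cvg_lim _ h2)//; congr (limn _).
by apply/funext => n /=; rewrite ssum_recl.
Qed.

Lemma hn2_tail x m : inH2 x ->
  [/\ inH2 (fun k => x (m + k)%N) &
   hn2 x = ssum m x + hn2 (fun k => x (m + k)%N)].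
Proof.
move=> xH; elim: m => [|m [H1 H2]].
  by rewrite ssum0 add0r; split.
split; first by have := inH2_shift H1; under eq_fun do rewrite addnS.
rewrite {1}H2 hn2_shift// ssumS addn0 addrA; congr (_ + hn2 _).
by apply/funext => k; rewrite addnS.
Qed.

Lemma hn2_tail_cvg0 x : inH2 x -> (fun m => hn2 (fun k => x (m + k)%N)) @ \oo --> (0 : R).
Proof.
move=> xH; have -> : (fun m => hn2 (fun k => x (m + k)%N)) = (fun m => hn2 x - ssum m x).
  by apply/funext => m; have [_ ->] := hn2_tail m xH; rewrite addrC addKr.
rewrite -(subrr (hn2 x)); apply: (@cvgB R R^o); [exact: cvg_cst|exact: hn2_cvg].
Qed.

Lemma inH2_cvg0 x : inH2 x -> (fun k => n2 (x k)) @ \oo --> (0 : R).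
Proof.
move=> xH; apply: cvg0_of_le (hn2_tail_cvg0 xH) => n; rewrite n2_ge0 /=.
have [H _] := hn2_tail n xH.
by have := ssum_hn2 1 H; rewrite /ssum big_ord1 addn0.
Qed.

Lemma cauchy_schwarz n x y :
  n2 (\sum_(k < n) x k * y k) <= ssum n x * ssum n y.
Proof.
elim: n => [|n IH]; first by rewrite !ssum0 big_ord0 n2_0 mul0r.
rewrite big_ord_recr /= !ssumS; move: IH.
move: (\sum_(i < n) _) (ssum_ge0 n x) (ssum_ge0 n y) => P.
move: (ssum n x) (ssum n y) => A B A0 B0 PAB.
rewrite -!cabs_sqr in PAB *.
have h1 := cabsD P (x n * y n); rewrite cabsM in h1.
have hP := cabs_ge0 P; have ha := cabs_ge0 (x n); have hb := cabs_ge0 (y n).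
have h0 := cabs_ge0 (P + x n * y n).
move: (cabs (P + _)) (cabs P) (cabs (x n)) (cabs (y n)) h0 h1 hP ha hb PAB => q p a b.
move=> q0 qp p0 a0 b0 pAB.
have qle : q ^+ 2 <= (p + a * b) ^+ 2 by rewrite ler_pXn2r// nnegrE// addr_ge0// mulr_ge0.
apply: (le_trans qle).
(* AM-GM combined with p^2 <= A B, compared through squares to avoid square roots of [A] and [B]. *)
have key : 2 * (p * (a * b)) <= A * b ^+ 2 + B * a ^+ 2.
  rewrite -(@ler_pXn2r _ 2) ?nnegrE ?addr_ge0 ?mulr_ge0 ?sqr_ge0//.
  apply: (@le_trans _ _ (4 * (A * B) * (a * b) ^+ 2)).
    have -> : (2 * (p * (a * b))) ^+ 2 = 4 * p ^+ 2 * (a * b) ^+ 2 by ring.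
    by rewrite ler_wpM2r ?sqr_ge0// ler_pM2l.
  rewrite -subr_ge0.
  have -> : (A * b ^+ 2 + B * a ^+ 2) ^+ 2 - 4 * (A * B) * (a * b) ^+ 2
     = (A * b ^+ 2 - B * a ^+ 2) ^+ 2 by ring.
  exact: sqr_ge0.
by nra.
Qed.

Lemma Re_mul_le z w : `|complex.Re (z * w)| <= n2 z + n2 w.
Proof.
apply: (le_trans (Re_cabs _)); rewrite cabsM -!cabs_sqr.
by have := cabs_ge0 z; have := cabs_ge0 w; nra.
Qed.

Lemma Im_mul_le z w : `|complex.Im (z * w)| <= n2 z + n2 w.
Proof.
apply: (le_trans (Im_cabs _)); rewrite cabsM -!cabs_sqr.
by have := cabs_ge0 z; have := cabs_ge0 w; nra.
Qed.

Lemma cvg_series_dom x y (f : nat -> R) : inH2 x -> inH2 y ->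
  (forall k, `|f k| <= n2 (x k) + n2 (y k)) -> cvgn (fun n => \sum_(k < n) f k).
Proof.
move=> xH yH fxy.
have -> : (fun n => \sum_(k < n) f k) = series f.
  by apply/funext => n; rewrite /series /= big_mkord.
apply: normed_cvg; apply: nondecreasing_is_cvgn.
  by apply/nondecreasing_seqP => n; rewrite [X in _ <= X]seriesSr lerDl normr_ge0.
exists (hn2 x + hn2 y) => _ [n _ <-].
rewrite /= seriesEord /=.
apply: (@le_trans _ _ (ssum n x + ssum n y)); last by apply: lerD; exact: ssum_hn2.
by rewrite /ssum -big_split; apply: ler_sum => k _ /=.
Qed.

(** Bilinear, without conjugation, so that evaluation at z is the pairing with the powers of z. *)
Definition dotc x y : C :=
  (limn (fun n => \sum_(k < n) complex.Re (x k * y k)) +i*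
   limn (fun n => \sum_(k < n) complex.Im (x k * y k)))%C.

Lemma dotcP x y : inH2 x -> inH2 y ->
  ccvg (fun n => \sum_(k < n) x k * y k) (dotc x y).
Proof.
move=> xH yH; split => /=.
  under eq_fun do rewrite (Re_sum _ (fun k => x k * y k)).
  exact: (@cvg_series_dom x y (fun k => complex.Re (x k * y k)) xH yH (fun k => Re_mul_le _ _)).
under eq_fun do rewrite (Im_sum _ (fun k => x k * y k)).
exact: (@cvg_series_dom x y (fun k => complex.Im (x k * y k)) xH yH (fun k => Im_mul_le _ _)).
Qed.

Lemma dotc_le x y : inH2 x -> inH2 y -> n2 (dotc x y) <= hn2 x * hn2 y.
Proof.
move=> xH yH; apply: (ccvg_n2_le (dotcP xH yH)) => n.
apply: (le_trans (cauchy_schwarz n x y)).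
by apply: ler_pM; rewrite ?ssum_ge0 ?ssum_hn2.
Qed.

End HardySpace.

(** * Evaluation and multiplication operators *)

Section Evaluation.
Variable R : realType.
Local Notation C := R[i].
Local Notation seqC := (nat -> C).
Implicit Types (x y u v f g : seqC) (z w : C).

Lemma ssum_geo n z : n2 z < 1 -> ssum n (fun k => z ^+ k) <= (1 - n2 z)^-1.
Proof.
move=> z1; have q0 : 0 < 1 - n2 z by rewrite subr_gt0.
have -> : ssum n (fun k => z ^+ k) = (1 - n2 z ^+ n) / (1 - n2 z).
  elim: n => [|n IH]; first by rewrite ssum0 expr0 subrr mul0r.
  by rewrite ssumS IH n2X exprS; field; rewrite gt_eqF.
by rewrite ler_pdivrMr// mulVf ?gt_eqF// gerBl exprn_ge0// n2_ge0.
Qed.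

Lemma inH2_geo z : n2 z < 1 -> inH2 (fun k => z ^+ k).
Proof. by move=> z1; apply: inH2_bound => n; exact: ssum_geo. Qed.

Lemma h2evalP x z : inH2 x -> n2 z < 1 ->
  ccvg (fun n => \sum_(k < n) x k * z ^+ k) (h2eval x z).
Proof.
move=> xH z1; have h := dotcP xH (inH2_geo z1).
by rewrite /h2eval (ccvg_lim h).
Qed.

Lemma h2eval_eq x z l : ccvg (fun n => \sum_(k < n) x k * z ^+ k) l ->
  h2eval x z = l.
Proof. exact: ccvg_lim. Qed.

Lemma h2eval_le x z : inH2 x -> n2 z < 1 ->
  n2 (h2eval x z) <= hn2 x / (1 - n2 z).
Proof.
move=> xH z1; have h := dotcP xH (inH2_geo z1).
rewrite /h2eval (ccvg_lim h); apply: (le_trans (dotc_le xH (inH2_geo z1))).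
rewrite ler_wpM2l ?hn2_ge0//; apply: hn2_le => n; exact: ssum_geo.
Qed.

Lemma h2evalD x y z : inH2 x -> inH2 y -> n2 z < 1 ->
  h2eval (fun k => x k + y k) z = h2eval x z + h2eval y z.
Proof.
move=> xH yH z1; apply: h2eval_eq.
under eq_fun do under eq_bigr do rewrite mulrDl.
under eq_fun do rewrite big_split /=.
by apply: ccvgD; exact: h2evalP.
Qed.

Lemma h2evalZ (c : C) x z : inH2 x -> n2 z < 1 ->
  h2eval (fun k => c * x k) z = c * h2eval x z.
Proof.
move=> xH z1; apply: h2eval_eq.
under eq_fun do under eq_bigr do rewrite -mulrA.
under eq_fun do rewrite -mulr_sumr.
by apply: ccvgM; [exact: ccvg_cst|exact: h2evalP].
Qed.

Lemma h2evalB x y z : inH2 x -> inH2 y -> n2 z < 1 ->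
  h2eval (fun k => x k - y k) z = h2eval x z - h2eval y z.
Proof.
move=> xH yH z1; have := h2evalD xH (inH2Z (-1) yH) z1.
rewrite h2evalZ// mulN1r => <-; congr h2eval.
by apply/funext => k; rewrite mulN1r.
Qed.

Lemma h2eval0 z : h2eval (fun=> 0 : C) z = 0.
Proof.
apply: h2eval_eq.
have -> : (fun n => \sum_(k < n) (0 : C) * z ^+ k) = fun=> 0.
  by apply/funext => n; rewrite big1// => k _; rewrite mul0r.
exact: ccvg_cst.
Qed.

Lemma h2eval_sum m (v : 'I_m -> seqC) z : (forall i, inH2 (v i)) -> n2 z < 1 ->
  h2eval (fun k => \sum_(i < m) v i k) z = \sum_(i < m) h2eval (v i) z.
Proof.
move=> vH z1; elim: m v vH => [|m IH] v vH.
  rewrite big_ord0 -[RHS](h2eval0 z); congr h2eval.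
  by apply/funext => k; rewrite big_ord0.
rewrite big_ord_recr /= -IH// -h2evalD//; last exact: inH2_sum.
by congr h2eval; apply/funext => k; rewrite big_ord_recr.
Qed.

Lemma h2eval_recl x z : inH2 x -> n2 z < 1 ->
  h2eval x z = x 0%N + z * h2eval (fun k => x k.+1) z.
Proof.
move=> xH z1; apply: h2eval_eq; apply: ccvg_unshift.
under eq_fun do rewrite big_ord_recl /= mulr1.
apply: ccvgD; first exact: ccvg_cst.
have -> : (fun n => \sum_(i < n) x (bump 0 i) * z ^+ bump 0 i) =
  (fun n => z * \sum_(i < n) x i.+1 * z ^+ i).
  apply/funext => n; rewrite mulr_sumr; apply: eq_bigr => i _.
  by rewrite /bump leq0n add1n exprS mulrCA.
by apply: ccvgM; [exact: ccvg_cst|apply: h2evalP => //; exact: inH2_shift].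
Qed.

(* The value at 0 is recovered from punctured neighbourhoods because the
   remainder [z * (shift x)(z)] is [O(|z|)] by Cauchy-Schwarz. *)
Lemma h2eval_eq0_head x : inH2 x ->
  (forall z, z != 0 -> n2 z < 1 -> h2eval x z = 0) -> x 0%N = 0.
Proof.
move=> xH x0; apply/eqP; rewrite -n2_eq0; apply/negPn/negP => N.
have h0 : 0 < n2 (x 0%N) by rewrite lt0r N n2_ge0.
have hM := hn2_ge0 (fun k => x k.+1).
(* The squared modulus of the test point: at most 1/2, so that 1 / (1 - t) <= 2, and small enough
   that 2 t times the squared norm of the shift stays below |x 0|^2. *)
pose t : R := n2 (x 0%N) / (2 * n2 (x 0%N) + 4 * hn2 (fun k => x k.+1)).
have den : 0 < 2 * n2 (x 0%N) + 4 * hn2 (fun k => x k.+1).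
  by rewrite ltr_wpDr ?mulr_ge0// mulr_gt0.
have t0 : 0 < t by rewrite divr_gt0.
have t1 : t <= 2^-1 by rewrite ler_pdivrMr// ; lra.
pose z : C := (Num.sqrt t)%:C%C.
have zt : n2 z = t by rewrite n2R sqr_sqrtr// ltW.
have z0 : z != 0 by rewrite -n2_eq0 zt gt_eqF.
have z1 : n2 z < 1 by rewrite zt; apply: (le_lt_trans t1); lra.
have := x0 z z0 z1; rewrite h2eval_recl// => /eqP; rewrite addr_eq0 => /eqP xE.
have := h2eval_le (inH2_shift xH) z1; rewrite zt => hle.
have h1 : n2 (x 0%N) = t * n2 (h2eval (fun k => x k.+1) z) by rewrite xE n2N n2M zt.
have : hn2 (fun k => x k.+1) / (1 - t) <= hn2 (fun k => x k.+1) * 2.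
  by rewrite ler_wpM2l// -[leRHS]invrK lef_pV2 ?posrE ?subr_gt0//; lra.
move=> /(le_trans hle) h2.
have : n2 (x 0%N) <= t * (hn2 (fun k => x k.+1) * 2) by rewrite {1}h1 ler_pM2l.
by rewrite /t mulrAC ler_pdivlMr//; nra.
Qed.

(** Coefficients are peeled off one at a time. Once the constant term vanishes, division by z is
    possible only off 0, whence the punctured form of the induction hypothesis. *)
Lemma h2_unique x y : inH2 x -> inH2 y ->
  (forall z, disk z -> h2eval x z = h2eval y z) -> x = y.
Proof.
move=> xH yH xy.
have dH := inH2B xH yH.
have H n : inH2 (fun k => x (n + k)%N - y (n + k)%N) /\
   forall z, z != 0 -> n2 z < 1 -> h2eval (fun k => x (n + k)%N - y (n + k)%N) z = 0.
  elim: n => [|n [IH1 IH2]].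
    by split => // z _ z1; rewrite h2evalB// xy ?subrr//; apply/diskE.
  have E : (fun k => x (n.+1 + k)%N - y (n.+1 + k)%N) =
     (fun k => x (n + k.+1)%N - y (n + k.+1)%N).
    by apply/funext => k; rewrite addSnnS.
  rewrite E; split; first exact: (inH2_shift IH1).
  move=> z z0 z1; have := IH2 z z0 z1; rewrite h2eval_recl//=.
  rewrite (h2eval_eq0_head IH1 IH2) add0r => /eqP.
  by rewrite mulf_eq0 (negbTE z0) => /eqP.
apply/funext => n; have [H1 H2] := H n.
by have /eqP := h2eval_eq0_head H1 H2; rewrite addn0 subr_eq0 => /eqP.
Qed.

(** * Multiplication by linear polynomials and by Moebius symbols *)

Definition pre x : seqC := fun k => if k is k'.+1 then x k' else 0.

Lemma ssum_pre n x : ssum n.+1 (pre x) = ssum n x.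
Proof. by rewrite ssum_recl n2_0 add0r. Qed.

Lemma ssum_pre_le n x : ssum n (pre x) <= ssum n x.
Proof. by case: n => [|n]; rewrite ?ssum0// ssum_pre ssumS lerDl n2_ge0. Qed.

Lemma inH2_pre x : inH2 x -> inH2 (pre x).
Proof.
move=> xH; apply: (@inH2_bound _ _ (hn2 x)) => n.
by apply: (le_trans (ssum_pre_le n x)); exact: ssum_hn2.
Qed.

Lemma h2eval_pre x z : inH2 x -> n2 z < 1 -> h2eval (pre x) z = z * h2eval x z.
Proof. by move=> xH z1; rewrite h2eval_recl ?add0r//; exact: inH2_pre. Qed.

(* Multiplication by [al * z + be]. *)
Definition lin (al be : C) x : seqC := fun k => al * pre x k + be * x k.

(* Formal division by [al * z + be]. *)
Fixpoint qlin (al be : C) x (k : nat) : C :=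
  if k is k'.+1 then (x k - al * qlin al be x k') / be else x 0%N / be.

Lemma inH2_lin al be x : inH2 x -> inH2 (lin al be x).
Proof. by move=> xH; apply: inH2D; apply: inH2Z => //; exact: inH2_pre. Qed.

Lemma h2eval_lin al be x z : inH2 x -> n2 z < 1 ->
  h2eval (lin al be x) z = (al * z + be) * h2eval x z.
Proof.
move=> xH z1; have pH := inH2_pre xH.
rewrite (h2evalD (inH2Z al pH) (inH2Z be xH) z1) (h2evalZ al pH z1).
by rewrite (h2evalZ be xH z1) h2eval_pre// mulrDl mulrA.
Qed.

Lemma lin_qlin al be x : be != 0 -> lin al be (qlin al be x) = x.
Proof.
move=> be0; apply/funext; case => [|k]; rewrite /lin /=.
  by rewrite mulr0 add0r mulrCA divff// mulr1.
by rewrite [be * _]mulrC divfK// addrC subrK.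
Qed.

Lemma qlinD al be x y :
  qlin al be (fun k => x k + y k) = (fun k => qlin al be x k + qlin al be y k).
Proof.
apply/funext; elim => [|k IH] /=; first by rewrite mulrDl.
rewrite IH; ring.
Qed.

Lemma qlinZ al be (c : C) x :
  qlin al be (fun k => c * x k) = (fun k => c * qlin al be x k).
Proof.
apply/funext; elim => [|k IH] /=; first by rewrite mulrA.
rewrite IH; ring.
Qed.

Lemma preD x y : pre (fun k => x k + y k) = (fun k => pre x k + pre y k).
Proof. by apply/funext; case => [|k]//=; rewrite addr0. Qed.

Lemma preZ (c : C) x : pre (fun k => c * x k) = (fun k => c * pre x k).
Proof. by apply/funext; case => [|k]//=; rewrite mulr0. Qed.

Lemma linD al be x y :
  lin al be (fun k => x k + y k) = (fun k => lin al be x k + lin al be y k).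
Proof. by apply/funext => k; rewrite /lin preD; ring. Qed.

Lemma linZ al be (c : C) x :
  lin al be (fun k => c * x k) = (fun k => c * lin al be x k).
Proof. by apply/funext => k; rewrite /lin preZ; ring. Qed.

(** A bound linear in |p|^2 and |q|^2, hence summable over the coefficients. With moduli in capitals
    it follows from |al p + be q| >= |B Q - A P|, the loss being A B (P - Q)^2. *)
Lemma n2_lin_ge (al be p q : C) : cabs al <= cabs be ->
  (cabs be - cabs al) * (cabs be * n2 q - cabs al * n2 p) <= n2 (al * p + be * q).
Proof.
move=> ab.
have h : (cabs (be * q) - cabs (al * p)) ^+ 2 <= n2 (al * p + be * q).
  rewrite -cabs_sqr.
  have h1 := cabsD (al * p + be * q) (- (al * p)).
  rewrite addrAC subrr add0r cabsN in h1.
  have h2 := cabsD (al * p + be * q) (- (be * q)).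
  rewrite addrK cabsN in h2.
  have := cabs_ge0 (al * p + be * q); nra.
apply: (le_trans _ h); rewrite !cabsM -!cabs_sqr -subr_ge0.
set A := cabs al; set B := cabs be; set P := cabs p; set Q := cabs q.
have -> : (B * Q - A * P) ^+ 2 - (B - A) * (B * Q ^+ 2 - A * P ^+ 2)
   = A * B * (P - Q) ^+ 2 by ring.
by apply: mulr_ge0; [apply: mulr_ge0; exact: cabs_ge0|exact: sqr_ge0].
Qed.

(** [n2_lin_ge] is summed and the shifted sum bounded by the sum itself. This makes formal division
    by al z + be bounded when |al| < |be|. *)
Lemma ssum_lin_ge n al be x : cabs al <= cabs be ->
  (cabs be - cabs al) ^+ 2 * ssum n x <= ssum n (lin al be x).
Proof.
move=> ab; apply: (@le_trans _ _ ((cabs be - cabs al) *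
    (cabs be * ssum n x - cabs al * ssum n (pre x)))).
  rewrite expr2 -mulrA ler_wpM2l ?subr_ge0// mulrBl lerD2l lerN2.
  by rewrite ler_wpM2l ?cabs_ge0// ssum_pre_le.
rewrite /ssum [cabs be * _]mulr_sumr [cabs al * _]mulr_sumr -sumrB mulr_sumr.
by apply: ler_sum => k _; exact: n2_lin_ge.
Qed.

Lemma ssum_lin_le n al be x :
  ssum n (lin al be x) <= 2 * (n2 al + n2 be) * ssum n x.
Proof.
apply: (le_trans (ssumD_le _ _ _)); rewrite !ssumZ.
by have := ler_wpM2l (n2_ge0 al) (ssum_pre_le n x); lra.
Qed.

Lemma hn2_lin_ge al be x : cabs al <= cabs be -> inH2 x ->
  (cabs be - cabs al) ^+ 2 * hn2 x <= hn2 (lin al be x).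
Proof.
move=> ab xH; apply: (@cvg_le_bound _ (fun n => (cabs be - cabs al) ^+ 2 * ssum n x)).
  by apply: cvgMr; exact: hn2_cvg.
move=> n; apply: (le_trans (ssum_lin_ge n x ab)).
exact: ssum_hn2 (inH2_lin _ _ xH).
Qed.

Lemma inH2_qlin al be x : cabs al < cabs be -> inH2 x -> inH2 (qlin al be x).
Proof.
move=> ab xH; have be0 : be != 0 by rewrite -cabs_gt0 (le_lt_trans _ ab)// cabs_ge0.
apply: (@inH2_bound _ _ (((cabs be - cabs al) ^+ 2)^-1 * hn2 x)) => n.
rewrite ler_pdivlMl ?exprn_gt0 ?subr_gt0//.
apply: (le_trans (ssum_lin_ge n _ (ltW ab))).
by rewrite lin_qlin//; exact: ssum_hn2.
Qed.

Lemma lin_neq0 al be z : cabs al < cabs be -> n2 z < 1 -> al * z + be != 0.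
Proof.
move=> ab z1; apply/negP; rewrite addrC addr_eq0 => /eqP beE.
have : cabs be <= cabs al.
  rewrite beE cabsN cabsM -[leRHS]mulr1 ler_wpM2l ?cabs_ge0//.
  by rewrite cabs_le// expr1n ltW.
by rewrite leNgt ab.
Qed.

Lemma h2eval_qlin al be x z : cabs al < cabs be -> inH2 x -> n2 z < 1 ->
  h2eval (qlin al be x) z = h2eval x z / (al * z + be).
Proof.
move=> ab xH z1; have be0 : be != 0 by rewrite -cabs_gt0 (le_lt_trans _ ab)// cabs_ge0.
have := h2eval_lin al be (inH2_qlin ab xH) z1; rewrite lin_qlin// => ->.
by rewrite mulrC mulKf// lin_neq0.
Qed.

Definition mobm (a b c d : C) x : seqC := lin a b (qlin c d x).

Lemma inH2_mobm a b c d x : cabs c < cabs d -> inH2 x -> inH2 (mobm a b c d x).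
Proof. by move=> cd xH; apply: inH2_lin; exact: inH2_qlin. Qed.

Lemma h2eval_mobm a b c d x z : cabs c < cabs d -> inH2 x -> n2 z < 1 ->
  h2eval (mobm a b c d x) z = flm a b c d z * h2eval x z.
Proof.
move=> cd xH z1; rewrite h2eval_lin ?h2eval_qlin//; last exact: inH2_qlin.
by rewrite /flm mulrAC mulrA.
Qed.

Lemma mobmD a b c d x y :
  mobm a b c d (fun k => x k + y k) =
  (fun k => mobm a b c d x k + mobm a b c d y k).
Proof. by rewrite /mobm qlinD linD. Qed.

Lemma mobmZ a b c d (s : C) x :
  mobm a b c d (fun k => s * x k) = (fun k => s * mobm a b c d x k).
Proof. by rewrite /mobm qlinZ linZ. Qed.

(** The right side is a Hermitian form in (p, q) whose cross coefficient is [e]; the cross term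
    costs at most m (|p|^2 + |q|^2). It serves both with (p, q) = (z, 1), for the self-map property,
    and with coefficients of a sequence. *)
Lemma n2_lin_diff (a b c d p q : C) (m : R) :
  cabs (conjc a * b - conjc c * d) <= m ->
  (n2 c - n2 a - m) * n2 p + (n2 d - n2 b - m) * n2 q <=
  n2 (c * p + d * q) - n2 (a * p + b * q).
Proof.
move=> hm; set e := conjc a * b - conjc c * d.
have -> : n2 (c * p + d * q) - n2 (a * p + b * q) =
  (n2 c - n2 a) * n2 p + (n2 d - n2 b) * n2 q - 2 * complex.Re (e * (conjc p * q)).
  by rewrite /e; case: a b c d p q {hm e} => [? ?] [? ?] [? ?] [? ?] [? ?] [? ?];
    rewrite /n2 /=; ring.
suff : 2 * complex.Re (e * (conjc p * q)) <= m * (n2 p + n2 q) by lra.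
have h1 := le_trans (ler_norm _) (Re_cabs (e * (conjc p * q))).
rewrite !cabsM cabsJ in h1.
have h2 : 2 * (cabs p * cabs q) <= n2 p + n2 q.
  by rewrite -!cabs_sqr; have := sqr_ge0 (cabs p - cabs q); nra.
have hp : 0 <= cabs p * cabs q by rewrite mulr_ge0 ?cabs_ge0.
have he := cabs_ge0 e.
apply: (@le_trans _ _ (m * (2 * (cabs p * cabs q)))).
  by rewrite [leRHS]mulrCA ler_pM2l//; apply: (le_trans h1); rewrite ler_wpM2r.
by rewrite ler_wpM2l// (le_trans he).
Qed.

(* The cross term is absorbed termwise by AM-GM, so no limit is needed. *)
Lemma ssum_mobm_le n a b c d x : cabs c < cabs d ->
  n2 c - n2 a <= n2 d - n2 b ->
  2 * cabs (conjc a * b - conjc c * d) <= (n2 c - n2 a) + (n2 d - n2 b) ->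
  ssum n (mobm a b c d x) <= ssum n x.
Proof.
move=> cd AD mAD; have d0 : d != 0 by rewrite -cabs_gt0 (le_lt_trans _ cd)// cabs_ge0.
rewrite -{2}(lin_qlin c x d0) /mobm; set u := qlin c d x.
rewrite -subr_ge0 /ssum -sumrB.
set m := cabs _ in mAD.
(* The first weight may be negative. With p <= q the two partial sums, the expression is (D - m)(q -
   p) + (A + D - 2m) p, a sum of nonnegative terms. *)
apply: (@le_trans _ _ ((n2 c - n2 a - m) * ssum n (pre u) + (n2 d - n2 b - m) * ssum n u)).
  have := ssum_pre_le n u; have := ssum_ge0 n (pre u); have := ssum_ge0 n u.
  set p := ssum n (pre u); set q := ssum n u => q0 p0 pq.
  have h0 : 0 <= n2 d - n2 b - m by lra.
  have h1 : 0 <= (n2 d - n2 b - m) * (q - p) by rewrite mulr_ge0// subr_ge0.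
  have h2 : 0 <= (n2 c - n2 a + (n2 d - n2 b) - 2 * m) * p by rewrite mulr_ge0// subr_ge0.
  lra.
rewrite /ssum !mulr_sumr -big_split /=; apply: ler_sum => k _.
exact: n2_lin_diff.
Qed.

(** * Blaschke factors and the splitting off of a reproducing kernel *)

Lemma n2_iso (w p q : C) :
  n2 (p - w * q) - n2 (q - conjc w * p) = (1 - n2 w) * (n2 p - n2 q).
Proof.
case: w p q => [? ?] [? ?] [? ?]; rewrite /n2 /=; ring.
Qed.

(** A telescoping sum of [n2_iso]: the two sequences have equal norms up to boundary terms. The term
    at 0 becomes the kernel component, the term at [n] tends to 0. *)
Lemma ssum_iso n w v :
  ssum n (fun k => v k - w * v k.+1) - ssum n (fun k => v k.+1 - conjc w * v k) =
  (1 - n2 w) * (n2 (v 0%N) - n2 (v n)).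
Proof.
elim: n => [|n IH]; first by rewrite !ssum0 !subrr mulr0.
rewrite !ssumS opprD addrACA IH n2_iso; ring.
Qed.

(** Multiplication by the Blaschke factor [bl w], an isometry of H^2 by [hn2_blm]. *)
Definition blm w x : seqC := mobm 1 (- w) (- conjc w) 1 x.

Definition bl w z : C := (z - w) / (1 - conjc w * z).

Lemma cabs_conj_lt1 w : n2 w < 1 -> cabs (- conjc w) < cabs 1.
Proof. by move=> w1; rewrite cabsN cabsJ cabs_lt ?cabs_ge0// cabs_sqr n2_1. Qed.

Lemma bl_flm w z : flm 1 (- w) (- conjc w) 1 z = bl w z.
Proof. by rewrite /flm /bl mul1r mulNr [- _ + 1]addrC. Qed.

Lemma inH2_blm w x : n2 w < 1 -> inH2 x -> inH2 (blm w x).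
Proof. by move=> w1; apply: inH2_mobm; exact: cabs_conj_lt1. Qed.

Lemma h2eval_blm w x z : n2 w < 1 -> inH2 x -> n2 z < 1 ->
  h2eval (blm w x) z = bl w z * h2eval x z.
Proof.
by move=> w1 xH z1; rewrite h2eval_mobm ?bl_flm//; exact: cabs_conj_lt1.
Qed.

(* The orthogonal decomposition of H^2 into the line of the reproducing kernel
   at [w] and the range of [blm w]. *)
Lemma hn2_decomp w (c : C) g : n2 w < 1 -> inH2 g ->
  inH2 (fun k => c * (conjc w) ^+ k + blm w g k) /\
  hn2 (fun k => c * (conjc w) ^+ k + blm w g k) = n2 c / (1 - n2 w) + hn2 g.
Proof.
move=> w1 gH; have q0 : 1 - n2 w != 0 by rewrite gt_eqF ?subr_gt0.
have cw : (1 - n2 w)%:C%C = 1 - w * conjc w.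
  by rewrite mulcJ rmorphB rmorph1.
have q0C : 1 - w * conjc w != 0 by rewrite -cw -n2_eq0 n2R sqrf_eq0.
set u := qlin (- conjc w) 1 g.
(* The geometric part of [v] cancels in v (k+1) - conj w v k, leaving [g], and contributes c' (1 -
   |w|^2) conj w^k = c conj w^k to v k - w v (k+1). *)
pose c' := c / (1 - w * conjc w).
pose v k := pre u k + c' * (conjc w) ^+ k.
have uH : inH2 u by apply: inH2_qlin => //; exact: cabs_conj_lt1.
have wJ : n2 (conjc w) < 1 by rewrite n2J.
have vH : inH2 v by apply: inH2D; [exact: inH2_pre|apply: inH2Z; exact: inH2_geo].
have gE : g = (fun k => v k.+1 - conjc w * v k).
  rewrite -(lin_qlin (- conjc w) g (oner_neq0 C)) -/u; apply/funext => k.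
  rewrite /lin /v /= exprS; ring.
have fE : (fun k => c * (conjc w) ^+ k + blm w g k) = (fun k => v k - w * v k.+1).
  apply/funext => k; rewrite /blm /mobm -/u /lin /v /= exprS /c'.
  by field.
have h := inH2_cvg0 vH.
have [fH fe] : inH2 (fun k => v k - w * v k.+1) /\
  hn2 (fun k => v k - w * v k.+1) = (1 - n2 w) * (n2 (v 0%N) - 0) + hn2 g.
  apply: hn2_eq.
  have -> : (fun n => ssum n (fun k => v k - w * v k.+1)) =
     fun n => (1 - n2 w) * (n2 (v 0%N) - n2 (v n)) + ssum n g.
    by apply/funext => n; rewrite -ssum_iso gE subrK.
  apply: (@cvgD R R^o); last exact: hn2_cvg.
  apply: (@cvgMr R); apply: (@cvgB R R^o) => //; exact: cvg_cst.
rewrite fE; split => //; rewrite fe subr0; congr (_ + _).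
rewrite /v /= add0r mulr1 /c' n2M n2V -cw n2R; field.
exact: q0.
Qed.

Lemma hn2_blm w g : n2 w < 1 -> inH2 g -> hn2 (blm w g) = hn2 g.
Proof.
move=> w1 gH; have [_] := hn2_decomp 0 w1 gH.
rewrite n2_0 mul0r add0r => <-; congr hn2.
by apply/funext => k; rewrite mul0r add0r.
Qed.

(* The inverse of the decomposition [hn2_decomp]. *)
Definition bdiv w f : seqC := fun k =>
  h2eval (fun j => f (k.+1 + j)%N) w - conjc w * h2eval (fun j => f (k + j)%N) w.

Lemma bdiv_tail w f k : n2 w < 1 -> inH2 f ->
  f k = h2eval (fun j => f (k + j)%N) w - w * h2eval (fun j => f (k.+1 + j)%N) w.
Proof.
move=> w1 fH; have [H _] := hn2_tail k fH.
rewrite [h2eval (fun j => f (k + j)%N) w]h2eval_recl// addn0.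
have -> : (fun j => f (k + j.+1)%N) = (fun j => f (k.+1 + j)%N).
  by apply/funext => j; rewrite addSnnS.
by rewrite addrK.
Qed.

(** With v k the value at [w] of the k-th tail of [f], the sequences [f] and [bdiv w f] are the two
    sides of [ssum_iso]; the boundary term at [n] vanishes because tails do. *)
Lemma bdiv_bound w f : n2 w < 1 -> inH2 f ->
  inH2 (bdiv w f) /\ hn2 (bdiv w f) <= hn2 f.
Proof.
move=> w1 fH; pose v k := h2eval (fun j => f (k + j)%N) w.
have fE : f = (fun k => v k - w * v k.+1).
  by apply/funext => k; rewrite /v -bdiv_tail.
have v0 : (fun n => n2 (v n)) @ \oo --> (0 : R).
  apply: (@cvg0_of_le _ _ (fun n => hn2 (fun j => f (n + j)%N) / (1 - n2 w))).
    by move=> n; rewrite n2_ge0 /=; have [H _] := hn2_tail n fH; exact: h2eval_le.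
  rewrite -(mul0r (1 - n2 w)^-1); apply: cvgM; last exact: cvg_cst.
  exact: hn2_tail_cvg0.
have [gH ge] : inH2 (bdiv w f) /\
    hn2 (bdiv w f) = hn2 f - (1 - n2 w) * (n2 (v 0%N) - 0).
  apply: hn2_eq.
  have -> : (fun n => ssum n (bdiv w f)) =
     fun n => ssum n f - (1 - n2 w) * (n2 (v 0%N) - n2 (v n)).
    by apply/funext => n; rewrite -ssum_iso -fE subKr.
  apply: (@cvgB R R^o); first exact: hn2_cvg.
  apply: (@cvgMr R); apply: (@cvgB R R^o) => //; exact: cvg_cst.
split => //; rewrite ge gerBl mulr_ge0 ?subr0 ?n2_ge0// subr_ge0 ltW//.
Qed.

Lemma bdiv_decomp w f : n2 w < 1 -> inH2 f ->
  f = (fun k => ((1 - n2 w)%:C%C * h2eval f w) * (conjc w) ^+ k + blm w (bdiv w f) k).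
Proof.
move=> w1 fH; pose v k := h2eval (fun j => f (k + j)%N) w.
have v0 : v 0%N = h2eval f w by [].
have uE k : qlin (- conjc w) 1 (bdiv w f) k = v k.+1 - v 0%N * (conjc w) ^+ k.+1.
  elim: k => [|k IH] /=.
    by rewrite divr1 /bdiv -/(v 1%N) -/(v 0%N) expr1 mulrC.
  rewrite divr1 IH /bdiv -/(v k.+2) -/(v k.+1) (exprS _ k.+1); ring.
have cw : (1 - n2 w)%:C%C = 1 - w * conjc w by rewrite mulcJ rmorphB rmorph1.
apply/funext => k; rewrite {1}(bdiv_tail k w1 fH) -/(v k) -/(v k.+1) -v0.
rewrite /blm /mobm /lin uE cw; case: k => [|k] /=.
  by rewrite mulr0 !expr0 expr1; ring.
rewrite uE !exprS; ring.
Qed.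

Lemma bdivD w f g : n2 w < 1 -> inH2 f -> inH2 g ->
  bdiv w (fun k => f k + g k) = (fun k => bdiv w f k + bdiv w g k).
Proof.
move=> w1 fH gH; apply/funext => k; rewrite /bdiv.
have [f1 _] := hn2_tail k fH; have [g1 _] := hn2_tail k gH.
have [f2 _] := hn2_tail k.+1 fH; have [g2 _] := hn2_tail k.+1 gH.
by rewrite !h2evalD//; ring.
Qed.

Lemma bdivZ w (c : C) f : n2 w < 1 -> inH2 f ->
  bdiv w (fun k => c * f k) = (fun k => c * bdiv w f k).
Proof.
move=> w1 fH; apply/funext => k; rewrite /bdiv.
have [f1 _] := hn2_tail k fH; have [f2 _] := hn2_tail k.+1 fH.
by rewrite !h2evalZ//; ring.
Qed.

End Evaluation.

(** * Boundedness of composition operators *)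

Section CompositionOperator.
Variable R : realType.
Local Notation C := R[i].
Local Notation seqC := (nat -> C).
Implicit Types (x y u v f g p : seqC) (z w : C) (phi psi : C -> C).

(** Existence is included because [compop] picks its value with [xget]; [compopP] transfers the
    properties to it. [M] bounds the squared norm. *)
Definition comp_bounded phi (M : R) := forall x, inH2 x -> exists y,
  [/\ inH2 y, hn2 y <= M * hn2 x & forall z, n2 z < 1 -> h2eval y z = h2eval x (phi z)].

Lemma compopP phi M x : comp_bounded phi M -> inH2 x ->
  [/\ inH2 (compop phi x), hn2 (compop phi x) <= M * hn2 x &
   forall z, n2 z < 1 -> h2eval (compop phi x) z = h2eval x (phi z)].
Proof.
move=> phiM xH; have [y [yH yM yE]] := phiM x xH.
suff -> : compop phi x = y by [].
have ex : [set y : seqC | inH2 y /\ forall z, disk z -> h2eval y z = h2eval x (phi z)] y.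
  by split; [exact: yH|move=> z /diskE z1; exact: yE z1].
have [H1 H2] := xgetPex (fun _ : nat => (0 : C)) (ex_intro _ y ex).
apply: (h2_unique H1 yH) => z z1; rewrite (H2 z z1); apply/esym/yE; exact/diskE.
Qed.

Lemma dotcD x y u : inH2 x -> inH2 y -> inH2 u ->
  dotc (fun k => x k + y k) u = dotc x u + dotc y u.
Proof.
move=> xH yH uH; apply: (ccvg_unique (dotcP (inH2D xH yH) uH)).
have := ccvgD (dotcP xH uH) (dotcP yH uH).
by under eq_fun do rewrite -big_split /=; under eq_fun do under eq_bigr do rewrite -mulrDl.
Qed.

Definition head n x : seqC := fun j => if (j < n)%N then x j else 0.
Definition tail n x : seqC := fun j => if (j < n)%N then 0 else x j.

Lemma head_tail n x : (fun j => head n x j + tail n x j) = x.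
Proof.
by apply/funext => j; rewrite /head /tail; case: ifP; rewrite ?addr0 ?add0r.
Qed.

Lemma sum_head n N x u : (n <= N)%N ->
  \sum_(j < N) head n x j * u j = \sum_(j < n) x j * u j.
Proof.
move=> nN; rewrite (big_ord_widen _ (fun j => x j * u j) nN) [RHS]big_mkcond /=.
by apply: eq_bigr => j _; rewrite /head; case: ifP; rewrite ?mul0r.
Qed.

Lemma ssum_head n N x : (n <= N)%N -> ssum N (head n x) = ssum n x.
Proof.
move=> nN; rewrite /ssum (big_ord_widen _ (fun j => n2 (x j)) nN) [RHS]big_mkcond /=.
by apply: eq_bigr => j _; rewrite /head; case: ifP; rewrite ?n2_0.
Qed.

Lemma ssum_head_tail n N x : ssum N x = ssum N (head n x) + ssum N (tail n x).
Proof.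
rewrite /ssum -big_split; apply: eq_bigr => j _ /=; rewrite /head /tail.
by case: ifP; rewrite n2_0 ?addr0 ?add0r.
Qed.

Lemma inH2_head n x : inH2 (head n x).
Proof.
apply: (@inH2_bound _ _ (ssum n x)) => N; have [nN|/ltnW nN] := leqP n N.
  by rewrite ssum_head.
by rewrite -(ssum_head x (leqnn n)); exact: ssum_homo.
Qed.

Lemma tail_bound n x : inH2 x -> inH2 (tail n x) /\ hn2 (tail n x) <= hn2 x - ssum n x.
Proof.
move=> xH; have h N : ssum N (tail n x) <= hn2 x - ssum n x.
  apply: (@le_trans _ _ (ssum (n + N) (tail n x))).
    by apply: ssum_homo; exact: leq_addl.
  have := ssum_head_tail n (n + N) x; rewrite ssum_head ?leq_addr//.
  by have := ssum_hn2 (n + N) xH; lra.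
by split; [exact: inH2_bound h|exact: hn2_le].
Qed.

Lemma dotc_head n x u : inH2 u -> dotc (head n x) u = \sum_(j < n) x j * u j.
Proof.
move=> uH; apply: (ccvg_unique (dotcP (inH2_head n x) uH)).
by split; apply: cvg_near_cst; exists n => // N /= nN; rewrite sum_head.
Qed.

(** Extension from polynomials to H^2, [F j] being the image of z^j. The bound on polynomials makes
    each sequence j |-> F j i square summable, so the i-th coefficient of the image of x is a
    convergent pairing; evaluation is checked by letting the tail of x tend to 0. *)
Lemma comp_bounded_ext phi (M : R) (F : nat -> seqC) : 0 <= M ->
  (forall j, inH2 (F j)) ->
  (forall j z, n2 z < 1 -> h2eval (F j) z = phi z ^+ j) ->
  (forall n p, hn2 (fun i => \sum_(j < n) p j * F j i) <= M * ssum n p) ->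
  comp_bounded phi M.
Proof.
move=> M0 FH FE FM x xH.
have sumH n p : inH2 (fun i => \sum_(j < n) p j * F j i).
  by apply: (@inH2_sum _ n (fun j k => p j * F j k)) => j; exact: inH2Z.
have colM i n : ssum n (fun j => F j i) <= M.
  set s := ssum _ _; have s0 : 0 <= s := ssum_ge0 _ _.
  (* Testing against the conjugate of the column turns the bound into s^2 <= M s. *)
  pose p j := conjc (F j i).
  have : n2 (\sum_(j < n) p j * F j i) <= M * ssum n p.
    apply: le_trans (FM n p); have := ssum_hn2 i.+1 (sumH n p).
    by apply: le_trans; rewrite ssumS lerDr ssum_ge0.
  have -> : \sum_(j < n) p j * F j i = s%:C%C.
    by rewrite /s /ssum rmorph_sum; apply: eq_bigr => j _; rewrite /p mulrC mulcJ.
  have -> : ssum n p = s by apply: eq_bigr => j _; rewrite n2J.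
  rewrite n2R expr2; case: (ltgtP 0 s) s0 => // [s0 _|<- _ _//].
  by rewrite ler_pM2r.
have colH i : inH2 (fun j => F j i) by apply: inH2_bound => n; exact: colM.
pose Y q : seqC := fun i => dotc q (fun j => F j i).
have YM q : inH2 q -> inH2 (Y q) /\ hn2 (Y q) <= M * hn2 q.
  move=> qH.
  suff h I : ssum I (Y q) <= M * hn2 q by split; [exact: inH2_bound h|exact: hn2_le].
  apply: (@cvg_le_bound _ (fun N => ssum I (fun i => \sum_(j < N) q j * F j i))).
    elim: I => [|I IH].
      by under eq_fun do rewrite ssum0; rewrite ssum0; exact: cvg_cst.
    under eq_fun do rewrite ssumS; rewrite ssumS; apply: (@cvgD R R^o) => //.
    by apply: n2_ccvg; exact: dotcP.
  move=> N; apply: (le_trans (ssum_hn2 _ (sumH N q))); apply: (le_trans (FM N q)).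
  by rewrite ler_wpM2l// ssum_hn2.
have [yH yM] := YM x xH; exists (Y x); split; [exact: yH|exact: yM|move=> z z1].
apply/esym/h2eval_eq/ccvg_of_n2.
apply: (@cvg0_of_le _ _ (fun n => M / (1 - n2 z) * (hn2 x - ssum n x))); last first.
  rewrite -(mulr0 (M / (1 - n2 z))); apply: (@cvgMr R).
  rewrite -(subrr (hn2 x)); apply: (@cvgB R R^o); [exact: cvg_cst|exact: hn2_cvg].
move=> n; rewrite n2_ge0 /=.
have [tH tM] := tail_bound n xH.
have YE : Y x = fun i => \sum_(j < n) x j * F j i + Y (tail n x) i.
  apply/funext => i; rewrite /Y -{1}(head_tail n x) dotcD ?dotc_head//.
  exact: inH2_head.
have [tYH tYM] := YM _ tH.
rewrite YE h2evalD// (h2eval_sum (v := fun (j : 'I_n) k => x j * F j k))//; last first.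
  by move=> j; exact: inH2Z.
have -> : \sum_(i < n) h2eval (fun k : nat => x i * F i k) z = \sum_(k < n) x k * phi z ^+ k.
  by apply: eq_bigr => j _; rewrite h2evalZ// FE.
rewrite addrAC subrr add0r; apply: (le_trans (h2eval_le tYH z1)).
rewrite mulrAC ler_wpM2r ?invr_ge0 ?subr_ge0 ?(ltW z1)//.
by apply: (le_trans tYM); rewrite ler_wpM2l.
Qed.

Definition delta0 : seqC := fun k => if k is 0%N then 1 else 0.

Lemma inH2_delta0 : inH2 delta0.
Proof.
apply: (@inH2_bound _ _ 1) => -[|n]; first by rewrite ssum0.
by rewrite ssum_recl n2_1 /ssum big1 ?addr0// => k _; rewrite n2_0.
Qed.

Lemma h2eval_delta0 z : n2 z < 1 -> h2eval delta0 z = 1.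
Proof.
by move=> z1; rewrite (h2eval_recl inH2_delta0 z1) /= h2eval0 mulr0 addr0.
Qed.

(* Littlewood's subordination principle for a fractional linear map fixing 0. *)
Lemma comp_bounded_fix0 (a c d : C) : cabs c < cabs d ->
  n2 c - n2 a <= n2 d ->
  2 * cabs (conjc c * d) <= (n2 c - n2 a) + n2 d ->
  comp_bounded (flm a 0 c d) 1.
Proof.
move=> cd AD mAD.
pose F j := iter j (mobm a 0 c d) delta0.
have FH j : inH2 (F j).
  by elim: j => [|j IH]; [exact: inH2_delta0|exact: inH2_mobm].
apply: (@comp_bounded_ext _ _ F) => //.
  move=> j z z1; elim: j => [|j IH]; first by rewrite h2eval_delta0.
  by rewrite [F _.+1]/= h2eval_mobm// IH exprS.
move=> n p; rewrite mul1r; apply: hn2_le; elim: n p => [|n IH] p N.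
  rewrite ssum0 /ssum big1// => k _; by rewrite big_ord0 n2_0.
(* Horner's scheme: the combination is p 0 plus [mobm] applied to [X]. The symbol vanishes at 0, so
   the squared norms add up, and [mobm] is a contraction. *)
pose X i := \sum_(j < n) p j.+1 * F j i.
have mX : mobm a 0 c d X = fun i => \sum_(j < n) p j.+1 * F j.+1 i.
  rewrite /X; elim: (n) => [|k IHk].
    apply/funext => i; rewrite big_ord0.
    have := mobmZ a 0 c d 0 delta0; under eq_fun do rewrite mul0r.
    have -> : (fun i : nat => \sum_(j < 0) p j.+1 * F j i) = fun=> 0.
      by apply/funext => ?; rewrite big_ord0.
    by move=> ->; rewrite mul0r.
  under eq_fun do rewrite big_ord_recr /=.
  rewrite mobmD IHk mobmZ; apply/funext => i; by rewrite big_ord_recr.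
have -> : (fun i => \sum_(j < n.+1) p j * F j i) =
    (fun i => p 0%N * delta0 i + mobm a 0 c d X i).
  by apply/funext => i; rewrite big_ord_recl mX.
case: N => [|N]; first by rewrite ssum0 ssum_ge0.
rewrite ssum_recl [leRHS]ssum_recl /= mulr1.
have -> : mobm a 0 c d X 0 = 0 by rewrite /mobm /lin /= mulr0 mul0r addr0.
rewrite addr0 lerD2l.
under [X in ssum _ X]eq_fun do rewrite mulr0 add0r.
apply: (le_trans (ssum_shift_le _ _)).
apply: (le_trans _ (IH (fun k => p k.+1) N.+1)).
apply: ssum_mobm_le => //; first by rewrite n2_0 subr0.
by rewrite mulr0 sub0r cabsN n2_0 subr0.
Qed.

(** The Takenaka-Malmquist system with one repeated pole, not normalised: every member has squared
    norm 1 / (1 - |w|^2). *)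
Definition kbl w j : seqC := iter j (blm w) (fun k => conjc w ^+ k).

Lemma inH2_kbl w j : n2 w < 1 -> inH2 (kbl w j).
Proof.
move=> w1; elim: j => [|j IH]; first by apply: inH2_geo; rewrite n2J.
exact: inH2_blm.
Qed.

Lemma h2eval_kernel w z : n2 w < 1 -> n2 z < 1 ->
  h2eval (fun k => conjc w ^+ k) z = (1 - conjc w * z)^-1.
Proof.
move=> w1 z1; have h := h2eval_qlin (cabs_conj_lt1 w1) inH2_delta0 z1.
rewrite h2eval_delta0// div1r mulNr [- _ + 1]addrC in h; rewrite -h.
congr h2eval; apply/funext => k; elim: k => [|k IH] /=; first by rewrite divr1.
by rewrite -IH exprS divr1; ring.
Qed.

Lemma h2eval_kbl w j z : n2 w < 1 -> n2 z < 1 ->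
  h2eval (kbl w j) z = bl w z ^+ j / (1 - conjc w * z).
Proof.
move=> w1 z1; elim: j => [|j IH]; first by rewrite mul1r h2eval_kernel.
by rewrite [kbl _ _.+1]/= h2eval_blm ?IH ?exprS ?mulrA//; exact: inH2_kbl.
Qed.

Lemma blm_sum w n (q : seqC) (F : nat -> seqC) :
  blm w (fun i => \sum_(j < n) q j * F j i) =
  fun i => \sum_(j < n) q j * blm w (F j) i.
Proof.
elim: n => [|k IHk].
  apply/funext => i; rewrite big_ord0.
  have := mobmZ 1 (- w) (- conjc w) 1 0 delta0; under eq_fun do rewrite mul0r.
  have -> : (fun i : nat => \sum_(j < 0) q j * F j i) = fun=> 0.
    by apply/funext => ?; rewrite big_ord0.
  by rewrite /blm => ->; rewrite mul0r.
under eq_fun do rewrite big_ord_recr /=.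
rewrite {1}/blm mobmD mobmZ -/(blm _ _) IHk; apply/funext => i.
by rewrite big_ord_recr.
Qed.

(** Orthogonality without an inner product: by Horner's scheme the combination is a multiple of the
    kernel plus [blm w] of a shorter one, and [hn2_decomp] adds the norms. *)
Lemma hn2_kbl w n p : n2 w < 1 ->
  inH2 (fun i => \sum_(j < n) p j * kbl w j i) /\
  hn2 (fun i => \sum_(j < n) p j * kbl w j i) = ssum n p / (1 - n2 w).
Proof.
move=> w1; split.
  apply: (@inH2_sum _ n (fun j k => p j * kbl w j k)) => j.
  by apply: inH2Z; exact: inH2_kbl.
elim: n p => [|n IH] p.
  rewrite ssum0 mul0r; apply/eqP; rewrite eq_le hn2_ge0 andbT; apply: hn2_le => N.
  by rewrite /ssum big1// => k _; rewrite big_ord0 n2_0.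
have H : inH2 (fun i => \sum_(j < n) p j.+1 * kbl w j i).
  apply: (@inH2_sum _ n (fun j k => p j.+1 * kbl w j k)) => j.
  by apply: inH2Z; exact: inH2_kbl.
have -> : (fun i => \sum_(j < n.+1) p j * kbl w j i) =
    (fun i => p 0%N * conjc w ^+ i + blm w (fun i => \sum_(j < n) p j.+1 * kbl w j i) i).
  by apply/funext => i; rewrite big_ord_recl (blm_sum w n (fun j => p j.+1)).
have [_ ->] := hn2_decomp (p 0%N) w1 H.
by rewrite (IH (fun j => p j.+1)) ssum_recl -mulrDl.
Qed.

(** The power bl w^j is (1 - conj w z) times [kbl w j]. The constant is the product of the bound for
    multiplication by 1 - conj w z and of the squared norm 1 / (1 - |w|^2). *)
Lemma comp_bounded_bl w : n2 w < 1 ->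
  comp_bounded (bl w) (2 * (n2 w + 1) / (1 - n2 w)).
Proof.
move=> w1; have q0 : 0 < 1 - n2 w by rewrite subr_gt0.
pose F j := lin (- conjc w) 1 (kbl w j).
apply: (@comp_bounded_ext _ _ F).
- by rewrite divr_ge0 ?(ltW q0)// mulr_ge0// addr_ge0// n2_ge0.
- by move=> j; apply: inH2_lin; exact: inH2_kbl.
- move=> j z z1; rewrite h2eval_lin ?h2eval_kbl//; last exact: inH2_kbl.
  have := lin_neq0 (cabs_conj_lt1 w1) z1; rewrite mulNr [- _ + 1]addrC => h.
  by rewrite mulrCA divff// mulr1.
- move=> n p; have [H HE] := hn2_kbl n p w1.
  apply: hn2_le => N.
  have -> : (fun i => \sum_(j < n) p j * F j i) =
     lin (- conjc w) 1 (fun i => \sum_(j < n) p j * kbl w j i).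
    rewrite /F; elim: (n) => [|k IHk].
      apply/funext => -[|i]; rewrite /lin /= !big_ord0 ?mulr0 ?addr0//.
    under [in RHS]eq_fun do rewrite big_ord_recr /=.
    by rewrite linD linZ -IHk; apply/funext => i; rewrite big_ord_recr.
  apply: (le_trans (ssum_lin_le _ _ _ _)).
  rewrite n2N n2J n2_1 -[leRHS]mulrA [_^-1 * _]mulrC -HE.
  apply: ler_wpM2l; last exact: ssum_hn2.
  by rewrite mulr_ge0// addr_ge0// n2_ge0.
Qed.

Lemma comp_bounded_comp phi psi (M N : R) : 0 <= M ->
  (forall z, n2 z < 1 -> n2 (phi z) < 1) ->
  comp_bounded phi M -> comp_bounded psi N -> comp_bounded (psi \o phi) (M * N).
Proof.
move=> M0 phiD phiM psiN x xH.
have [y [yH yN yE]] := psiN x xH; have [u [uH uM uE]] := phiM y yH.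
exists u; split; first exact: uH.
  by apply: (le_trans uM); rewrite -mulrA ler_wpM2l.
by move=> z z1; rewrite (uE z z1) (yE _ (phiD z z1)).
Qed.

Lemma comp_bounded_eq phi psi (M : R) : (forall z, n2 z < 1 -> phi z = psi z) ->
  comp_bounded phi M -> comp_bounded psi M.
Proof.
move=> E h x xH; have [y [yH yN yE]] := h x xH; exists y; split; [exact: yH|exact: yN|move=> z z1].
by rewrite (yE z z1) E.
Qed.

End CompositionOperator.

(** * Fractional linear self-maps of the disk *)

Section FractionalLinear.
Variable R : realType.
Local Notation C := R[i].
Local Notation seqC := (nat -> C).
Implicit Types (a b c d z w s : C).

(* Non-constant fractional linear self-maps of the disk. *)
Definition good a b c d := [/\ cabs c < cabs d, n2 c - n2 a <= n2 d - n2 b,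
  2 * cabs (conjc a * b - conjc c * d) <= (n2 c - n2 a) + (n2 d - n2 b) &
  a * d - b * c != 0].

(** The Hermitian form of [n2_lin_diff] is the pullback of a form of signature (1,1) by the matrix,
    so its determinant A D - m^2 equals -|ad - bc|^2. *)
Lemma n2_mu a b c d : n2 (conjc a * b - conjc c * d) =
  (n2 c - n2 a) * (n2 d - n2 b) + n2 (a * d - b * c).
Proof.
by case: a b c d => [? ?] [? ?] [? ?] [? ?]; rewrite /n2 /=; ring.
Qed.

(** Otherwise A <= D <= m and 2m <= A + D force A = D = m, and [n2_mu] makes the determinant of the
    map vanish. *)
Lemma good_D a b c d : good a b c d ->
  cabs (conjc a * b - conjc c * d) < n2 d - n2 b.
Proof.
move=> [cd AD mAD D0].
have := n2_mu a b c d; rewrite -cabs_sqr.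
set m := cabs _ in mAD *; set A := n2 c - n2 a in AD mAD *; set D := n2 d - n2 b in AD mAD *.
have : 0 < n2 (a * d - b * c) by rewrite n2_gt0.
move: (n2 _) => q q0 mE; have m0 : 0 <= m := cabs_ge0 _.
rewrite ltNge; apply/negP => Dm.
have E1 : D = m by lra.
have E2 : A = m by lra.
by rewrite E1 E2 in mE; nra.
Qed.

(** Bounding m below by the triangle inequality gives |a| + |b| <= |c| + |d| and |b| - |a| <= |d| -
    |c|, whose combination is [AD]. If |c| = |d|, then |a| = |b| and m <= |c|^2 - |a|^2, against
    [n2_mu]. *)
Lemma good_hyp a b c d :
  cabs a ^+ 2 + cabs b ^+ 2 + 2 * cabs (conjc a * b - conjc c * d)
    <= cabs c ^+ 2 + cabs d ^+ 2 ->
  cabs c <= cabs d -> a * d - b * c != 0 -> good a b c d.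
Proof.
move=> h cd D0.
have h1 : cabs a * cabs b - cabs c * cabs d <= cabs (conjc a * b - conjc c * d).
  have := cabsD (conjc a * b - conjc c * d) (conjc c * d).
  by rewrite subrK !cabsM !cabsJ; lra.
have h2 : cabs c * cabs d - cabs a * cabs b <= cabs (conjc a * b - conjc c * d).
  have := cabsD (conjc c * d - conjc a * b) (conjc a * b).
  by rewrite subrK !cabsM !cabsJ -[cabs (_ * _ - _)]cabsN opprB; lra.
have := n2_mu a b c d.
have a0 := cabs_ge0 a; have b0 := cabs_ge0 b; have c0 := cabs_ge0 c; have d0 := cabs_ge0 d.
have q0 : 0 < n2 (a * d - b * c) by rewrite n2_gt0.
rewrite /good -!cabs_sqr; move: q0; rewrite -cabs_sqr.
move: h h1 h2 (cabs_ge0 (conjc a * b - conjc c * d)) cd a0 b0 c0 d0.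
move: (cabs (_ - _)) (cabs (_ - _)) (cabs a) (cabs b) (cabs c) (cabs d) => m q A B C' D.
move=> h h1 h2 m0 cd A0 B0 C0 D0' q0 mE.
have k1 : A + B <= C' + D by rewrite -(@ler_pXn2r _ 2) ?nnegrE ?addr_ge0//; nra.
have k2 : B - A <= D - C'.
  have [BA|BA] := leP B A; first by lra.
  by rewrite -(@ler_pXn2r _ 2) ?nnegrE ?subr_ge0//; [nra|exact: ltW].
have AD : C' ^+ 2 - A ^+ 2 <= D ^+ 2 - B ^+ 2 by nra.
split => //; last by lra.
rewrite lt_neqAle cd andbT; apply/negP => /eqP CD.
have AB : A = B.
  by apply/eqP; rewrite -subr_eq0 -sqrf_eq0 -(rwP eqP); nra.
rewrite CD AB in mE h; nra.
Qed.

Lemma good_cz a b c d z : good a b c d -> n2 z < 1 -> c * z + d != 0.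
Proof. by move=> [cd _ _ _]; exact: lin_neq0. Qed.

(** The lower bound (A - m)|z|^2 + (D - m) of [n2_lin_diff] is affine in |z|^2, positive at 0 by
    [good_D] and nonnegative at 1. *)
Lemma good_disk a b c d z : good a b c d -> n2 z < 1 -> n2 (flm a b c d z) < 1.
Proof.
move=> G z1; have mD := good_D G; have cz := good_cz G z1.
have [_ AD mAD _] := G.
rewrite /flm n2M n2V ltr_pdivrMr ?n2_gt0// mul1r -subr_gt0.
have := @n2_lin_diff _ a b c d z 1 _ (lexx _); rewrite !mulr1 n2_1 mulr1.
apply: lt_le_trans; have := n2_ge0 z.
by move: (cabs _) (n2 z) z1 mD mAD AD => m r z1 mD mAD AD r0; nra.
Qed.

(** Post-composition with [bl w] turns the matrix into (a - w c, b - w d; c - conj w a, d - conj w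
    b). By this lemma, [transv_det] and [transv_mu], the quantities A, D, the determinant and the
    cross coefficient are all multiplied by 1 - |w|^2. *)
Lemma n2_transv (w p q : C) :
  n2 (q - conjc w * p) - n2 (p - w * q) = (1 - n2 w) * (n2 q - n2 p).
Proof. by rewrite -[LHS]opprB n2_iso -mulrN opprB. Qed.

Lemma RC1B w : (1 - n2 w)%:C%C = 1 - w * conjc w.
Proof. by rewrite mulcJ rmorphB rmorph1. Qed.

Lemma transv_det a b c d w :
  (a - w * c) * (d - conjc w * b) - (b - w * d) * (c - conjc w * a)
  = (1 - n2 w)%:C%C * (a * d - b * c).
Proof. by rewrite RC1B; ring. Qed.

Lemma transv_mu a b c d w :
  conjc (a - w * c) * (b - w * d) - conjc (c - conjc w * a) * (d - conjc w * b)
  = (1 - n2 w)%:C%C * (conjc a * b - conjc c * d).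
Proof. by rewrite RC1B !rmorphB !rmorphM /= conjcK; ring. Qed.

Lemma cabsR (x : R) : 0 <= x -> cabs x%:C%C = x.
Proof. by move=> x0; rewrite cabsE n2R sqrtr_sqr ger0_norm. Qed.

Lemma one_subM_neq0 z w : n2 z < 1 -> n2 w < 1 -> 1 - conjc w * z != 0.
Proof.
move=> z1 w1; have := lin_neq0 (cabs_conj_lt1 w1) z1.
by rewrite mulNr [- _ + 1]addrC.
Qed.

(** With w the value of the map at 0, the map is [bl (- w)] after a map fixing 0. The common factor
    1 - |w|^2 of the [transv] lemmas preserves the hypotheses of [comp_bounded_fix0]. *)
Lemma good_bounded a b c d : good a b c d ->
  exists M, 0 < M /\ comp_bounded (flm a b c d) M.
Proof.
move=> G; have mD := good_D G; have [cd AD mAD D0] := G.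
have d0 : d != 0 by rewrite -cabs_gt0 (le_lt_trans _ cd)// cabs_ge0.
set w := b / d; have wd : w * d = b by rewrite divfK.
have z0 : n2 (0 : C) < 1 by rewrite n2_0.
have w1 : n2 w < 1.
  by have := good_disk G z0; rewrite /flm !mulr0 !add0r.
have q0 : 0 < 1 - n2 w by rewrite subr_gt0.
set a0 := a - w * c; set c0 := c - conjc w * a; set d0' := d - conjc w * b.
have bE : b - w * d = 0 by rewrite wd subrr.
have A0 : n2 c0 - n2 a0 = (1 - n2 w) * (n2 c - n2 a) by rewrite n2_transv.
have B0 : n2 d0' = (1 - n2 w) * (n2 d - n2 b).
  by rewrite -n2_transv bE n2_0 subr0.
have m0 : cabs (conjc c0 * d0') = (1 - n2 w) * cabs (conjc a * b - conjc c * d).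
  have := transv_mu a b c d w; rewrite bE mulr0 sub0r => h.
  by rewrite -cabsN h cabsM cabsR// ltW.
have det0 : a0 * d0' = (1 - n2 w)%:C%C * (a * d - b * c).
  by rewrite -transv_det bE mul0r subr0.
have a00 : 0 < n2 a0.
  rewrite n2_gt0; apply/eqP => a00; move/eqP: det0.
  by rewrite a00 mul0r eq_sym mulf_eq0 (negbTE D0) orbF -n2_eq0 n2R sqrf_eq0 gt_eqF.
have h1 : n2 c0 - n2 a0 <= n2 d0' by rewrite A0 B0 ler_pM2l.
have h2 : 2 * cabs (conjc c0 * d0') <= (n2 c0 - n2 a0) + n2 d0'.
  by rewrite A0 B0 m0 mulrCA -mulrDr ler_pM2l.
have c0d0 : cabs c0 < cabs d0'.
  have d00 : 0 < cabs d0'.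
    by rewrite cabs_gt0 -n2_gt0 B0 mulr_gt0// (le_lt_trans _ mD)// cabs_ge0.
  have a0p : 0 < cabs a0 by rewrite cabs_gt0 -n2_gt0.
  move: h1 h2; rewrite cabsM cabsJ -!cabs_sqr.
  have := cabs_ge0 c0; move: (cabs a0) (cabs c0) (cabs d0') a0p d00.
  move=> x y u x0 u0 y0 k1 k2; rewrite ltNge; apply/negP => uy.
  have k3 : x <= y - u by rewrite -(@ler_pXn2r _ 2) ?nnegrE ?subr_ge0 ?(ltW x0)//; lra.
  have : 0 < u * x by rewrite mulr_gt0.
  by nra.
have w1N : n2 (- w) < 1 by rewrite n2N.
pose M := 1 * (2 * (n2 (- w) + 1) / (1 - n2 (- w))).
have B1 : comp_bounded (bl (- w) \o flm a0 0 c0 d0') M.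
  apply: comp_bounded_comp => //; last 2 first.
  - exact: comp_bounded_fix0.
  - exact: comp_bounded_bl.
  move=> z z1; apply: good_disk => //; split => //; rewrite ?n2_0 ?subr0//.
    by rewrite mulr0 sub0r cabsN.
  rewrite mul0r subr0 det0 mulf_neq0// -n2_eq0 n2R sqrf_eq0 gt_eqF//.
exists M; split.
  rewrite /M mul1r divr_gt0// ?n2N// mulr_gt0// ltr_wpDl// n2_ge0//.
apply: comp_bounded_eq B1 => z z1 /=.
have cz := good_cz G z1.
have c0z : c0 * z + d0' != 0 by exact: lin_neq0.
rewrite /flm addr0 /bl opprK rmorphN mulNr opprK.
have e0 : (1 - n2 w)%:C%C != 0 :> C by rewrite -n2_eq0 n2R sqrf_eq0 gt_eqF.
have E1 : 1 + conjc w * (a0 * z / (c0 * z + d0')) =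
   (1 - n2 w)%:C%C * (c * z + d) / (c0 * z + d0').
  have h : conjc w * (a0 * z / (c0 * z + d0')) * (c0 * z + d0') = conjc w * (a0 * z).
    by rewrite -mulrA divfK.
  apply: (mulIf c0z); rewrite mulrDl mul1r h divfK// /c0 /d0' /a0.
  by rewrite RC1B -wd; ring.
have E2 : a0 * z / (c0 * z + d0') + w =
   (1 - n2 w)%:C%C * (a * z + b) / (c0 * z + d0').
  apply: (mulIf c0z); rewrite mulrDl !divfK// /c0 /d0' /a0.
  rewrite RC1B -wd; ring.
rewrite E1 E2; move: c0z cz e0; clear.
move: (a * z + b) (c * z + d) (c0 * z + d0') (1 - n2 w)%:C%C => p q X e X0 q0 e0.
by field; rewrite X0 q0 e0.
Qed.

(** Precomposition with z |-> t z multiplies A by t^2 and m by t. Since t^2 A + D - t (A + D) = (1 -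
    t)(D - t A) > 0, strictness is gained even from a tangent map. *)
Lemma good_dil a b c d (t : R) : good a b c d -> 0 < t -> t < 1 ->
  good (t%:C%C * a) b (t%:C%C * c) d /\
  2 * cabs (conjc (t%:C%C * a) * b - conjc (t%:C%C * c) * d) <
   (n2 (t%:C%C * c) - n2 (t%:C%C * a)) + (n2 d - n2 b).
Proof.
move=> G t0 t1; have mD := good_D G; have [cd AD mAD D0] := G.
have E : cabs (conjc (t%:C%C * a) * b - conjc (t%:C%C * c) * d) =
   t * cabs (conjc a * b - conjc c * d).
  rewrite -[in RHS](cabsR (ltW t0)) -cabsM; congr cabs.
  by rewrite !conjcM conjcR; ring.
have m0 := cabs_ge0 (conjc a * b - conjc c * d).
rewrite !n2M n2R E.
have str : 2 * (t * cabs (conjc a * b - conjc c * d)) <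
   t ^+ 2 * n2 c - t ^+ 2 * n2 a + (n2 d - n2 b).
  rewrite -mulrBr; move: (cabs _) (n2 c - n2 a) (n2 d - n2 b) mD AD mAD m0.
  move=> m A D mD AD mAD m0.
  apply: (@le_lt_trans _ _ (t * (A + D))); first by rewrite mulrCA ler_pM2l.
  have : 0 < (1 - t) * (D - A * t).
    rewrite mulr_gt0 ?subr_gt0//; have [A0|A0] := leP A 0; last by nra.
    by apply: (@le_lt_trans _ _ 0); [nra|lra].
  by lra.
split => //; split.
- rewrite cabsM cabsR ?(ltW t0)//; apply: le_lt_trans cd.
  by rewrite ler_piMl ?cabs_ge0// ltW.
- rewrite !n2M n2R -mulrBr.
  move: (n2 c - n2 a) (n2 d - n2 b) mD AD => A D mD AD.
  have D0' : 0 < D by apply: le_lt_trans mD.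
  have [A0|A0] := leP A 0; first by nra.
  apply: le_trans AD; rewrite ler_piMl ?(ltW A0)// expr_le1// ltW//.
- by rewrite E !n2M n2R ltW.
- have -> : t%:C%C * a * d - b * (t%:C%C * c) = t%:C%C * (a * d - b * c) by ring.
  by rewrite mulf_neq0// -n2_eq0 n2R sqrf_eq0 gt_eqF.
Qed.

(* [s], [w] are the points whose reflections across the unit circle are
   exchanged by the map: [phi s = w] and [phi (1 / conj s) = 1 / conj w]; in the
   coordinates [bl s], [bl w] the map is the multiplication by [rho]. *)
Lemma good_center a b c d : good a b c d ->
  2 * cabs (conjc a * b - conjc c * d) < (n2 c - n2 a) + (n2 d - n2 b) ->
  exists s w P Q : C,
  [/\ [/\ n2 s < 1, n2 w < 1, P != 0, Q != 0 & n2 P < n2 Q],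
    [/\ a - w * c = P, b - w * d = - s * P, d - conjc w * b = Q &
        c - conjc w * a = - conjc s * Q] &
    cabs P * cabs Q * (n2 d - n2 b - (n2 c - n2 a)) =
    cabs (a * d - b * c) * (n2 P + n2 Q)].
Proof.
move=> G str; have mD := good_D G; have [cd AD mAD D0] := G.
set mu := conjc c * d - conjc a * b.
have muE : cabs mu = cabs (conjc a * b - conjc c * d) by rewrite -cabsN opprB.
rewrite -muE in str mD mAD.
set L := (n2 c - n2 a) + (n2 d - n2 b) in str.
(* The root of the discriminant of the equation [quad] for conj s. The solution in the disk is
   written as -2 mu / (L + e), which avoids dividing by [mu]. *)
pose e := Num.sqrt (L ^+ 2 - 4 * n2 mu).
have m0 := cabs_ge0 mu.
have e2 : e ^+ 2 = L ^+ 2 - 4 * n2 mu.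
  by rewrite sqr_sqrtr// -cabs_sqr; nra.
have e0 : 0 <= e := sqrtr_ge0 _.
pose N := L + e.
have N0 : 0 < N by rewrite /N; lra.
have NC : (N%:C%C : C) != 0 by rewrite -n2_eq0 n2R sqrf_eq0 gt_eqF.
pose s := - (2 * mu / N%:C%C).
have s1 : n2 s < 1.
  rewrite /s n2N n2M n2V n2R n2M ltr_pdivrMr ?exprn_gt0// mul1r.
  have -> : n2 (2 : C) = 4 by rewrite (_ : 2 = (2 : R)%:C%C) ?n2R ?rmorph_nat//; ring.
  rewrite -cabs_sqr; have : 2 * cabs mu < N by rewrite /N; lra.
  by nra.
have LC : (L%:C%C : C) = c * conjc c - a * conjc a + (d * conjc d - b * conjc b).
  by rewrite !mulcJ /L -!rmorphB -rmorphD.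
have quad : mu * conjc s ^+ 2 + L%:C%C * conjc s + conjc mu = 0.
  have -> : conjc s = - (2 * conjc mu / N%:C%C).
    by rewrite /s conjcN !conjcM conjc_inv conjcR conjc_nat.
  have EN : (N%:C%C ^+ 2 - 2 * L%:C%C * N%:C%C + 4 * (mu * conjc mu) : C) = 0.
    rewrite mulcJ -(rmorph_nat (real_complex R) 2) -(rmorph_nat (real_complex R) 4).
    rewrite -rmorphXn -!rmorphM -rmorphB -rmorphD /N.
    have -> : (L + e) ^+ 2 - 2 * L * (L + e) + 4 * n2 mu =
       e ^+ 2 - (L ^+ 2 - 4 * n2 mu) by ring.
    by rewrite e2 subrr.
  have -> : mu * (- (2 * conjc mu / N%:C%C)) ^+ 2 + L%:C%C * - (2 * conjc mu / N%:C%C) + conjc mu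
    = conjc mu * (N%:C%C ^+ 2 - 2 * L%:C%C * N%:C%C + 4 * (mu * conjc mu)) / N%:C%C ^+ 2.
    by field.
  by rewrite EN mulr0 mul0r.
clearbody s; pose w := flm a b c d s.
have w1 : n2 w < 1 by exact: good_disk.
have cs := good_cz G s1.
have wE : w * (c * s + d) = a * s + b by rewrite /w /flm divfK.
have wJE : conjc w * (conjc c * conjc s + conjc d) = conjc a * conjc s + conjc b.
  by rewrite -!conjcM -!conjcD -conjcM wE.
have csJ : conjc c * conjc s + conjc d != 0.
  by rewrite -conjcM -conjcD conjc_eq0.
set P := a - w * c; set Q := d - conjc w * b.
have E1 : b - w * d = - s * P.
  have -> : b = w * (c * s + d) - a * s by rewrite wE addrC addKr.
  by rewrite /P; ring.
(* With denominators cleared this is the reflection condition at 1 / conj s, and it reduces to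
   [quad]. *)
have E2 : c - conjc w * a = - conjc s * Q.
  apply: (mulIf csJ); apply/eqP; rewrite -subr_eq0 /Q.
  have -> : (c - conjc w * a) * (conjc c * conjc s + conjc d) -
      - conjc s * (d - conjc w * b) * (conjc c * conjc s + conjc d) =
     (c + conjc s * d) * (conjc c * conjc s + conjc d) -
     (conjc w * (conjc c * conjc s + conjc d)) * (a + conjc s * b) by ring.
  rewrite wJE; apply/eqP; rewrite -[RHS]quad LC /mu conjcB !conjcM !conjcK; ring.
have q0 : 0 < 1 - n2 w by rewrite subr_gt0.
have p0 : 0 < 1 - n2 s by rewrite subr_gt0.
have F1 : n2 s * n2 Q - n2 P = (1 - n2 w) * (n2 c - n2 a).
  by rewrite -n2_transv E2 n2M n2N n2J.
have F2 : n2 Q - n2 s * n2 P = (1 - n2 w) * (n2 d - n2 b).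
  by rewrite -n2_transv E1 n2M n2N.
have F3 : P * Q * (1 - n2 s)%:C%C = (1 - n2 w)%:C%C * (a * d - b * c).
  by rewrite -transv_det E1 E2 -/P -/Q RC1B; ring.
have PQ0 : P * Q != 0.
  apply/eqP => PQ0; move/eqP: F3; rewrite PQ0 mul0r eq_sym mulf_eq0 (negbTE D0) orbF.
  by rewrite -n2_eq0 n2R sqrf_eq0 gt_eqF.
have [P0 Q0] : P != 0 /\ Q != 0 by move: PQ0; rewrite mulf_eq0 negb_or => /andP.
exists s, w, P, Q; split => //.
  split => //.
  have : (1 + n2 s) * (n2 Q - n2 P) = (1 - n2 w) * L by rewrite /L; lra.
  have L0 : 0 < L by lra.
  have := mulr_gt0 q0 L0 => h1 h2; rewrite -h2 in h1.
  rewrite -subr_gt0; rewrite pmulr_rgt0 in h1 => //.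
  by rewrite ltr_wpDr ?n2_ge0.
have F4 : cabs P * cabs Q * (1 - n2 s) = (1 - n2 w) * cabs (a * d - b * c).
  rewrite -(cabsR (ltW p0)) -(cabsR (ltW q0)) -!cabsM F3//.
have F5 : (n2 P + n2 Q) * (1 - n2 s) = (1 - n2 w) * (n2 d - n2 b - (n2 c - n2 a)) by lra.
apply: (@mulfI _ ((1 - n2 s) * (1 - n2 w))); first by rewrite mulf_neq0// gt_eqF.
transitivity ((cabs P * cabs Q * (1 - n2 s)) * ((1 - n2 w) * (n2 d - n2 b - (n2 c - n2 a)))).
  by ring.
by rewrite F4 -F5; ring.
Qed.

End FractionalLinear.

(** * Approximation numbers *)

Section ApproximationNumbers.
Variable R : realType.
Local Notation C := R[i].
Local Notation seqC := (nat -> C).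
Implicit Types (a b c d z w s P Q : C) (x : seqC).

(** Coefficient form of the normal form [center_bl]: the multiplier [rho] of the overview is
    [P / Q]. *)
Definition center a b c d s w P Q :=
  [/\ n2 s < 1, n2 w < 1, P != 0, Q != 0 & n2 P < n2 Q] /\
  [/\ a - w * c = P, b - w * d = - s * P, d - conjc w * b = Q &
        c - conjc w * a = - conjc s * Q].

Lemma center_den a b c d s w P Q z : good a b c d -> center a b c d s w P Q ->
  n2 z < 1 ->
  1 - conjc w * flm a b c d z = Q * (1 - conjc s * z) / (c * z + d).
Proof.
move=> G [[s1 w1 P0 Q0 PQ] [E1 E2 E3 E4]] z1; have cz := good_cz G z1.
apply: (mulIf cz); rewrite divfK// mulrBl mul1r -mulrA /flm divfK//.
have -> : Q * (1 - conjc s * z) = Q + (- conjc s * Q) * z by ring.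
by rewrite -E4 -E3; ring.
Qed.

Lemma center_num a b c d s w P Q z : good a b c d -> center a b c d s w P Q ->
  n2 z < 1 -> flm a b c d z - w = P * (z - s) / (c * z + d).
Proof.
move=> G [[s1 w1 P0 Q0 PQ] [E1 E2 E3 E4]] z1; have cz := good_cz G z1.
apply: (mulIf cz); rewrite divfK// mulrBl /flm divfK//.
have -> : P * (z - s) = P * z + - s * P by ring.
by rewrite -E2 -E1; ring.
Qed.

Lemma center_bl a b c d s w P Q z : good a b c d -> center a b c d s w P Q ->
  n2 z < 1 -> bl w (flm a b c d z) = P / Q * bl s z.
Proof.
move=> G H z1; rewrite /bl (center_den G H z1) (center_num G H z1).
have cz := good_cz G z1; have [[s1 w1 P0 Q0 PQ] _] := H.
have sz := one_subM_neq0 z1 s1; move: cz sz Q0; clear.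
move: (c * z + d) (1 - conjc s * z) (z - s) => p q r p0 q0 Q0.
by field; rewrite p0 q0 Q0.
Qed.

Definition lin_on_H2 (S : seqC -> seqC) :=
  (forall x y, inH2 x -> inH2 y -> S (fun k => x k + y k) = (fun k => S x k + S y k)) /\
  (forall (c : C) x, inH2 x -> S (fun k => c * x k) = (fun k => c * S x k)).

(* Peeling off the component of [f] along the kernel at [w] gains one rank and
   one factor [P / Q]. *)
Lemma upper_rank a b c d s w P Q (M : R) : good a b c d ->
  center a b c d s w P Q -> comp_bounded (flm a b c d) M -> forall N,
  exists S : seqC -> seqC, finite_rank_lt N.+1 S /\
    forall x, inH2 x ->
      hn2 (fun k => compop (flm a b c d) x k - S x k) <= n2 (P / Q) ^+ N * M * hn2 x.
Proof.
move=> G H BM; have [[s1 w1 P0 Q0 PQ] _] := H.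
set T := compop _.
have TP x (xH : inH2 x) := compopP BM xH.
have kwH : inH2 (fun k => conjc w ^+ k) by apply: inH2_geo; rewrite n2J.
have [KH _ KE] := TP _ kwH; set K := compop _ _ in KH KE.
(* Composition intertwines multiplication by [bl w] with P / Q times multiplication by [bl s];
   applied to [bdiv_decomp], this is a recursion for [T]. *)
have rec x : inH2 x -> T x = fun k =>
    ((1 - n2 w)%:C%C * h2eval x w) * K k + P / Q * blm s (T (bdiv w x)) k.
  move=> xH; have [bH _] := bdiv_bound w1 xH.
  have [TxH _ TxE] := TP x xH; have [TbH _ TbE] := TP _ bH.
  have blH := inH2_blm s1 TbH.
  apply: (h2_unique TxH (inH2D (inH2Z _ KH) (inH2Z _ blH))).
  move=> z /diskE z1; have fz1 := good_disk G z1.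
  rewrite (TxE z z1) h2evalD//; [|exact: inH2Z..].
  rewrite !h2evalZ// (KE z z1) (h2eval_blm s1 TbH z1) (TbE z z1) {1}(bdiv_decomp w1 xH).
  have bbH := inH2_blm w1 bH.
  rewrite (h2evalD (inH2Z _ kwH) bbH fz1) (h2evalZ _ kwH fz1).
  by rewrite (h2eval_blm w1 bH fz1) (center_bl G H z1) mulrA.
elim=> [|N [S [[SH [SD [SZ [m [mN [v [vH vS]]]]]]] SM]]].
  exists (fun x k => 0); split.
    split; first by move=> x _; exact: inH2_0.
    split; first by move=> x y _ _; apply/funext => k; rewrite addr0.
    split; first by move=> e x _; apply/funext => k; rewrite mulr0.
    exists 0%N; split => //; exists (fun=> fun=> 0); split; first by case.
    by move=> x _; exists (fun=> 0); apply/funext => k; rewrite big_ord0.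
  move=> x xH; rewrite expr0 mul1r; have [_ h _] := TP x xH.
  by apply: le_trans h; under eq_fun do rewrite subr0.
(* The recursion of [T] with [S] on the right. The kernel terms cancel in T - S', where [blm s] is
   isometric and [bdiv w] contractive. *)
pose S' x k := ((1 - n2 w)%:C%C * h2eval x w) * K k + P / Q * blm s (S (bdiv w x)) k.
have S'E x : S' x = fun k =>
  ((1 - n2 w)%:C%C * h2eval x w) * K k + P / Q * blm s (S (bdiv w x)) k by [].
exists S'; split.
  split.
    move=> x xH; have [bH _] := bdiv_bound w1 xH.
    by apply: inH2D; apply: inH2Z => //; apply: inH2_blm => //; exact: SH.
  split.
    move=> x y xH yH; have [bxH _] := bdiv_bound w1 xH; have [byH _] := bdiv_bound w1 yH.
    rewrite !S'E (bdivD w1 xH yH) (SD _ _ bxH byH) (h2evalD xH yH w1) /blm mobmD.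
    by apply/funext => k; ring.
  split.
    move=> e x xH; have [bxH _] := bdiv_bound w1 xH.
    rewrite !S'E (bdivZ e w1 xH) (SZ e _ bxH) (h2evalZ e xH w1) /blm mobmZ.
    by apply/funext => k; ring.
  exists m.+1; split => //.
  exists (fun i => if unlift ord0 i is Some j then blm s (v j) else K); split.
    by move=> i; case: unliftP => [j _|_] //; exact: inH2_blm.
  move=> x xH; have [bH _] := bdiv_bound w1 xH; have [cf cfE] := vS _ bH.
  exists (fun i => if unlift ord0 i is Some j then P / Q * cf j
     else (1 - n2 w)%:C%C * h2eval x w).
  apply/funext => k; rewrite S'E big_ord_recl unlift_none; congr (_ + _).
  have -> : blm s (S (bdiv w x)) = fun k => \sum_(i < m) cf i * blm s (v i) k.
    rewrite cfE; elim: (m) v cf {mN vH vS cfE} => [|m' IH] v cf.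
      have h := mobmZ 1 (- s) (- conjc s) 1 0 K.
      apply/funext => j; rewrite big_ord0.
      have -> : (fun k : nat => \sum_(i < 0) cf i * v i k) = fun k => 0 * K k.
        by apply/funext => ?; rewrite big_ord0 mul0r.
      by rewrite /blm h mul0r.
    under eq_fun do rewrite big_ord_recr /=.
    rewrite /blm mobmD mobmZ -!/(blm _ _) IH; apply/funext => j.
    by rewrite big_ord_recr.
  by rewrite mulr_sumr; apply: eq_bigr => i _; rewrite liftK mulrA.
move=> x xH; have [bH bM] := bdiv_bound w1 xH.
have [TbH _ _] := TP _ bH; have SbH := SH _ bH.
have -> : (fun k => T x k - S' x k) = fun k => P / Q *
    blm s (fun k => T (bdiv w x) k - S (bdiv w x) k) k.
  rewrite (rec x xH) S'E.
  have -> : (fun k => T (bdiv w x) k - S (bdiv w x) k) =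
     (fun k => T (bdiv w x) k + (-1) * S (bdiv w x) k).
    by apply/funext => k; rewrite mulN1r.
  rewrite /blm mobmD mobmZ; apply/funext => k; ring.
have dH := inH2B TbH SbH.
rewrite hn2Z; last exact: inH2_blm.
rewrite hn2_blm// exprS -!mulrA ler_wpM2l ?n2_ge0//.
apply: (le_trans (SM _ bH)); rewrite -mulrA.
have M0 : 0 <= n2 (P / Q) ^+ N * M.
  rewrite mulr_ge0 ?exprn_ge0 ?n2_ge0//.
  have [_ h _] := TP _ kwH.
  have k0 : 0 < hn2 (fun k => conjc w ^+ k).
    apply: (@lt_le_trans _ _ (ssum 1 (fun k => conjc w ^+ k))); last exact: ssum_hn2.
    by rewrite /ssum big_ord1 expr0 n2_1.
  by rewrite -(pmulr_lge0 _ k0) (le_trans _ h)// hn2_ge0.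
by rewrite !mulrA ler_wpM2l.
Qed.

Lemma opnorm_le (S : seqC -> seqC) (M : R) : 0 <= M ->
  (forall x, inH2 x -> inH2 (S x) /\ hn2 (S x) <= M ^+ 2 * hn2 x) ->
  (opnorm S <= M%:E)%E.
Proof.
move=> M0 SM; apply: ge_ereal_sup => _ [x /= x1 <-].
have x1' : forall n, ssum n x <= 1.
  by have := (h2norm_leP x ler01).1 x1; rewrite expr1n.
have xH := inH2_bound x1'; have hx1 := hn2_le x1'.
apply/h2norm_leP => // n; have [SH SM'] := SM x xH.
apply: (le_trans (ssum_hn2 n SH)); apply: (le_trans SM').
by rewrite ler_piMr ?sqr_ge0.
Qed.

Lemma opnorm_ge0 (S : seqC -> seqC) : (0 <= opnorm S)%E.
Proof.
apply: (@le_trans _ _ (h2norm (S (fun=> 0)))); first exact: h2norm_ge0.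
apply: ereal_sup_ubound; exists (fun=> 0) => //=.
by apply/h2norm_leP => // n; rewrite expr1n /ssum big1// => k _; rewrite n2_0.
Qed.

Lemma approx_num_ge0 n (S : seqC -> seqC) : (0 <= approx_num n S)%E.
Proof. by apply: le_ereal_inf_tmp => _ [x _ <-]; exact: opnorm_ge0. Qed.

Lemma approx_num_upper a b c d s w P Q (M : R) : good a b c d ->
  center a b c d s w P Q -> 0 < M -> comp_bounded (flm a b c d) M -> forall N,
  (approx_num N.+1 (compop (flm a b c d)) <= (cabs (P / Q) ^+ N * Num.sqrt M)%:E)%E.
Proof.
move=> G H M0 BM N; have [S [fS SM]] := upper_rank G H BM N.
apply: ge_ereal_inf; eexists; [exists S; [exact: fS|reflexivity]|].
apply: opnorm_le; first by rewrite mulr_ge0 ?exprn_ge0 ?cabs_ge0 ?sqrtr_ge0.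
move=> x xH; split.
  have [TxH _ _] := compopP BM xH; apply: inH2B => //; exact: fS.1.
by rewrite exprMn sqr_sqrtr ?(ltW M0)// -exprM mulnC exprM cabs_sqr; exact: SM.
Qed.

Lemma lin_sum (S : seqC -> seqC) n (p : nat -> C) (F : nat -> seqC) :
  lin_on_H2 S -> (forall j, inH2 (F j)) ->
  S (fun i => \sum_(j < n) p j * F j i) = fun i => \sum_(j < n) p j * S (F j) i.
Proof.
move=> [SD SZ] FH; elim: n => [|n IH].
  have := SZ 0 _ (FH 0%N); under eq_fun do rewrite mul0r.
  under [in X in _ -> X]eq_fun do rewrite big_ord0.
  by move=> ->; apply/funext => k; rewrite big_ord0 mul0r.
under eq_fun do rewrite big_ord_recr /=.
rewrite SD; first last.
- exact: inH2Z.
- by apply: (@inH2_sum _ n (fun j k => p j * F j k)) => j; exact: inH2Z.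
by rewrite IH SZ//; apply/funext => i; rewrite big_ord_recr.
Qed.

(** A dimension count: the coefficients of the S (F j) form an n by m matrix with m < n, whose left
    kernel is nonzero. *)
Lemma finite_rank_kernel n (S : seqC -> seqC) (F : nat -> seqC) :
  finite_rank_lt n S -> (forall j, inH2 (F j)) ->
  exists p : nat -> C, 0 < ssum n p /\ S (fun i => \sum_(j < n) p j * F j i) = fun=> 0.
Proof.
move=> [SH [SD [SZ [m [mn [v [vH vS]]]]]]] FH.
have [cf cfE] := choice (fun j => vS (F j) (FH j)).
pose A : 'M[C]_(n, m) := \matrix_(j, i) cf j i.
have : kermx A != 0.
  rewrite -mxrank_eq0 mxrank_ker subn_eq0 -ltnNge.
  by apply: leq_ltn_trans mn; exact: rank_leq_col.
move=> /rowV0Pn[p /sub_kermxP pA p0].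
pose q j := if insub j is Some i then p 0 i else 0.
have qE (j : 'I_n) : q j = p 0 j by rewrite /q valK.
exists q; split.
  rewrite lt0r ssum_ge0 andbT; apply/negP => /eqP s0.
  have h : forall i : 'I_n, n2 (q i) = 0.
    move=> i; apply/eqP; have := s0; rewrite /ssum => /eqP.
    rewrite psumr_eq0 => [/allP/(_ i)|k _]; last exact: n2_ge0.
    by rewrite mem_index_enum => /(_ isT).
  move/negP: p0; apply; apply/eqP/rowP => i; rewrite mxE -qE; apply/eqP.
  by rewrite -n2_eq0 h.
rewrite lin_sum//; apply/funext => k.
under eq_bigr do rewrite cfE mulr_sumr.
rewrite exchange_big /= big1// => i _.
under eq_bigr do rewrite mulrA; rewrite -mulr_suml.
have -> : \sum_(j < n) q j * cf j i = (p *m A) 0 i.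
  by rewrite mxE; apply: eq_bigr => j _; rewrite mxE qE.
by rewrite pA mxE mul0r.
Qed.

(** By [center_bl] and [center_den] the image of the combination is c z + d times the combination of
    the [kbl s j] with coefficients p j (P / Q)^j / Q. As |P / Q| < 1, each power with j < n is at
    least the n-th in modulus. *)
Lemma lower_span a b c d s w P Q (M : R) : good a b c d ->
  center a b c d s w P Q -> comp_bounded (flm a b c d) M ->
  exists kap : R, 0 < kap /\ forall n (p : nat -> C),
   kap ^+ 2 * n2 (P / Q) ^+ n * hn2 (fun i => \sum_(j < n) p j * kbl w j i) <=
   hn2 (compop (flm a b c d) (fun i => \sum_(j < n) p j * kbl w j i)).
Proof.
move=> G H BM; have [[s1 w1 P0 Q0 PQ] _] := H; have [cd _ _ _] := G.
have q0 : 0 < 1 - n2 w by rewrite subr_gt0.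
have p0 : 0 < 1 - n2 s by rewrite subr_gt0.
have nQ : 0 < n2 Q by rewrite n2_gt0.
(* The factors come from multiplication by c z + d, from the norms of the two systems and from the
   division by [Q] in the coefficients. *)
pose kap2 := (cabs d - cabs c) ^+ 2 * (1 - n2 w) / (n2 Q * (1 - n2 s)).
have k0 : 0 < kap2 by rewrite divr_gt0 ?mulr_gt0 ?exprn_gt0 ?subr_gt0.
exists (Num.sqrt kap2); split; first by rewrite sqrtr_gt0.
move=> n p; have [XH XE] := hn2_kbl n p w1.
set X := (fun i => _) in XH XE *.
have [TXH _ TXE] := compopP BM XH.
pose q j := p j * (P / Q) ^+ j / Q.
have [YH YE] := hn2_kbl n q s1.
set Y := (fun i => _) in YH YE.
have TX : compop (flm a b c d) X = lin c d Y.
  apply: h2_unique => //; first exact: inH2_lin.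
  move=> z /diskE z1; rewrite (TXE z z1) (h2eval_lin c d YH z1).
  have fz1 := good_disk G z1.
  rewrite (h2eval_sum (v := fun (j : 'I_n) k => p j * kbl w j k)) //; last first.
    by move=> i; apply: inH2Z; exact: inH2_kbl.
  rewrite (h2eval_sum (v := fun (j : 'I_n) k => q j * kbl s j k)) //; last first.
    by move=> i; apply: inH2Z; exact: inH2_kbl.
  rewrite mulr_sumr; apply: eq_bigr => j _.
  rewrite (h2evalZ _ (inH2_kbl j w1) fz1) (h2evalZ _ (inH2_kbl j s1) z1).
  rewrite !h2eval_kbl// (center_bl G H z1) (center_den G H z1) /q exprMn.
  have cz := good_cz G z1; have sz := one_subM_neq0 z1 s1; move: cz sz Q0; clear.
  move: (c * z + d) (1 - conjc s * z) ((P / Q) ^+ j) (bl s z ^+ j) => e f g h e0 f0 Q0.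
  by field; rewrite e0 f0 Q0.
rewrite TX; apply: le_trans (hn2_lin_ge (ltW cd) YH).
rewrite YE XE sqr_sqrtr ?(ltW k0)//.
have hs : n2 (P / Q) ^+ n * ssum n p <= n2 Q * ssum n q.
  rewrite /ssum !mulr_sumr; apply: ler_sum => j _.
  have -> : n2 Q * n2 (q j) = n2 (p j) * n2 (P / Q) ^+ j.
    rewrite /q n2M n2V [LHS]mulrC divfK ?gt_eqF// n2M n2X//.
  rewrite mulrC ler_wpM2l ?n2_ge0//.
  apply: ler_wiXn2l; rewrite ?n2_ge0 ?(ltnW (ltn_ord j))//.
  by rewrite n2M n2V ler_pdivrMr// mul1r ltW.
rewrite -subr_ge0.
have -> : (cabs d - cabs c) ^+ 2 * (ssum n q / (1 - n2 s)) -
   kap2 * n2 (P / Q) ^+ n * (ssum n p / (1 - n2 w)) =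
   (cabs d - cabs c) ^+ 2 / (n2 Q * (1 - n2 s)) *
   (n2 Q * ssum n q - n2 (P / Q) ^+ n * ssum n p).
  rewrite /kap2; move: (gt_eqF q0) (gt_eqF p0) (gt_eqF nQ).
  move: (1 - n2 w) (1 - n2 s) (n2 Q) (n2 (P / Q) ^+ n) => e f g h e0 f0 g0.
  by field; rewrite e0 f0 g0.
rewrite mulr_ge0 ?subr_ge0// divr_ge0 ?sqr_ge0// mulr_ge0// ltW//.
Qed.

(** Stated for any [T] dominating the composition operator, so that a tangent map can be compared
    with its dilations. On a unit vector of the span killed by [S], T - S coincides with [T]. *)
Lemma approx_num_lower a b c d s w P Q (M : R) (T : seqC -> seqC) :
  good a b c d -> center a b c d s w P Q -> comp_bounded (flm a b c d) M ->
  (forall x, inH2 x -> inH2 (T x) /\ hn2 (compop (flm a b c d) x) <= hn2 (T x)) ->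
  exists kap : R, 0 < kap /\ forall n,
    ((kap * cabs (P / Q) ^+ n)%:E <= approx_num n T)%E.
Proof.
move=> G H BM TT; have [[s1 w1 P0 Q0 PQ] _] := H.
have [kap [k0 kE]] := lower_span G H BM; exists kap; split => // n.
apply: le_ereal_inf_tmp => _ [S fS <-].
have [p [p0 Sp]] := finite_rank_kernel fS (fun j => inH2_kbl j w1).
have [XH XE] := hn2_kbl n p w1.
have kEp := kE n p.
set X := (fun i => _) in XH XE kEp Sp.
have X0 : 0 < hn2 X by rewrite XE divr_gt0// subr_gt0.
have h0 : 0 < Num.sqrt (hn2 X) by rewrite sqrtr_gt0.
pose e : C := ((Num.sqrt (hn2 X))^-1)%:C%C.
have e2 : n2 e = (hn2 X)^-1 by rewrite n2R exprVn sqr_sqrtr// ltW.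
pose X' k := e * X k.
have X'H : inH2 X' by exact: inH2Z.
have X'1 : hn2 X' = 1 by rewrite hn2Z// e2 mulVf// gt_eqF.
apply: (@le_trans _ _ (h2norm (fun k => T X' k - S X' k))); last first.
  apply: ereal_sup_ubound; exists X' => //=; apply/h2norm_leP => // m.
  by rewrite expr1n -X'1; exact: ssum_hn2.
have [SH [SD [SZ _]]] := fS.
have -> : (fun k => T X' k - S X' k) = T X'.
  by apply/funext => k; rewrite (SZ e X XH) Sp mulr0 subr0.
have [TH TX] := TT X' X'H.
rewrite h2normE// lee_fin -(@ger0_norm _ (kap * _)) ?mulr_ge0 ?(ltW k0) ?exprn_ge0 ?cabs_ge0//.
rewrite -sqrtr_sqr ler_sqrt ?hn2_ge0//; apply: le_trans TX.
rewrite exprMn -exprM mulnC exprM cabs_sqr.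
have X'E : X' = fun i => \sum_(j < n) (e * p j) * kbl w j i.
  by apply/funext => i; rewrite /X' mulr_sumr; apply: eq_bigr => j _; rewrite mulrA.
have := kE n (fun j => e * p j).
by rewrite -X'E X'1 mulr1.
Qed.

(** Constants disappear under n-th roots. The lower bound is asked only for each r < rho, with a
    constant depending on r, because dilations give no more. *)
Lemma cvg_root (u : nat -> R) (K rho : R) : 0 < K -> 0 < rho ->
  (forall n, (0 < n)%N -> 0 <= u n <= K * rho ^+ n) ->
  (forall r, 0 < r < rho -> exists kap : R, 0 < kap /\
     forall n, (0 < n)%N -> kap * r ^+ n <= u n) ->
  (fun n => u n `^ (n%:R)^-1) @ \oo --> rho.
Proof.
move=> K0 rho0 uK ukap.
have inv0 : (fun n : nat => (n%:R : R)^-1) @ \oo --> (0 : R).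
  by rewrite -cvg_shiftS; exact: cvg_harmonic.
have rt (k r : R) : 0 < k -> 0 < r -> (fun n => k `^ (n%:R)^-1 * r) @ \oo --> r.
  move=> k0 r0; rewrite -[X in _ --> X](mul1r r); apply: cvgM; last exact: cvg_cst.
  have -> : (fun n : nat => k `^ (n%:R)^-1) = expR \o (fun n : nat => (n%:R)^-1 * ln k).
    by apply/funext => n /=; rewrite /powR gt_eqF.
  have h : (fun n : nat => (n%:R : R)^-1 * ln k) @ \oo --> (0 : R).
    by rewrite -(mul0r (ln k)); apply: cvgM => //; exact: cvg_cst.
  by have := cvg_comp _ _ h (@continuous_expR R 0); rewrite expR0.
have pw (k r : R) n : 0 < k -> 0 < r -> (0 < n)%N ->
    (k * r ^+ n) `^ (n%:R)^-1 = k `^ (n%:R)^-1 * r.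
  move=> k0 r0 n0; rewrite powRM ?(ltW k0) ?exprn_ge0 ?(ltW r0)//; congr (_ * _).
  by rewrite -powR_mulrn ?(ltW r0)// -powRrM mulfV ?powRr1 ?(ltW r0)// pnatr_eq0 -lt0n.
apply/cvgrPdist_le => e e0.
pose r := Num.max (rho - e / 2) (rho / 2).
have r0 : 0 < r by rewrite lt_max (divr_gt0 rho0)// orbT.
have rrho : r < rho by rewrite gt_max; apply/andP; split; lra.
have re : rho - e / 2 <= r by rewrite le_max lexx.
have [|kap [kap0 kapu]] := ukap r; first by rewrite r0 rrho.
have e20 : 0 < e / 2 by rewrite divr_gt0.
move/cvgrPdist_le : (rt kap r kap0 r0) => /(_ _ e20) hlow.
move/cvgrPdist_le : (rt K rho K0 rho0) => /(_ _ e0) hup.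
near=> n.
have n0 : (0 < n)%N by near: n; exists 1%N.
have h1 : `|r - kap `^ n%:R^-1 * r| <= e / 2 by near: n.
have h2 : `|rho - K `^ n%:R^-1 * rho| <= e by near: n.
have /andP[u0 uK'] := uK n n0.
have hn : 0 <= (n%:R : R)^-1 by rewrite invr_ge0.
have k1 : kap `^ n%:R^-1 * r <= u n `^ n%:R^-1.
  rewrite -pw//; apply: (@ge0_ler_powR _ _ hn) => //; rewrite ?nnegrE//.
    by rewrite mulr_ge0 ?(ltW kap0) ?exprn_ge0 ?(ltW r0).
  exact: kapu.
have k2 : u n `^ n%:R^-1 <= K `^ n%:R^-1 * rho.
  rewrite -pw//; apply: (@ge0_ler_powR _ _ hn) => //; rewrite ?nnegrE//.
  by rewrite mulr_ge0 ?(ltW K0) ?exprn_ge0 ?(ltW rho0).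
by move: h1 h2; rewrite !ler_norml => /andP[? ?] /andP[? ?]; apply/andP; split; lra.
Unshelve. all: by end_near. Qed.

End ApproximationNumbers.

(** * Constant maps *)

Section ConstantMap.
Variable R : realType.
Local Notation C := R[i].
Local Notation seqC := (nat -> C).
Implicit Types (a b c d z : C) (x : seqC).

(** Valid also for |lam| = 1 and any [x]: whatever value [h2eval] returns, default included, the
    constant function with that value is in H^2. *)
Lemma compop_const (phi : C -> C) (lam : C) x :
  (forall z, disk z -> phi z = lam) ->
  compop phi x = fun k => h2eval x lam * delta0 R k.
Proof.
move=> phil; set y := (fun k => _).
have yH : inH2 y := inH2Z _ (inH2_delta0 R).
have yE z : disk z -> h2eval y z = h2eval x (phi z).
  move=> dz; rewrite phil//; move/diskE : dz => z1.
  by rewrite (h2evalZ _ (inH2_delta0 R) z1) h2eval_delta0// mulr1.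
have [H1 H2] := xgetPex (fun _ : nat => (0 : C))
  (ex_intro (fun y => inH2 y /\ forall z, disk z -> h2eval y z = h2eval x (phi z)) y
    (conj yH yE)).
by apply: (h2_unique H1 yH) => z dz; rewrite (H2 z dz) (yE z dz).
Qed.

(** The operator has rank at most 1 and [finite_rank_lt] is strict, hence the index n + 2. *)
Lemma approx_num_const_in (phi : C -> C) (lam : C) n :
  (forall z, disk z -> phi z = lam) -> n2 lam < 1 ->
  approx_num n.+2 (compop phi) = 0%E.
Proof.
move=> phil l1; apply/eqP; rewrite eq_le approx_num_ge0 andbT.
apply: ge_ereal_inf; eexists.
  exists (compop phi); last reflexivity.
  split; first by move=> x xH; rewrite (compop_const x phil); exact: inH2Z (inH2_delta0 R).
  split.
    move=> x y xH yH; rewrite !(compop_const _ phil) (h2evalD xH yH l1).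
    by apply/funext => k; rewrite mulrDl.
  split.
    move=> e x xH; rewrite !(compop_const _ phil) (h2evalZ e xH l1).
    by apply/funext => k; rewrite mulrA.
  exists 1%N; split => //; exists (fun=> delta0 R); split; first by move=> _; exact: inH2_delta0.
  move=> x xH; exists (fun=> h2eval x lam); rewrite (compop_const _ phil).
  by apply/funext => k; rewrite big_ord1.
apply: opnorm_le => // x xH.
under eq_fun do rewrite subrr; split; first exact: inH2_0.
rewrite expr0n mul0r; apply: hn2_le => m.
by rewrite /ssum big1// => k _; rewrite n2_0.
Qed.

Lemma sum_inv_sqr_le n : \sum_(k < n) ((k.+1%:R : R) ^+ 2)^-1 <= 2.
Proof.
suff h : \sum_(k < n.+1) ((k.+1%:R : R) ^+ 2)^-1 <= 2 - (n.+1%:R)^-1.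
  apply: (@le_trans _ _ (\sum_(k < n.+1) ((k.+1%:R : R) ^+ 2)^-1)).
    by rewrite big_ord_recr /= lerDl invr_ge0 sqr_ge0.
  by apply: (le_trans h); rewrite gerBl invr_ge0.
elim: n => [|n IH]; first by rewrite big_ord1 expr1n invr1; lra.
rewrite big_ord_recr /=; apply: (le_trans (lerD IH (lexx _))).
rewrite -subr_ge0 -(natr1 n.+1).
have m0 : 0 < (n.+1%:R : R) by rewrite ltr0n.
move: (n.+1%:R : R) m0 => m m0.
have -> : 2 - (m + 1)^-1 - (2 - m^-1 + ((m + 1) ^+ 2)^-1) = (m * (m + 1) ^+ 2)^-1.
  by field; apply/andP; split; lra.
by rewrite invr_ge0 mulr_ge0 ?sqr_ge0// ltW.
Qed.

(* Where the harmonic series makes the Taylor series diverge, [h2eval] returns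
   the junk value 0. *)
Lemma h2eval_harmonic x (lam : C) N0 :
  (forall k, (N0 <= k)%N -> x k * lam ^+ k = ((4 * k.+1%:R)^-1)%:C%C) ->
  h2eval x lam = 0.
Proof.
move=> xE; rewrite /h2eval dvgP// => /cvg_ex[l /cvg_cabs].
(* Convergence would make two partial sums differ by at most 1/16, but the block from n to 2n is at
   least 1/8. *)
have e0 : (0 : R) < 32^-1 by rewrite invr_gt0.
move=> /(_ _ e0)[N _ hN].
pose n := (maxn N N0).+1.
have nN : (N <= n)%N by apply: leqW; exact: leq_maxl.
have nN0 : (N0 <= n)%N by apply: leqW; exact: leq_maxr.
have h1 := hN n nN.
have h2 : cabs (l - \sum_(k < (n + n)) x k * lam ^+ k) <= 32^-1.
  by apply: hN => /=; apply: leq_trans nN _; exact: leq_addr.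
move: h1 h2; set p := \sum_(k < n) _; set q := \sum_(k < n + n) _ => h1 h2.
have h3 : cabs (q - p) <= 16^-1.
  have -> : q - p = (l - p) + - (l - q) by ring.
  by apply: (le_trans (cabsD _ _)); rewrite cabsN; lra.
have qp : q - p = (\sum_(i < n) (4 * (n + i).+1%:R)^-1)%:C%C.
  have -> : q = p + \sum_(i < n) x (n + i)%N * lam ^+ (n + i) by rewrite /q big_split_ord.
  rewrite addrAC subrr add0r rmorph_sum.
  by apply: eq_bigr => i _; rewrite xE// (leq_trans nN0)// leq_addr.
have : 8^-1 <= cabs (q - p).
  rewrite qp cabsR; last by apply: sumr_ge0 => i _; rewrite invr_ge0.
  apply: (@le_trans _ _ (\sum_(i < n) (4 * (n + n)%:R)^-1)); last first.
    apply: ler_sum => i _; rewrite lef_pV2 ?posrE ?mulr_gt0 ?ltr0n ?addn_gt0//.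
    by rewrite ler_pM2l// ler_nat ltn_add2l.
  have n0 : (0 : R) < n%:R by rewrite ltr0n.
  have -> : \sum_(i < n) (4 * (n + n)%:R)^-1 = 8^-1 :> R.
    by rewrite sumr_const card_ord -[LHS]mulr_natr natrD; field; lra.
  exact: lexx.
by lra.
Qed.

(** Default values break additivity: [X] and [X + Y] have divergent series at [lam], hence value 0,
    while [Y] has a large value there. An additive [S] cannot compensate, so T - S is unbounded on
    the unit ball. *)
Lemma approx_num_const_bd (phi : C -> C) (lam : C) n :
  (forall z, disk z -> phi z = lam) -> n2 lam = 1 ->
  approx_num n (compop phi) = +oo%E.
Proof.
move=> phil l1; apply/eqP; rewrite -leye_eq; apply: le_ereal_inf_tmp => _ [S fS <-].
rewrite leye_eq; apply/eqP.
set D := (fun x k => _).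
case E : (opnorm D) => [M| |] //; last by have := opnorm_ge0 D; rewrite E.
exfalso; have M0 : 0 <= M by have := opnorm_ge0 D; rewrite E lee_fin.
have key x : (forall m, ssum m x <= 1) -> cabs (D x 0%N) <= M.
  move=> x1.
  have : (h2norm (D x) <= M%:E)%E.
    rewrite -E; apply: ereal_sup_ubound; exists x => //=.
    by apply/h2norm_leP => // m; rewrite expr1n.
  move=> /(h2norm_leP _ M0)/(_ 1%N); rewrite /ssum big_ord1.
  by rewrite -cabs_le.
have [SH [SD _]] := fS.
pose m := (Num.bound (6 * M)).+1.
have mM : 6 * M < m%:R.
  apply: (@lt_trans _ _ (Num.bound (6 * M))%:R); last by rewrite ltr_nat.
  by apply: archi_boundP; rewrite mulr_ge0.
have mp : (0 : R) < m%:R by rewrite ltr0n.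
have lJ k : conjc lam ^+ k * lam ^+ k = 1.
  by rewrite -exprMn mulrC mulcJ l1 expr1n.
pose X k := conjc lam ^+ k * ((4 * k.+1%:R)^-1)%:C%C.
(* Here m^2 entries of modulus 1 / (2m) are aligned with [lam]: squared norm 1/4, but value m/2,
   which exceeds the bound 3M. *)
pose Y k := if (k < m ^ 2)%N then conjc lam ^+ k * ((2 * m%:R)^-1)%:C%C else 0.
have nX k : n2 (X k) = 16^-1 * (k.+1%:R ^+ 2)^-1.
  rewrite n2M n2X n2J l1 expr1n mul1r n2R.
  have : (0 : R) < k.+1%:R by rewrite ltr0n.
  by move: (k.+1%:R) => t t0; field; lra.
have nY k : (k < m ^ 2)%N -> n2 (Y k) = (4 * m%:R ^+ 2)^-1.
  by move=> km; rewrite /Y km n2M n2X n2J l1 expr1n mul1r n2R; field; lra.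
have sX j : ssum j X <= 8^-1.
  rewrite /ssum; under eq_bigr do rewrite nX; rewrite -mulr_sumr.
  by have := sum_inv_sqr_le j; lra.
have sY j : ssum j Y <= 4^-1.
  have YE : Y = head (m ^ 2) Y by apply/funext => k; rewrite /head /Y; case: ifP.
  apply: (@le_trans _ _ (ssum (m ^ 2 + j) Y)); first by apply: ssum_homo; exact: leq_addl.
  rewrite YE ssum_head ?leq_addr// /ssum (eq_bigr (fun=> (4 * m%:R ^+ 2)^-1)).
    have -> : \sum_(k < m ^ 2) (4 * m%:R ^+ 2)^-1 = 4^-1 :> R.
      by rewrite sumr_const card_ord -[LHS]mulr_natr natrX; field; lra.
    exact: lexx.
  by move=> k _; exact: nY.
have XH : inH2 X := inH2_bound sX; have YH : inH2 Y := inH2_bound sY.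
pose XY k := X k + Y k.
have DX : cabs (D X 0%N) <= M by apply: key => j; apply: (le_trans (sX j)); lra.
have DY : cabs (D Y 0%N) <= M by apply: key => j; apply: (le_trans (sY j)); lra.
have DXY : cabs (D XY 0%N) <= M.
  by apply: key => j; apply: (le_trans (ssumD_le j X Y)); have := sX j; have := sY j; lra.
have eX : h2eval X lam = 0.
  by apply: (@h2eval_harmonic _ _ 0) => k _; rewrite /X mulrAC lJ mul1r.
have eXY : h2eval XY lam = 0.
  apply: (@h2eval_harmonic _ _ (m ^ 2)) => k km.
  by rewrite /XY /X /Y ltnNge km addr0 mulrAC lJ mul1r.
have eY : h2eval Y lam = (m%:R / 2)%:C%C.
  have sE j : (m ^ 2 <= j)%N -> \sum_(k < j) Y k * lam ^+ k = (m%:R / 2)%:C%C.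
    move=> mj.
    have YE : Y = head (m ^ 2) Y by apply/funext => k; rewrite /head /Y; case: ifP.
    rewrite YE sum_head// (eq_bigr (fun=> ((2 * m%:R)^-1)%:C%C)); last first.
      by move=> k _; rewrite /Y ltn_ord mulrAC lJ mul1r.
    rewrite -(rmorph_sum (real_complex R)).
    have -> // : \sum_(k < m ^ 2) (2 * m%:R)^-1 = m%:R / 2 :> R.
    by rewrite sumr_const card_ord -[LHS]mulr_natr natrX; field; lra.
  by apply: h2eval_eq; split; apply: cvg_near_cst; exists (m ^ 2)%N => // j /= mj; rewrite sE.
have : (m%:R / 2)%:C%C = D Y 0%N + (D X 0%N + - D XY 0%N).
  rewrite /D !(compop_const _ phil) eX eXY eY (SD X Y XH YH) /= !mul0r mulr1; ring.
move=> /(congr1 (@cabs R)); rewrite cabsR ?divr_ge0 ?(ltW mp)// => mE.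
have := cabsD (D Y 0%N) (D X 0%N + - D XY 0%N).
have := cabsD (D X 0%N) (- D XY 0%N); rewrite cabsN.
by rewrite -mE; lra.
Qed.

Lemma flm_const a b c d :
  cabs a ^+ 2 + cabs b ^+ 2 + 2 * cabs (conjc a * b - conjc c * d)
    <= cabs c ^+ 2 + cabs d ^+ 2 ->
  cabs c <= cabs d -> a * d - b * c = 0 ->
  exists lam : C, n2 lam <= 1 /\ forall z, disk z -> flm a b c d z = lam.
Proof.
move=> h cd D0; have m0 := cabs_ge0 (conjc a * b - conjc c * d).
rewrite !cabs_sqr in h.
(* Then all four coefficients vanish and [flm] takes the default value 0 / 0 = 0. *)
have [d0|d0] := eqVneq d 0.
  have c0 : c = 0.
    apply/eqP; rewrite -cabs_eq0 eq_le cabs_ge0 andbT (le_trans cd)// d0.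
    by rewrite le_eqVlt cabs_eq0 eqxx.
  rewrite c0 d0 n2_0 in h.
  have ha := n2_ge0 a; have hb := n2_ge0 b; rewrite c0 d0 in m0.
  have a0 : a = 0 by apply/eqP; rewrite -n2_eq0; apply/eqP; lra.
  have b0 : b = 0 by apply/eqP; rewrite -n2_eq0; apply/eqP; lra.
  exists 0; rewrite n2_0; split => // z _.
  by rewrite /flm a0 b0 mul0r add0r mul0r.
exists (b / d).
have aE : a = b / d * c.
  apply: (mulIf d0); rewrite mulrAC divfK//; apply/eqP.
  by rewrite -subr_eq0 D0.
have bE : b = b / d * d by rewrite divfK.
have dn : 0 < n2 d by rewrite n2_gt0.
split.
  have ha : n2 a = n2 (b / d) * n2 c by rewrite -n2M -aE.
  have hb : n2 b = n2 (b / d) * n2 d by rewrite -n2M -bE.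
  have cn := n2_ge0 c; rewrite ha hb in h.
  by rewrite -(@ler_pM2r _ (n2 c + n2 d)) ?mul1r; lra.
move=> z /diskE z1; have cz : c * z + d != 0.
  apply/negP; rewrite addrC addr_eq0 => /eqP dE.
  have : n2 d < n2 d.
    rewrite {1}dE n2N n2M; apply: (@le_lt_trans _ _ (n2 d * n2 z)).
      by rewrite ler_wpM2r ?n2_ge0// -!cabs_sqr ler_pXn2r ?nnegrE ?cabs_ge0.
    by rewrite gtr_pMr.
  by rewrite ltxx.
apply: (mulIf cz); rewrite /flm divfK// mulrDr mulrA -aE divfK//.
Qed.

End ConstantMap.

(** * Logarithmic means over circles *)

Section CircleMean.
Variable R : realType.
Local Notation C := R[i].
Local Notation mu := (@lebesgue_measure R).
Implicit Types (x y : C) (t : R).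

Definition cis t : C := (cos (2 * pi * t) +i* sin (2 * pi * t))%C.

Lemma n2_cis t : n2 (cis t) = 1.
Proof. by rewrite /n2 /= cos2Dsin2. Qed.

Lemma cis_double t : cis (2 * t) = cis t * cis t.
Proof.
apply/eqP; rewrite eq_complex /cis /=.
have -> : 2 * pi * (2 * t) = 2 * pi * t + 2 * pi * t :> R by ring.
by rewrite cosD sinD; apply/andP; split => //; apply/eqP; ring.
Qed.

Lemma cis_half t : cis (t + 2^-1) = - cis t.
Proof.
apply/eqP; rewrite eq_complex /cis /=.
have -> : 2 * pi * (t + 2^-1) = 2 * pi * t + pi :> R by field.
by rewrite cosDpi sinDpi !eqxx.
Qed.

Lemma continuous_linear (k m : R) : continuous (fun t : R => k * t + m).
Proof.
by move=> t; apply: cvgD; [apply: cvgM; [exact: cvg_cst|exact: cvg_id]|exact: cvg_cst].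
Qed.

Lemma continuous_cos2pi : continuous (fun t : R => cos (2 * pi * t)).
Proof.
move=> t; apply: (@continuous_comp _ _ _ (fun t : R => 2 * pi * t) cos).
  by have := @continuous_linear (2 * pi) 0 t; under eq_fun do rewrite addr0.
exact: continuous_cos.
Qed.

Lemma continuous_sin2pi : continuous (fun t : R => sin (2 * pi * t)).
Proof.
move=> t; apply: (@continuous_comp _ _ _ (fun t : R => 2 * pi * t) sin).
  by have := @continuous_linear (2 * pi) 0 t; under eq_fun do rewrite addr0.
exact: continuous_sin.
Qed.

Definition lnc x t : R := ln (cabs (1 - x * cis t)).

Lemma cabs_1B_cis x t : 1 - cabs x <= cabs (1 - x * cis t) <= 1 + cabs x.
Proof.
have h : cabs (x * cis t) = cabs x by rewrite cabsM [cabs (cis t)]cabsE n2_cis sqrtr1 mulr1.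
have h1 : cabs 1 = 1 :> R by rewrite cabsE n2_1 sqrtr1.
apply/andP; split.
  have := cabsD (1 - x * cis t) (x * cis t); rewrite subrK h h1; lra.
by have := cabsD 1 (- (x * cis t)); rewrite cabsN h h1.
Qed.

Lemma continuous_lnc x : cabs x < 1 -> continuous (lnc x).
Proof.
move=> x1 t.
have h0 : 0 < cabs (1 - x * cis t).
  by have /andP[h _] := cabs_1B_cis x t; apply: lt_le_trans h; rewrite subr_gt0.
apply: (@continuous_comp _ _ _ (fun t => cabs (1 - x * cis t)) (@ln R));
  last exact: continuous_ln.
apply: (@continuous_comp _ _ _ (fun t => n2 (1 - x * cis t)) Num.sqrt);
  last exact: sqrt_continuous.
have cc := @continuous_cos2pi t; have cs := @continuous_sin2pi t.
have cst (k : R) : {for t, continuous (fun _ : R => k)} by exact: cvg_cst.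
have -> : (fun t => n2 (1 - x * cis t)) = fun t =>
  (1 - (complex.Re x * cos (2 * pi * t) - complex.Im x * sin (2 * pi * t))) *
  (1 - (complex.Re x * cos (2 * pi * t) - complex.Im x * sin (2 * pi * t))) +
  (complex.Re x * sin (2 * pi * t) + complex.Im x * cos (2 * pi * t)) *
  (complex.Re x * sin (2 * pi * t) + complex.Im x * cos (2 * pi * t)).
  by apply/funext => s; case: x {x1 h0} => a b; rewrite /n2 /cis /=; ring.
have c1 : {for t, continuous (fun t : R =>
    1 - (complex.Re x * cos (2 * pi * t) - complex.Im x * sin (2 * pi * t)))}.
  apply: cvgB; first exact: cst.
  by apply: cvgB; apply: cvgM; [exact: cst|exact: cc|exact: cst|exact: cs].
have c2 : {for t, continuous (fun t : R =>
    complex.Re x * sin (2 * pi * t) + complex.Im x * cos (2 * pi * t))}.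
  by apply: cvgD; apply: cvgM; [exact: cst|exact: cs|exact: cst|exact: cc].
by apply: cvgD; apply: cvgM; [exact: c1|exact: c1|exact: c2|exact: c2].
Qed.

Lemma integrable_itv (f : R -> R) (a b : R) : continuous f ->
  mu.-integrable `[a, b] (EFin \o f).
Proof.
move=> cf; apply: continuous_compact_integrable; first exact: segment_compact.
exact: continuous_subspaceT.
Qed.

Lemma Rintegral_affine (G : R -> R) (k m a b : R) : continuous G -> 0 < k -> a <= b ->
  \int[mu]_(x in `[k * a + m, k * b + m]) G x =
  k * \int[mu]_(t in `[a, b]) G (k * t + m).
Proof.
move=> cG k0 ab; pose F (t : R) := k * t + m.
have dF (t : R) : is_derive t 1 F k.
  have -> : F = k *: (@id R) + cst m by [].
  by apply: is_derive_eq; rewrite addr0 /GRing.scale /= mulr1.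
have F' : F^`()%classic = fun=> k.
  by apply/funext => t; rewrite derive1E (@derive_val _ _ _ _ _ _ _ (dF t)).
have cF : continuous F by exact: continuous_linear.
have cGF : continuous (G \o F) by move=> t; apply: continuous_comp; [exact: cF|exact: cG].
rewrite /Rintegral (@integration_by_substitution_increasing _ F G a b)//.
- rewrite -RintegralZl; last 2 first.
  + exact: measurable_itv.
  + exact: integrable_itv.
  rewrite /Rintegral; congr fine; apply: eq_integral => t _; congr (_%:E).
  by rewrite F' /= mulrC.
- by move=> x y _ _ xy; rewrite /F ltrD2r ltr_pM2l.
- by rewrite F' => t _; exact: cvg_cst.
- by rewrite F'; exact: is_cvg_cst.
- by rewrite F'; exact: is_cvg_cst.
- split; first by move=> t _; exact: (@ex_derive _ _ _ _ _ _ _ (dF t)).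
  + by apply: cvg_at_right_filter; exact: cF.
  + by apply: cvg_at_left_filter; exact: cF.
- exact: continuous_subspaceT.
Qed.

Lemma Rintegral_split (f : R -> R) (a c b : R) : continuous f -> a <= c -> c <= b ->
  \int[mu]_(x in `[a, b]) f x =
  \int[mu]_(x in `[a, c]) f x + \int[mu]_(x in `[c, b]) f x.
Proof.
move=> cf ac cb.
have := @Rintegral_itvB R f (BLeft a) (BRight b) c (integrable_itv _ _ cf).
rewrite !bnd_simp => /(_ ac cb) h.
rewrite -(@Rintegral_itv_obnd_cbnd _ c); first by rewrite -h addrC subrK.
apply: (integrableS _ _ _ (integrable_itv c b cf)) => //.
by apply: subset_itvr; rewrite bnd_simp.
Qed.

Definition cmean x : R := \int[mu]_(t in `[0, 1]) lnc x t.

(** From 1 - x^2 e^2 = (1 - x e)(1 + x e) with e = cis t, where -e is a half-turn shift: the two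
    factors cover the two halves of the circle. *)
Lemma cmean_double x : cabs x < 1 -> cmean (x * x) = 2 * cmean x.
Proof.
move=> x1; have x21 : cabs (x * x) < 1.
  by rewrite cabsM; apply: (le_lt_trans _ x1); rewrite ler_piMl ?cabs_ge0// ltW.
have c1 := continuous_lnc x1; have c2 := continuous_lnc x21.
rewrite /cmean; have := @Rintegral_affine _ 2 0 0 2^-1 c2.
rewrite mulr0 !addr0 divff// => -> //; congr (_ * _).
have h0 : (0 : R) <= 2^-1 by [].
have h1 : (2^-1 : R) <= 1 by lra.
rewrite (Rintegral_split c1 h0 h1).
have := @Rintegral_affine _ 1 2^-1 0 2^-1 c1 ltr01 h0.
have -> : 1 * 0 + 2^-1 = 2^-1 :> R by lra.
have -> : 1 * 2^-1 + 2^-1 = 1 :> R by lra.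
move=> ->; rewrite mul1r -RintegralD//; last 2 first.
- exact: integrable_itv.
- apply: integrable_itv => t.
  apply: (@continuous_comp _ _ _ (fun t => 1 * t + 2^-1) (lnc x)); last exact: c1.
  exact: continuous_linear.
apply: eq_Rintegral => t _; rewrite addr0 mul1r /lnc cis_half cis_double.
have p1 s : 0 < cabs (1 - x * cis s).
  by have /andP[h _] := cabs_1B_cis x s; apply: lt_le_trans h; rewrite subr_gt0.
have p2 : 0 < cabs (1 - x * - cis t) by rewrite -cis_half.
by rewrite -lnM ?posrE// -cabsM; congr (ln (cabs _)); ring.
Qed.

Lemma cmean_bound x y : cabs x < 1 -> cabs y <= cabs x ->
  `|cmean y| <= ln 2 - ln (1 - cabs x).
Proof.
move=> x1 yx; have y1 := le_lt_trans yx x1.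
have cy := continuous_lnc y1.
have m1 : fine (mu (`[0, 1]%classic : set R)) = 1.
  by rewrite lebesgue_measure_itv /= lte_fin ltr01 oppr0 adde0.
have q0 : 0 < 1 - cabs x by rewrite subr_gt0.
have l1 : ln (1 - cabs x) <= 0 by apply: ln_le0; rewrite gerBl cabs_ge0.
have l2 : 0 <= ln 2 :> R by apply: ln_ge0; lra.
apply: (le_trans (le_normr_Rintegral _ _)) => //; first exact: integrable_itv.
apply: (@le_trans _ _ (\int[mu]_(t in `[0, 1]) (ln 2 - ln (1 - cabs x)))); last first.
  by rewrite Rintegral_cst// m1 mulr1.
apply: le_Rintegral => //.
- apply: integrable_itv => t; apply: (@continuous_comp _ _ _ (lnc y) (fun x : R => `|x|)).
    exact: cy.
  exact: norm_continuous.
- by apply: integrable_itv => t; exact: cvg_cst.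
move=> t _; rewrite /lnc; have /andP[h1 h2] := cabs_1B_cis y t.
have p1 : 0 < cabs (1 - y * cis t) by apply: lt_le_trans h1; rewrite subr_gt0.
rewrite ler_norml; apply/andP; split.
  apply: (@le_trans _ _ (ln (1 - cabs x))); first by lra.
  by rewrite ler_ln ?posrE//; apply: le_trans h1; lra.
apply: (@le_trans _ _ (ln 2)); last by lra.
by rewrite ler_ln ?posrE//; lra.
Qed.

(* [cmean] is bounded on each disk and doubles under squaring. *)
Lemma cmean0 x : cabs x < 1 -> cmean x = 0.
Proof.
move=> x1.
have h k : exists y, cabs y <= cabs x /\ cmean y = 2 ^+ k * cmean x.
  elim: k => [|k [y [yx yE]]]; first by exists x; rewrite expr0 mul1r.
  have y1 := le_lt_trans yx x1.
  exists (y * y); rewrite cmean_double// yE exprS mulrA; split => //.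
  by rewrite cabsM; apply: (le_trans _ yx); rewrite ler_piMl ?cabs_ge0// ltW.
apply/eqP; rewrite -normr_eq0; apply/negPn/negP => n0.
have I0 : 0 < `|cmean x| by rewrite lt0r n0 normr_ge0.
set B := ln 2 - ln (1 - cabs x).
pose k := Num.bound (B / `|cmean x|).
have [y [yx yE]] := h k.
have := cmean_bound x1 yx; rewrite -/B yE normrM ger0_norm ?exprn_ge0// leNgt.
move/negP; apply; rewrite -ltr_pdivrMr//.
have B0 : 0 <= B / `|cmean x|.
  by rewrite divr_ge0// (le_trans _ (cmean_bound x1 (lexx _))).
apply: (lt_le_trans (archi_boundP B0)); rewrite -/k -natrX ler_nat.
exact: (ltnW (ltn_expl _ _)).
Qed.

End CircleMean.

(** * The Green function as a power series *)

Section GreenSeries.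
Variable R : realType.
Local Notation C := R[i].
Implicit Types (z w u v : C) (q x : R).

Lemma is_derive_log_sum n (t : R) :
  is_derive t 1 (fun t : R => \sum_(k < n) t ^+ k.+1 / k.+1%:R) (\sum_(k < n) t ^+ k).
Proof.
elim: n => [|n IH].
  have -> : (fun t : R => \sum_(k < 0) t ^+ k.+1 / k.+1%:R) = cst 0.
    by apply/funext => s; rewrite big_ord0.
  by rewrite big_ord0; exact: is_derive_cst.
have -> : (fun t : R => \sum_(k < n.+1) t ^+ k.+1 / k.+1%:R) =
   (fun t : R => \sum_(k < n) t ^+ k.+1 / k.+1%:R) +
   (n.+1%:R)^-1 *: (fun t : R => t ^+ n.+1).
  by apply/funext => s; rewrite big_ord_recr; congr (_ + _); exact: mulrC.
rewrite big_ord_recr /=; apply: is_deriveD.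
have -> : (fun t : R => t ^+ n.+1) = (@id R) ^+ n.+1 by rewrite exprfctE.
apply: (is_derive_eq (is_deriveZ _ (is_deriveX n.+1 (is_derive_id t 1)))).
by rewrite /GRing.scale /= mulr1 mulrA mulVf ?mul1r// pnatr_eq0.
Qed.

(** The partial sum plus ln (1 - t) has derivative - t^n / (1 - t), so the mean value theorem bounds
    the remainder by x^(n+1) / (1 - x). *)
Lemma log_series x : 0 <= x -> x < 1 ->
  (fun n => \sum_(k < n) x ^+ k.+1 / k.+1%:R) @ \oo --> - ln (1 - x).
Proof.
move=> x0 x1; have [->|xn0] := eqVneq x 0.
  rewrite subr0 ln1 oppr0.
  have -> : (fun n => \sum_(k < n) (0 : R) ^+ k.+1 / k.+1%:R) = fun=> 0.
    by apply/funext => n; rewrite big1// => k _; rewrite expr0n mul0r.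
  exact: cvg_cst.
have {xn0}x0 : 0 < x by rewrite lt0r xn0.
pose f n (t : R) := \sum_(k < n) t ^+ k.+1 / k.+1%:R + ln (1 - t).
have dln (t : R) : t < 1 -> is_derive t 1 (fun t : R => ln (1 - t)) (- (1 - t)^-1).
  move=> t1; have h0 : 0 < 1 - t by rewrite subr_gt0.
  have d1 := is_derive1_ln h0.
  have d2 : is_derive t 1 (fun t : R => 1 - t) (-1).
    have -> : (fun t : R => 1 - t) = cst 1 - id by [].
    by apply: is_derive_eq; rewrite sub0r.
  have := @is_derive1_comp _ (@ln R) (fun t : R => 1 - t) t _ _ d1 d2.
  by rewrite mulrN1.
have df n (t : R) : t < 1 -> is_derive t 1 (f n) (- (t ^+ n / (1 - t))).
  move=> t1; apply: (is_derive_eq (is_deriveD (is_derive_log_sum n t) (dln t t1))).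
  have h0 : 1 - t != 0 by rewrite gt_eqF// subr_gt0.
  apply: (mulIf h0); rewrite mulrDl !mulNr mulVf// divfK//.
  elim: n => [|n IH]; first by rewrite big_ord0 expr0 mul0r add0r.
  by rewrite big_ord_recr /= mulrDl addrAC IH exprS; ring.
have fx n : `|f n x| <= x ^+ n / (1 - x) * x.
  have [||c c0x E] := @MVT _ (f n) (fun t => - (t ^+ n / (1 - t))) 0 x x0.
  - by move=> t; rewrite in_itv /= => /andP[_ tx]; apply: df; exact: lt_trans x1.
  - apply: derivable_within_continuous => t; rewrite in_itv /= => /andP[_ tx].
    by apply: (@ex_derive _ _ _ _ _ _ _ (df n t _)); exact: le_lt_trans x1.
  have f0 : f n 0 = 0.
    rewrite /f subr0 ln1 addr0 big1// => k _; by rewrite expr0n mul0r.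
  rewrite f0 !subr0 in E; rewrite E normrM normrN [`|x|]ger0_norm ?(ltW x0)//.
  move: c0x; rewrite in_itv /= => /andP[c0 cx].
  have hc : 0 < 1 - c by rewrite subr_gt0; exact: lt_trans x1.
  rewrite ler_pM2r// ger0_norm; last by rewrite divr_ge0 ?exprn_ge0 ?(ltW c0) ?(ltW hc).
  apply: ler_pM; rewrite ?exprn_ge0 ?invr_ge0 ?(ltW c0) ?(ltW hc)//.
    by apply: lerXn2r; rewrite ?nnegrE ?(ltW c0) ?(ltW x0)// ltW.
  have hx : 0 < 1 - x by rewrite subr_gt0.
  by rewrite lef_pV2 ?posrE//; lra.
have f0 : (fun n => `|f n x|) @ \oo --> (0 : R).
  apply: (@cvg0_of_le _ _ (fun n => x ^+ n / (1 - x) * x)).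
    by move=> n; rewrite normr_ge0 fx.
  rewrite -(mul0r x) -{1}(mul0r (1 - x)^-1); apply: cvgM; last exact: cvg_cst.
  by apply: cvgM; [apply: cvg_expr; rewrite ger0_norm ?(ltW x0)|exact: cvg_cst].
apply/cvgrPdist_le => e e0; move/cvgrPdist_le : f0 => /(_ _ e0).
apply: filter_app; near=> n; rewrite sub0r normrN normr_id /f.
by rewrite -[X in _ -> is_true (X <= _)]normrN opprB opprK.
Unshelve. all: by end_near. Qed.

Definition clog n : R := (2 * n.+1%:R)^-1.

Lemma clog_ge0 n : 0 <= clog n. Proof. by rewrite invr_ge0. Qed.

(** The series of - ln (1 - q) / 2, extended-valued so that q = 1 gives +oo, the value of [green] on
    the diagonal. *)
Definition gser q : \bar R := (\sum_(0 <= n <oo) (clog n * q ^+ n.+1)%:E)%E.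

Lemma gser_lt1 q : 0 <= q -> q < 1 -> gser q = (- ln (1 - q) / 2)%:E.
Proof.
move=> q0 q1; rewrite /gser; apply: cvg_lim => //.
have -> : (fun n => (\sum_(0 <= i < n) (clog i * q ^+ i.+1)%:E)%E) =
   EFin \o (fun n => (\sum_(k < n) q ^+ k.+1 / k.+1%:R) / 2).
  apply/funext => n /=; rewrite big_mkord sumEFin mulr_suml; congr (_%:E).
  by apply: eq_bigr => k _; rewrite /clog invfM; ring.
apply: cvg_EFin; first by near=> n.
by apply: cvgM; [exact: log_series|exact: cvg_cst].
Unshelve. all: by end_near. Qed.

Lemma gser1 : gser 1 = +oo%E.
Proof.
have u0 n : (0 <= n)%N -> xpredT n -> (0 <= (clog n * 1 ^+ n.+1)%:E :> \bar R)%E.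
  by move=> _ _; rewrite lee_fin expr1n mulr1 clog_ge0.
have : (0 <= gser 1)%E by apply: nneseries_ge0.
case E : (gser 1) => [r| |] // _; exfalso.
apply: (@dvg_harmonic R); apply: nondecreasing_is_cvgn.
  apply/nondecreasing_seqP => n; rewrite [X in _ <= X]seriesSr lerDl.
  by rewrite /harmonic /= invr_ge0.
exists (2 * r) => _ [n _ <-].
have := @nneseries_lim_ge _ _ xpredT 0 n u0; rewrite -/(gser 1) E.
rewrite sumEFin lee_fin big_mkord => h.
rewrite seriesEord /=; apply: (@le_trans _ _ (2 * \sum_(i < n) (clog i * 1 ^+ i.+1))).
  rewrite mulr_sumr; apply: ler_sum => i _.
  rewrite expr1n mulr1 /clog /harmonic invfM mulrA mulfV ?mul1r//.
by rewrite ler_pM2l.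
Qed.

(** One minus the squared pseudo-hyperbolic distance, and also the squared modulus of the normalised
    Szego kernel, whence its positive definiteness. *)
Definition Qc z w : R := (1 - n2 z) * (1 - n2 w) / n2 (1 - conjc w * z).

Lemma Qc_compl z w : n2 (1 - conjc w * z) - (1 - n2 z) * (1 - n2 w) = n2 (z - w).
Proof. by case: z w => [? ?] [? ?]; rewrite /n2 /=; ring. Qed.

Lemma Qc_gt0 z w : n2 z < 1 -> n2 w < 1 -> 0 < Qc z w.
Proof.
move=> z1 w1; rewrite divr_gt0 ?mulr_gt0 ?subr_gt0//.
by rewrite n2_gt0 one_subM_neq0.
Qed.

Lemma Qc_1B z w : n2 z < 1 -> n2 w < 1 -> 1 - Qc z w = n2 (z - w) / n2 (1 - conjc w * z).
Proof.
move=> z1 w1; have h : n2 (1 - conjc w * z) != 0 by rewrite n2_eq0 one_subM_neq0.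
by rewrite /Qc -Qc_compl; field.
Qed.

Lemma Qc_le1 z w : n2 z < 1 -> n2 w < 1 -> Qc z w <= 1.
Proof. by move=> z1 w1; rewrite -subr_ge0 Qc_1B// divr_ge0// n2_ge0. Qed.

Lemma green_gser z w : n2 z < 1 -> n2 w < 1 -> green z w = gser (Qc z w).
Proof.
move=> z1 w1; rewrite /green; case: eqVneq => [<-|zw].
  suff -> : Qc z z = 1 by rewrite gser1.
  by apply/eqP; rewrite eq_sym -subr_eq0 Qc_1B// subrr n2_0 mul0r.
have h : 0 < n2 (1 - conjc w * z) by rewrite n2_gt0 one_subM_neq0.
have h2 : 0 < n2 (z - w) by rewrite n2_gt0 subr_eq0.
have Q1 : Qc z w < 1 by rewrite -subr_gt0 Qc_1B// divr_gt0.
rewrite gser_lt1// ?ltW ?Qc_gt0//; congr (_%:E).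
rewrite Qc_1B// -!cabs_sqr -exprVn -exprMn lnXn; last first.
  by rewrite divr_gt0// cabs_gt0 -n2_gt0.
have -> : cabs (1 - conjc w * z) / cabs (z - w) =
   (cabs (z - w) / cabs (1 - conjc w * z))^-1 by rewrite invf_div.
rewrite lnV ?posrE; last by rewrite divr_gt0// cabs_gt0 -n2_gt0.
by rewrite mulr2n; field.
Qed.

Lemma gser_ge0 q : 0 <= q -> (0 <= gser q)%E.
Proof.
by move=> q0; apply: nneseries_ge0 => n _ _; rewrite lee_fin mulr_ge0 ?clog_ge0 ?exprn_ge0.
Qed.

Lemma bl_1B w z : n2 w < 1 -> n2 z < 1 ->
  1 - n2 (bl w z) = (1 - n2 w) * (1 - n2 z) / n2 (1 - conjc w * z).
Proof.
move=> w1 z1; have h : n2 (1 - conjc w * z) != 0 by rewrite n2_eq0 one_subM_neq0.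
rewrite /bl n2M n2V; have := Qc_compl z w => <-; by field.
Qed.

Lemma bl_disk w z : n2 w < 1 -> n2 z < 1 -> n2 (bl w z) < 1.
Proof.
move=> w1 z1; rewrite -subr_gt0 bl_1B// divr_gt0 ?mulr_gt0 ?subr_gt0//.
by rewrite n2_gt0 one_subM_neq0.
Qed.

Lemma conjcV z : conjc z^-1 = (conjc z)^-1.
Proof. exact: conjc_inv. Qed.

(** Conformal invariance, which moves potentials of circles about [w] to circles about 0. *)
Lemma Qc_bl w z u : n2 w < 1 -> n2 z < 1 -> n2 u < 1 ->
  Qc (bl w z) (bl w u) = Qc z u.
Proof.
move=> w1 z1 u1; rewrite /Qc !bl_1B//.
have hz := one_subM_neq0 z1 w1; have hu := one_subM_neq0 u1 w1.
have huJ : 1 - w * conjc u != 0.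
  by have := hu; rewrite -conjc_eq0 conjcB conjcM conjcK conjc1.
have -> : 1 - conjc (bl w u) * bl w z = (1 - n2 w)%:C%C * (1 - conjc u * z) /
   ((1 - conjc w * z) * (1 - w * conjc u)).
  rewrite /bl conjcM conjcV !conjcB conjcM conjcK conjc1 RC1B.
  by field; rewrite hz huJ.
rewrite !n2M n2V n2M n2R.
have -> : n2 (1 - w * conjc u) = n2 (1 - conjc w * u).
  by rewrite -n2J conjcB conjcM conjcK conjc1.
have k1 : n2 (1 - conjc w * z) != 0 by rewrite n2_eq0.
have k2 : n2 (1 - conjc w * u) != 0 by rewrite n2_eq0.
have k3 : n2 (1 - conjc u * z) != 0 by rewrite n2_eq0 one_subM_neq0.
have k4 : 1 - n2 w != 0 by rewrite gt_eqF// subr_gt0.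
by field; rewrite k1 k2 k3 k4.
Qed.

Lemma bl_invol w z : n2 w < 1 -> n2 z < 1 -> bl w (bl (- w) z) = z.
Proof.
move=> w1 z1; have w1N : n2 (- w) < 1 by rewrite n2N.
have h := one_subM_neq0 z1 w1N.
have e0 : 1 - w * conjc w != 0.
  by rewrite -RC1B -n2_eq0 n2R sqrf_eq0 gt_eqF// subr_gt0.
rewrite /bl; rewrite conjcN mulNr !opprK in h *.
have E1 : (z + w) / (1 + conjc w * z) - w = (1 - w * conjc w) * z / (1 + conjc w * z).
  by field.
have E2 : 1 - conjc w * ((z + w) / (1 + conjc w * z)) = (1 - w * conjc w) / (1 + conjc w * z).
  by field.
by rewrite E1 E2; field; rewrite h e0.
Qed.

End GreenSeries.

(** * Positive definite kernels *)

Section PositiveDefinite.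
Variable R : realType.
Local Notation C := R[i].
Local Notation T := (R * R)%type.
Implicit Types (f g : T -> R) (k l : T -> T -> R) (mu nu : probability T R).

Definition bounded_mfun f := measurable_fun [set: T] f /\ exists b, forall x, `|f x| <= b.

Lemma bm_integrable mu f : bounded_mfun f -> mu.-integrable [set: T] (EFin \o f).
Proof.
move=> [mf [b fb]]; apply: measurable_bounded_integrable => //.
  exact: (le_lt_trans (probability_le1 mu measurableT) (ltry 1)).
exists b; split; first exact: num_real.
by move=> M bM x _; exact: le_trans (fb x) (ltW bM).
Qed.

Definition mean mu f : R := \int[mu]_x f x.

Lemma bmD f g : bounded_mfun f -> bounded_mfun g -> bounded_mfun (fun x => f x + g x).
Proof.
move=> [mf [b fb]] [mg [c gc]]; split; first exact: measurable_funD.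
by exists (b + c) => x; apply: (le_trans (ler_normD _ _)); exact: lerD.
Qed.

Lemma bmM f g : bounded_mfun f -> bounded_mfun g -> bounded_mfun (fun x => f x * g x).
Proof.
move=> [mf [b fb]] [mg [c gc]]; split; first exact: measurable_funM.
by exists (b * c) => x; rewrite normrM; exact: ler_pM.
Qed.

Lemma bm_cst (r : R) : bounded_mfun (fun=> r).
Proof. by split; [exact: measurable_cst|exists `|r| => _]. Qed.

Lemma bm_sum (I : finType) (F : I -> T -> R) : (forall i, bounded_mfun (F i)) ->
  bounded_mfun (fun x => \sum_i F i x).
Proof.
move=> FB; split; first by apply: measurable_sum => i; exact: (FB i).1.
have [b bE] := choice (fun i => (FB i).2).
exists (\sum_i b i) => x; apply: (le_trans (ler_norm_sum _ _ _)).
by apply: ler_sum => i _; exact: bE.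
Qed.

Lemma meanD mu f g : bounded_mfun f -> bounded_mfun g -> mean mu (fun x => f x + g x) = mean mu f + mean mu g.
Proof. by move=> fB gB; apply: RintegralD => //; exact: bm_integrable. Qed.

Lemma meanZ mu (r : R) f : bounded_mfun f -> mean mu (fun x => r * f x) = r * mean mu f.
Proof. by move=> fB; apply: RintegralZl => //; exact: bm_integrable. Qed.

Lemma mean_cst mu (r : R) : mean mu (fun=> r) = r.
Proof.
rewrite /mean Rintegral_cst//; transitivity (r * fine (1%E : \bar R)).
  by congr (r * fine _); exact: probability_setT.
exact: mulr1.
Qed.

Lemma mean_le mu f g : bounded_mfun f -> bounded_mfun g -> (forall x, f x <= g x) -> mean mu f <= mean mu g.
Proof. by move=> fB gB fg; apply: le_Rintegral => //; exact: bm_integrable. Qed.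

Lemma mean_sum mu (I : finType) (F : I -> T -> R) : (forall i, bounded_mfun (F i)) ->
  mean mu (fun x => \sum_i F i x) = \sum_i mean mu (F i).
Proof.
move=> FB.
have h (s : seq I) : bounded_mfun (fun x => \sum_(i <- s) F i x) /\
    mean mu (fun x => \sum_(i <- s) F i x) = \sum_(i <- s) mean mu (F i).
  elim: s => [|i s [IH1 IH2]].
    have -> : (fun x => \sum_(i <- [::]) F i x) = fun=> 0.
      by apply/funext => x; rewrite big_nil.
    by rewrite big_nil mean_cst; split => //; exact: bm_cst.
  have -> : (fun x => \sum_(j <- i :: s) F j x) =
      fun x => F i x + \sum_(j <- s) F j x.
    by apply/funext => x; rewrite big_cons.
  by rewrite big_cons -IH2 meanD//; split => //; exact: bmD.
exact: (h (index_enum I)).2.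
Qed.

Lemma mean_near mu f g (e : R) : bounded_mfun f -> bounded_mfun g -> (forall x, `|f x - g x| <= e) ->
  `|mean mu f - mean mu g| <= e.
Proof.
move=> fB gB fg; have eB (r : R) := bmD gB (bm_cst r).
have hE (r : R) : mean mu (fun x => g x + r) = mean mu g + r.
  by rewrite meanD ?mean_cst//; exact: bm_cst.
have k1 : mean mu g + - e <= mean mu f.
  rewrite -hE; apply: mean_le => // x.
  by have := fg x; rewrite ler_norml => /andP[? ?]; lra.
have k2 : mean mu f <= mean mu g + e.
  rewrite -hE; apply: mean_le => // x.
  by have := fg x; rewrite ler_norml => /andP[? ?]; lra.
by rewrite ler_norml; apply/andP; split; lra.
Qed.

Definition unit_kernel k := measurable_fun [set: T * T] (fun pq : T * T => k pq.1 pq.2) /\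
  forall p q, 0 <= k p q <= 1.

Lemma km_section k p : unit_kernel k -> bounded_mfun (k p).
Proof.
move=> [mk k01]; split.
  exact: (@measurable_fun_pair2 _ _ _ _ _ _ (fun pq : T * T => k pq.1 pq.2) p).
by exists 1 => q; have /andP[h0 h1] := k01 p q; rewrite ger0_norm.
Qed.

Lemma km_integralE nu k p : unit_kernel k ->
  (\int[nu]_q (k p q)%:E)%E = (mean nu (k p))%:E.
Proof.
move=> kM; rewrite /mean /Rintegral fineK//.
by apply: integrable_fin_num => //; exact: bm_integrable (km_section p kM).
Qed.

Lemma km_mean nu k : unit_kernel k -> bounded_mfun (fun p => mean nu (k p)).
Proof.
move=> kM; have [mk k01] := kM; split.
  apply/measurable_EFinP.
  have -> : EFin \o (fun p => mean nu (k p)) =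
      fubini_F nu (fun pq : T * T => (k pq.1 pq.2)%:E).
    by apply/funext => p; rewrite /= /fubini_F km_integralE.
  apply: measurable_fun_fubini_tonelli_F; first exact/measurable_EFinP.
  by move=> pq; rewrite lee_fin; have /andP[] := k01 pq.1 pq.2.
exists 1 => p; have sB := km_section p kM.
rewrite ger0_norm; last first.
  rewrite -(mean_cst nu 0); apply: mean_le => //; first exact: bm_cst.
  by move=> q; have /andP[] := k01 p q.
rewrite -(mean_cst nu 1); apply: mean_le => //; first exact: bm_cst.
by move=> q; have /andP[] := k01 p q.
Qed.

Definition mean2 mu nu k : R := mean mu (fun p => mean nu (k p)).

Lemma mean2E mu nu k : unit_kernel k ->
  (\int[mu]_p \int[nu]_q (k p q)%:E)%E = (mean2 mu nu k)%:E.
Proof.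
move=> kM; rewrite /mean2 /mean /Rintegral fineK; last first.
  by apply: integrable_fin_num => //; exact: bm_integrable (km_mean nu kM).
by apply: eq_integral => p _; rewrite km_integralE.
Qed.

(** Positive definiteness in a form that integrates by linearity alone: a uniform limit of Gram
    kernels of finitely many bounded real functions. *)
Definition feature_approx k := forall e : R, 0 < e -> exists (I : finType) (F : I -> T -> R),
  (forall i, bounded_mfun (F i)) /\ forall p q, `|k p q - \sum_i F i p * F i q| <= e.

(** Schur's product theorem: the features of a product are the products of the features. *)
Lemma approxM k l : unit_kernel k -> unit_kernel l -> feature_approx k -> feature_approx l ->
  feature_approx (fun p q => k p q * l p q).
Proof.
move=> [_ k01] [_ l01] ak al e e0.
pose d : R := Num.min 1 (e / 3).
have d0 : 0 < d by rewrite lt_min ltr01 divr_gt0.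
have d1 : d <= 1 by rewrite ge_min lexx.
have de : 3 * d <= e by rewrite -ler_pdivlMl// mulrC ge_min lexx orbT.
have [I [F [FB Fk]]] := ak d d0; have [J [G [GB Gl]]] := al d d0.
exists (I * J)%type, (fun ij x => F ij.1 x * G ij.2 x); split.
  by move=> ij; exact: bmM.
move=> p q.
have -> : \sum_ij (F ij.1 p * G ij.2 p) * (F ij.1 q * G ij.2 q) =
   (\sum_i F i p * F i q) * (\sum_j G j p * G j q).
  rewrite big_distrlr /= pair_big /=; apply: eq_bigr => ij _; ring.
have := Fk p q; have := Gl p q; have := k01 p q; have := l01 p q.
move: (k p q) (l p q) (\sum_i _) (\sum_j _) => a b A B /andP[b0 b1] /andP[a0 a1] hB hA.
have -> : a * b - A * B = a * (b - B) + (a - A) * B by ring.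
have Bn : `|B| <= 2.
  have -> : B = b - (b - B) by ring.
  by apply: (le_trans (ler_normB _ _)); rewrite (ger0_norm b0); lra.
apply: (le_trans (ler_normD _ _)); rewrite !normrM (ger0_norm a0).
have h1 : a * `|b - B| <= d by rewrite -[leRHS]mul1r ler_pM.
have h2 : `|a - A| * `|B| <= d * 2 by rewrite ler_pM.
by lra.
Qed.

Lemma mean2_feature mu nu (I : finType) (F : I -> T -> R) : (forall i, bounded_mfun (F i)) ->
  mean mu (fun p => mean nu (fun q => \sum_i F i p * F i q)) =
  \sum_i mean mu (F i) * mean nu (F i).
Proof.
move=> FB.
have -> : (fun p => mean nu (fun q => \sum_i F i p * F i q)) =
   fun p => \sum_i F i p * mean nu (F i).
  apply/funext => p; rewrite mean_sum; last by move=> i; apply: bmM => //; exact: bm_cst.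
  by apply: eq_bigr => i _; rewrite meanZ.
rewrite mean_sum; last by move=> i; apply: bmM => //; exact: bm_cst.
apply: eq_bigr => i _; have -> : (fun p => F i p * mean nu (F i)) =
   fun p => mean nu (F i) * F i p by apply/funext => p; rewrite mulrC.
by rewrite meanZ// mulrC.
Qed.

(** For a finite feature sum the claim is 2xy <= x^2 + y^2 with x, y the means of one feature; the
    approximation error is uniform. *)
Lemma mean2_posdef mu nu k : unit_kernel k -> feature_approx k ->
  2 * mean2 mu nu k <= mean2 mu mu k + mean2 nu nu k.
Proof.
move=> kM ak; apply/ler_addgt0Pr => e e0.
have e40 : 0 < e / 4 by rewrite divr_gt0.
have [I [F [FB Fk]]] := ak _ e40.
have FB2 p : bounded_mfun (fun q => \sum_i F i p * F i q).
  by apply: bm_sum => i; apply: bmM => //; exact: bm_cst.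
have near m n : `|mean2 m n k - \sum_i mean m (F i) * mean n (F i)| <= e / 4.
  rewrite -mean2_feature// /mean2; apply: mean_near.
  - exact: km_mean.
  - have -> : (fun p => mean n (fun q => \sum_i F i p * F i q)) =
       fun p => \sum_i F i p * mean n (F i).
      apply/funext => p; rewrite mean_sum; last by move=> i; apply: bmM => //; exact: bm_cst.
      by apply: eq_bigr => i _; rewrite meanZ.
    by apply: bm_sum => i; apply: bmM => //; exact: bm_cst.
  - by move=> p; apply: mean_near => //; exact: km_section.
have := near mu mu; have := near mu nu; have := near nu nu.
rewrite !ler_norml => /andP[a1 a2] /andP[b1 b2] /andP[c1 c2].
have : 2 * \sum_i mean mu (F i) * mean nu (F i) <=
   \sum_i mean mu (F i) * mean mu (F i) + \sum_i mean nu (F i) * mean nu (F i).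
  rewrite mulr_sumr -big_split /=; apply: ler_sum => i _.
  by have := sqr_ge0 (mean mu (F i) - mean nu (F i)); lra.
by lra.
Qed.

End PositiveDefinite.

(** * Green energy *)

Section EnergyKernel.
Variable R : realType.
Local Notation C := R[i].
Local Notation T := (R * R)%type.
Implicit Types (mu nu : probability T R) (rho : R).

Section ComplexMeasurable.
Context (d : measure_display) (X : measurableType d).
Implicit Types (h g : X -> C).

Definition cmeas h := measurable_fun [set: X] (fun x => complex.Re (h x)) /\
  measurable_fun [set: X] (fun x => complex.Im (h x)).

Lemma cmeas_cst (c : C) : cmeas (fun=> c).
Proof. by split; exact: measurable_cst. Qed.

Lemma cmeasM h g : cmeas h -> cmeas g -> cmeas (fun x => h x * g x).
Proof.
move=> [h1 h2] [g1 g2]; split.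
  under eq_fun do rewrite ReM.
  by apply: measurable_funB; exact: measurable_funM.
under eq_fun do rewrite ImM.
by apply: measurable_funD; exact: measurable_funM.
Qed.

Lemma cmeasB h g : cmeas h -> cmeas g -> cmeas (fun x => h x - g x).
Proof.
move=> [h1 h2] [g1 g2]; split.
  have -> : (fun x => complex.Re (h x - g x)) = fun x => complex.Re (h x) - complex.Re (g x).
    by apply/funext => x; case: (h x) (g x) => [? ?] [? ?].
  exact: measurable_funB.
have -> : (fun x => complex.Im (h x - g x)) = fun x => complex.Im (h x) - complex.Im (g x).
  by apply/funext => x; case: (h x) (g x) => [? ?] [? ?].
exact: measurable_funB.
Qed.

Lemma cmeasJ h : cmeas h -> cmeas (fun x => conjc (h x)).
Proof.
move=> [h1 h2]; split.
  have -> : (fun x => complex.Re (conjc (h x))) = fun x => complex.Re (h x).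
    by apply/funext => x; case: (h x).
  exact: h1.
have -> : (fun x => complex.Im (conjc (h x))) = fun x => 0 - complex.Im (h x).
  by apply/funext => x; case: (h x) => ? ?; rewrite sub0r.
by apply: measurable_funB => //; exact: measurable_cst.
Qed.

Lemma cmeasX h n : cmeas h -> cmeas (fun x => h x ^+ n).
Proof.
move=> hM; elim: n => [|n IH].
  by under eq_fun do rewrite expr0; exact: cmeas_cst.
by under eq_fun do rewrite exprS; exact: cmeasM.
Qed.

Lemma measurable_n2 h : cmeas h -> measurable_fun [set: X] (fun x => n2 (h x)).
Proof. by move=> [h1 h2]; apply: measurable_funD; exact: measurable_funX. Qed.

Lemma measurable_cabs h : cmeas h -> measurable_fun [set: X] (fun x => cabs (h x)).
Proof.
move=> hM; apply: (@measurableT_comp _ _ _ _ _ _ (@Num.sqrt R)); last exact: measurable_n2.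
exact: (continuous_measurable_fun (@sqrt_continuous R)).
Qed.

Lemma measurable_inv (f : X -> R) : measurable_fun [set: X] f -> (forall x, 0 <= f x) ->
  measurable_fun [set: X] (fun x => (f x)^-1).
Proof.
move=> mf f0; have -> : (fun x => (f x)^-1) = fun x => f x `^ (-1).
  by apply/funext => x; rewrite powR_inv1.
by apply: (@measurableT_comp _ _ _ _ _ _ (fun y : R => y `^ (-1))) => //; exact: measurable_powR.
Qed.

End ComplexMeasurable.

Lemma cmeas_toC : cmeas (@toC R).
Proof. by split; [exact: measurable_fst|exact: measurable_snd]. Qed.

Lemma cmeas_toC1 : cmeas (fun pq : T * T => toC pq.1).
Proof.
by split; exact: measurableT_comp.
Qed.

Lemma cmeas_toC2 : cmeas (fun pq : T * T => toC pq.2).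
Proof.
by split; exact: measurableT_comp.
Qed.

(** The cutoff, where [rho] bounds the squared modulus, gives values in [0, 1] on the whole plane
    and |conj w z| <= rho < 1, the uniformity needed for geometric expansions. *)
Definition Qk rho (p q : T) : R :=
  if (n2 (toC p) <= rho) && (n2 (toC q) <= rho) then Qc (toC p) (toC q) else 0.

Lemma Qk_01 rho p q : rho < 1 -> 0 <= Qk rho p q <= 1.
Proof.
move=> r1; rewrite /Qk; case: ifP => [/andP[hp hq]|_]; last by rewrite lexx ler01.
have p1 := le_lt_trans hp r1; have q1 := le_lt_trans hq r1.
by rewrite (ltW (Qc_gt0 p1 q1)) (Qc_le1 p1 q1).
Qed.

Lemma Qk_measurable rho :
  measurable_fun [set: T * T] (fun pq : T * T => Qk rho pq.1 pq.2).
Proof.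
have m1 := cmeas_toC1; have m2 := cmeas_toC2.
apply: measurable_fun_ifT; last exact: measurable_cst.
  by apply: measurable_and; apply: measurable_fun_ler => //; exact: measurable_n2.
apply: measurable_funM.
  by apply: measurable_funM; apply: measurable_funB => //; exact: measurable_n2.
apply: measurable_inv; last by move=> x; exact: n2_ge0.
apply: measurable_n2; apply: cmeasB; first exact: cmeas_cst.
by apply: cmeasM => //; exact: cmeasJ.
Qed.

Lemma km_QkX rho n : rho < 1 -> unit_kernel (fun p q => Qk rho p q ^+ n).
Proof.
move=> r1; split; first by apply: measurable_funX; exact: Qk_measurable.
move=> p q; have /andP[h0 h1] := Qk_01 p q r1.
by rewrite exprn_ge0//= exprn_ile1.
Qed.

(** Expands the square into monomials in z and conj z paired with their values at w; taking real
    parts lets [Re_mulJ] split each term into two products of real features. *)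
Lemma sum_features N (z w : C) :
  \sum_(jk : 'I_N * 'I_N) complex.Re ((z ^+ jk.1 * conjc z ^+ jk.2) *
     conjc (w ^+ jk.1 * conjc w ^+ jk.2)) =
  n2 (\sum_(j < N) (conjc w * z) ^+ j).
Proof.
set S := \sum_(j < N) _.
have -> : n2 S = complex.Re (S * conjc S) by rewrite mulcJ.
have -> : conjc S = \sum_(j < N) conjc ((conjc w * z) ^+ j).
  by rewrite /S; elim/big_ind2: _ => [|x1 x2 y1 y2 <- <-|//];
   rewrite ?conjc0 ?conjcD.
rewrite big_distrlr /= pair_big /=.
have H (s : seq ('I_N * 'I_N)) (G : 'I_N * 'I_N -> C) :
   complex.Re (\sum_(i <- s) G i) = \sum_(i <- s) complex.Re (G i).
  by elim/big_ind2: _ => // x1 x2 y1 y2 <- <-; rewrite ReD.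
rewrite H; apply: eq_bigr => -[j k] _ /=; congr complex.Re.
have cX (u : C) n : conjc (u ^+ n) = conjc u ^+ n.
  by elim: n => [|n IH]; rewrite ?expr0 ?conjc1// !exprS conjcM IH.
rewrite conjcM !cX conjcM !conjcK !exprMn; ring.
Qed.

Lemma Re_mulJ (a b : C) : complex.Re (a * conjc b) =
  complex.Re a * complex.Re b + complex.Im a * complex.Im b.
Proof. by case: a b => [? ?] [? ?] /=; ring. Qed.

(** With x = conj w z, truncating the geometric series for 1 / (1 - x) replaces Q by Q |1 - x^N|^2,
    an error of at most 2|x^N| + |x^N|^2 <= 3 rho^N. *)
Lemma approx_Qk rho : 0 <= rho -> rho < 1 -> feature_approx (Qk rho).
Proof.
move=> r0 r1 e e0.
have [N hN] : exists N, 3 * rho ^+ N <= e.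
  have : (fun n => rho ^+ n) @ \oo --> (0 : R) by apply: cvg_expr; rewrite ger0_norm.
  have e30 : 0 < e / 3 by rewrite divr_gt0.
  move=> /cvgrPdist_le /(_ _ e30)[N _ hN]; exists N.
  have := hN N (leqnn N); rewrite sub0r normrN ger0_norm ?exprn_ge0//.
  by rewrite ler_pdivlMr// mulrC.
pose chi (p : T) : R := if n2 (toC p) <= rho then 1 - n2 (toC p) else 0.
pose m (jk : 'I_N * 'I_N) (p : T) : C := toC p ^+ jk.1 * conjc (toC p) ^+ jk.2.
pose F (i : bool * ('I_N * 'I_N)) (p : T) : R :=
  chi p * (if i.1 then complex.Re (m i.2 p) else complex.Im (m i.2 p)).
exists (bool * ('I_N * 'I_N))%type, F; split.
  move=> [b jk]; rewrite /F /=.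
  have mM : cmeas (m jk).
    by apply: cmeasM; apply: cmeasX; [exact: cmeas_toC|apply: cmeasJ; exact: cmeas_toC].
  split.
    apply: measurable_funM.
      apply: measurable_fun_ifT; last exact: measurable_cst.
        by apply: measurable_fun_ler => //; apply: measurable_n2; exact: cmeas_toC.
      by apply: measurable_funB => //; apply: measurable_n2; exact: cmeas_toC.
    by case: b; [exact: mM.1|exact: mM.2].
  exists 1 => p; rewrite /chi; case: ifP => [hp|_]; last by rewrite mul0r normr0.
  have p1 : n2 (toC p) <= 1 by exact: ltW (le_lt_trans hp r1).
  have m1 : cabs (m jk p) <= 1.
    rewrite cabs_le// expr1n /m n2M !n2X n2J -exprD.
    by apply: exprn_ile1 => //; exact: n2_ge0.
  rewrite normrM -[leRHS]mulr1; apply: ler_pM => //.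
    by rewrite ger0_norm ?subr_ge0// gerBl n2_ge0.
  by case: b; apply: le_trans m1; [exact: Re_cabs|exact: Im_cabs].
move=> p q.
have -> : \sum_i F i p * F i q =
   chi p * chi q * n2 (\sum_(j < N) (conjc (toC q) * toC p) ^+ j).
  rewrite -sum_features mulr_sumr.
  rewrite -(pair_big xpredT xpredT (fun b jk => F (b, jk) p * F (b, jk) q)) /=.
  rewrite big_bool /= -big_split /=; apply: eq_bigr => jk _.
  rewrite /F /= -/(m jk p) -/(m jk q) Re_mulJ; ring.
rewrite /Qk /chi; case: ifP => [/andP[hp hq]|]; last first.
  by case: (n2 (toC p) <= rho) => //=; [move=> ->|]; rewrite ?mulr0 ?mul0r subrr normr0 ltW.
rewrite hp hq; move: hp hq; move: (toC p) (toC q) => z w hz hw.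
have z1 := le_lt_trans hz r1; have w1 := le_lt_trans hw r1.
set x := conjc w * z; have hx := one_subM_neq0 z1 w1; rewrite -/x in hx.
have geo : (\sum_(j < N) x ^+ j) * (1 - x) = 1 - x ^+ N.
  elim: (N) => [|n IH]; first by rewrite big_ord0 mul0r expr0 subrr.
  by rewrite big_ord_recr /= mulrDl IH exprS; ring.
have -> : (1 - n2 z) * (1 - n2 w) * n2 (\sum_(j < N) x ^+ j) = Qc z w * n2 (1 - x ^+ N).
  have k : n2 (1 - x) != 0 by rewrite n2_eq0.
  by rewrite -geo n2M /Qc -/x; field.
have Q0 := ltW (Qc_gt0 z1 w1); have Q1 := Qc_le1 z1 w1.
rewrite -{1}(mulr1 (Qc z w)) -mulrBr normrM (ger0_norm Q0).
apply: (@le_trans _ _ `|1 - n2 (1 - x ^+ N)|); first by rewrite ler_piMl.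
apply: le_trans hN.
have hy : cabs (x ^+ N) <= rho ^+ N.
  rewrite cabs_le ?exprn_ge0// n2X -exprM mulnC exprM.
  apply: lerXn2r; rewrite ?nnegrE ?n2_ge0 ?sqr_ge0//.
  by rewrite n2M n2J expr2; apply: ler_pM; rewrite ?n2_ge0.
have rN1 : rho ^+ N <= 1 by apply: exprn_ile1 => //; exact: ltW.
have rN0 : 0 <= rho ^+ N by rewrite exprn_ge0.
move: (x ^+ N) hy => y hy.
have -> : 1 - n2 (1 - y) = 2 * complex.Re y - n2 y.
  by case: (y) => [? ?]; rewrite /n2 /=; ring.
have hR := Re_cabs y; have h0 := cabs_ge0 y; rewrite -cabs_sqr.
apply: (le_trans (ler_normB _ _)).
rewrite normrM (ger0_norm (sqr_ge0 _)) (@ger0_norm _ 2)//.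
have : cabs y ^+ 2 <= cabs y by rewrite expr2 ler_piMr//; lra.
by lra.
Qed.

Lemma approx_QkX rho n : 0 <= rho -> rho < 1 -> feature_approx (fun p q => Qk rho p q ^+ n.+1).
Proof.
move=> r0 r1; elim: n => [|n IH]; first exact: approx_Qk.
have -> : (fun p q => Qk rho p q ^+ n.+2) = fun p q => Qk rho p q * Qk rho p q ^+ n.+1.
  by apply/funext => p; apply/funext => q; rewrite exprS.
apply: approxM => //; last exact: approx_Qk.
  exact: (@km_QkX rho 1).
exact: km_QkX.
Qed.

Lemma gser_mean rho nu p : rho < 1 ->
  (\int[nu]_q gser (Qk rho p q))%E =
  (\sum_(0 <= n <oo) (clog R n * mean nu (fun q => Qk rho p q ^+ n.+1))%:E)%E.
Proof.
move=> r1; rewrite /gser integral_nneseries//.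
- congr (limn _); apply/funext => N; apply: eq_bigr => n _.
  have kM := @km_QkX rho n.+1 r1.
  transitivity ((clog R n)%:E * (\int[nu]_q ((Qk rho p q ^+ n.+1)%:E)))%E.
    rewrite -ge0_integralZl//.
    - by apply/measurable_EFinP; exact: (km_section p kM).1.
    - by move=> q _; rewrite lee_fin; have /andP[] := kM.2 p q.
    - by rewrite lee_fin clog_ge0.
  by rewrite (km_integralE _ _ kM).
- move=> n; apply/measurable_EFinP; apply: measurable_funM => //.
  exact: (km_section p (@km_QkX rho n.+1 r1)).1.
- move=> n q _; rewrite lee_fin mulr_ge0 ?clog_ge0//.
  by have /andP[] := (@km_QkX rho n.+1 r1).2 p q.
Qed.

Lemma gser_mean2 rho mu nu : rho < 1 ->
  (\int[mu]_p \int[nu]_q gser (Qk rho p q))%E =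
  (\sum_(0 <= n <oo) (clog R n * mean2 mu nu (fun p q => Qk rho p q ^+ n.+1))%:E)%E.
Proof.
move=> r1; under eq_integral do rewrite gser_mean//.
have bmn n := km_mean nu (@km_QkX rho n.+1 r1).
have pos n p : 0 <= mean nu (fun q => Qk rho p q ^+ n.+1).
  have kM := @km_QkX rho n.+1 r1.
  rewrite -(mean_cst nu 0); apply: mean_le; [exact: bm_cst|exact: km_section kM|].
  by move=> q; have /andP[] := kM.2 p q.
rewrite integral_nneseries//.
- congr (limn _); apply/funext => N; apply: eq_bigr => n _.
  have kM := @km_QkX rho n.+1 r1.
  transitivity ((clog R n)%:E * (\int[mu]_p ((mean nu (fun q => Qk rho p q ^+ n.+1))%:E)))%E.
    rewrite -ge0_integralZl//.
    - by apply/measurable_EFinP; exact: (bmn n).1.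
    - by move=> q _; rewrite lee_fin.
    - by rewrite lee_fin clog_ge0.
  rewrite EFinM; congr (_ * _)%E; rewrite -(mean2E mu nu kM).
  by apply: eq_integral => p _; rewrite (km_integralE _ _ kM).
- by move=> n; apply/measurable_EFinP; apply: measurable_funM => //; exact: (bmn n).1.
- by move=> n q _; rewrite lee_fin mulr_ge0 ?clog_ge0.
Qed.

(** Holds term by term in the series. The additive form avoids subtracting energies that may be
    infinite. *)
Lemma energy_posdef rho mu nu : 0 <= rho -> rho < 1 ->
  (2%:E * \int[mu]_p \int[nu]_q gser (Qk rho p q) <=
   \int[mu]_p \int[mu]_q gser (Qk rho p q) + \int[nu]_p \int[nu]_q gser (Qk rho p q))%E.
Proof.
move=> r0 r1; rewrite !gser_mean2//.
have pos m n i : (0 <= (clog R i * mean2 m n (fun p q => Qk rho p q ^+ i.+1))%:E)%E.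
  have kM := @km_QkX rho i.+1 r1.
  rewrite lee_fin mulr_ge0 ?clog_ge0// -(mean_cst m 0); apply: mean_le => //.
  - exact: bm_cst.
  - exact: km_mean.
  move=> p; rewrite -(mean_cst n 0); apply: mean_le; [exact: bm_cst|exact: km_section kM|].
  by move=> q; have /andP[] := kM.2 p q.
rewrite -nneseriesZl// -nneseriesD//; apply: lee_nneseries.
  by move=> i _ _; rewrite mule_ge0.
move=> n _; rewrite -EFinM -EFinD lee_fin mulrCA -mulrDr ler_wpM2l ?clog_ge0//.
by apply: mean2_posdef; [exact: km_QkX|exact: approx_QkX].
Qed.

Lemma measurable_green :
  measurable_fun [set: T * T] (fun pq : T * T => green (toC pq.1) (toC pq.2)).
Proof.
have m1 := cmeas_toC1; have m2 := cmeas_toC2.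
apply: measurable_fun_ifT.
- have -> : (fun pq : T * T => toC pq.1 == toC pq.2) =
     fun pq : T * T => (complex.Re (toC pq.1) == complex.Re (toC pq.2)) &&
       (complex.Im (toC pq.1) == complex.Im (toC pq.2)).
    by apply/funext => pq; rewrite eq_complex.
  apply: measurable_and; apply: measurable_fun_eqr;
    [exact: m1.1|exact: m2.1|exact: m1.2|exact: m2.2].
- exact: measurable_cst.
apply/measurable_EFinP; apply: (@measurableT_comp _ _ _ _ _ _ (@ln R)).
  exact: measurable_ln.
apply: measurable_funM.
  apply: measurable_cabs; apply: cmeasB; first exact: cmeas_cst.
  by apply: cmeasM => //; exact: cmeasJ.
apply: measurable_inv; last by move=> x; exact: cabs_ge0.
by apply: measurable_cabs; exact: cmeasB.
Qed.

(** Tonelli on the positive and negative parts, since [green] may be negative off the disk. *)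
Lemma measurable_integral2 nu (h : T * T -> \bar R) :
  measurable_fun [set: T * T] h ->
  measurable_fun [set: T] (fun p => \int[nu]_q h (p, q))%E.
Proof.
move=> mh.
have -> : (fun p => \int[nu]_q h (p, q))%E =
   (fun p => fubini_F nu (h^\+)%E p - fubini_F nu (h^\-)%E p)%E.
  apply/funext => p; rewrite integralE /fubini_F; congr (_ - _)%E;
    apply: eq_integral => q _; by rewrite ?funeposE ?funenegE.
apply: emeasurable_funB; apply: measurable_fun_fubini_tonelli_F => //.
- exact: measurable_funepos.
- exact: measurable_funeneg.
Qed.

Lemma integral2_ae mu (h g : T * T -> \bar R) (A : set T) : measurable A ->
  mu (~` A) = 0%E -> measurable_fun [set: T * T] h -> measurable_fun [set: T * T] g ->
  (forall p q, A p -> A q -> h (p, q) = g (p, q)) ->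
  (\int[mu]_p \int[mu]_q h (p, q) = \int[mu]_p \int[mu]_q g (p, q))%E.
Proof.
move=> mA A0 mh mg hg.
have neg : mu.-negligible (~` A).
  by exists (~` A); split => //; exact: measurableC.
apply: ae_eq_integral => //; try exact: measurable_integral2.
apply: (negligibleS _ neg) => p /= hp; apply: contra_not hp => Ap _.
apply: ae_eq_integral => //.
- exact: measurable_fun_pair2.
- exact: measurable_fun_pair2.
apply: (negligibleS _ neg) => q /= hq; apply: contra_not hq => Aq _.
exact: hg.
Qed.

Lemma measurable_gser rho : rho < 1 ->
  measurable_fun [set: T * T] (fun pq : T * T => gser (Qk rho pq.1 pq.2)).
Proof.
move=> r1; rewrite /gser; apply: ge0_emeasurable_sum => k.
  by move=> pq _ _; rewrite lee_fin mulr_ge0 ?clog_ge0// exprn_ge0//;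
    have /andP[] := Qk_01 pq.1 pq.2 r1.
move=> _; apply/measurable_EFinP; apply: measurable_funM => //.
by apply: measurable_funX; exact: Qk_measurable.
Qed.

Definition cdisk rho : set T := [set p | n2 (toC p) <= rho].

Lemma measurable_cdisk rho : measurable (cdisk rho).
Proof.
rewrite /cdisk -[X in measurable X]setTI.
apply: measurable_fun_le => //; apply: measurable_n2; exact: cmeas_toC.
Qed.

Lemma energy_gser rho mu : rho < 1 -> mu (~` cdisk rho) = 0%E ->
  energy mu = (\int[mu]_p \int[mu]_q gser (Qk rho p q))%E.
Proof.
move=> r1 m0; rewrite /energy.
apply: (@integral2_ae mu (fun pq => green (toC pq.1) (toC pq.2))
  (fun pq => gser (Qk rho pq.1 pq.2)) (cdisk rho)) => //.
- exact: measurable_cdisk.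
- exact: measurable_green.
- exact: measurable_gser.
move=> p q; rewrite /cdisk /= => hp hq.
have p1 := le_lt_trans hp r1; have q1 := le_lt_trans hq r1.
by rewrite green_gser// /Qk hp hq.
Qed.

Lemma energy_ge0 mu (A : set T) : measurable A -> mu (~` A) = 0%E ->
  (forall p, A p -> n2 (toC p) < 1) -> (0 <= energy mu)%E.
Proof.
move=> mA A0 A1; rewrite /energy.
rewrite (@integral2_ae mu (fun pq => green (toC pq.1) (toC pq.2))
  (fun pq => maxe (green (toC pq.1) (toC pq.2)) 0) A) //.
- by apply: integral_ge0 => p _; apply: integral_ge0 => q _; rewrite le_max lexx orbT.
- exact: measurable_green.
- by apply: measurable_maxe => //; exact: measurable_green.
move=> p q /A1 p1 /A1 q1 /=; rewrite green_gser//; apply/esym/max_idPl.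
by apply: gser_ge0; exact: ltW (Qc_gt0 p1 q1).
Qed.

End EnergyKernel.

(** * Equilibrium measures *)

Section EquilibriumMeasure.
Variable R : realType.
Local Notation C := R[i].
Local Notation T := (R * R)%type.
Local Notation leb := (@lebesgue_measure R).
Implicit Types (mu : probability T R) (z w u v : C) (r rho t : R).

(** Links the topology of [C^o] to the product sigma-algebra: the open complement is a countable
    union of boxes with rational centres and sides given by 1 / (n + 1). *)
Lemma closed_toC_measurable (A : set C^o) : closed A -> measurable (@toC R @^-1` A : set T).
Proof.
move=> cA; rewrite -[X in measurable X]setCK; apply: measurableC.
pose box (x : rat * rat * nat) : set T :=
  [set p | (`|p.1 - ratr x.1.1| < (x.2.+1%:R)^-1) && (`|p.2 - ratr x.1.2| < (x.2.+1%:R)^-1)].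
pose F x := if `[< box x `<=` ~` (@toC R @^-1` A) >] then box x else set0.
have -> : ~` (@toC R @^-1` A) = \bigcup_x F x.
  apply/seteqP; split; last first.
    by move=> p [x _]; rewrite /F; case: asboolP => // h /h.
  move=> p /= pA.
  have : nbhs (toC p : C^o) (~` A).
    by apply: open_nbhs_nbhs; split => //; exact: closed_openC.
  move=> /nbhs_ballP[e /= e0 he].
  have e0R : 0 < complex.Re e by move: e0; rewrite ltcE => /andP[].
  have eE : e = (complex.Re e)%:C%C.
    by move: e0; case: (e) => x y; rewrite ltcE /= => /andP[/eqP -> _].
  pose n := Num.bound (4 / complex.Re e).
  have hn : 4 / complex.Re e < n.+1%:R.
    apply: (@lt_trans _ _ n%:R); last by rewrite ltr_nat.
    by apply: archi_boundP; rewrite divr_ge0// ltW.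
  have n0 : 0 < (n.+1%:R : R)^-1 by rewrite invr_gt0.
  have {}hn : 4 * (n.+1%:R)^-1 < complex.Re e.
    by rewrite ltr_pdivrMr// mulrC -ltr_pdivrMr.
  have lt (x : R) : x - (n.+1%:R)^-1 < x + (n.+1%:R)^-1.
    by rewrite ltrD2l; apply: lt_trans n0; rewrite oppr_lt0.
  have [a ha] := rat_in_itvoo (lt p.1); have [b hb] := rat_in_itvoo (lt p.2).
  rewrite !in_itv /= in ha hb.
  have pbox : box (a, b, n) p.
    rewrite /box /= !ltr_norml; move: ha hb => /andP[a1 a2] /andP[b1 b2].
    move: (n.+1%:R^-1) a1 a2 b1 b2 => d' a1 a2 b1 b2.
    by apply/andP; split; apply/andP; split; lra.
  exists (a, b, n) => //; rewrite /F; case: asboolP => // -[] q qbox.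
  apply: he; rewrite -ball_normE /= normc_cabs eE ltcR cabs_lt ?(ltW e0R)//.
  move: pbox qbox; rewrite /box /= !ltr_norml /n2 /=.
  move: (n.+1%:R^-1) (complex.Re e) n0 hn => d E d0 dE.
  move=> /andP[/andP[? ?] /andP[? ?]] /andP[/andP[? ?] /andP[? ?]].
  have h1 : (p.1 - q.1) ^+ 2 <= (2 * d) ^+ 2.
    by rewrite -ler_sqrt ?sqr_ge0// !sqrtr_sqr (@ger0_norm _ (2 * d)) ?ler_norml; lra.
  have h2 : (p.2 - q.2) ^+ 2 <= (2 * d) ^+ 2.
    by rewrite -ler_sqrt ?sqr_ge0// !sqrtr_sqr (@ger0_norm _ (2 * d)) ?ler_norml; lra.
  by nra.
apply: countable_bigcupT_measurable; first exact: countableP.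
move=> x; rewrite /F; case: asboolP => // _.
rewrite /box -[X in measurable X]setTI.
have -> : [set: T] `&` [set p | (`|p.1 - ratr x.1.1| < x.2.+1%:R^-1) && (`|p.2 - ratr x.1.2| < x.2.+1%:R^-1)]
  = (fun p : T => (`|p.1 - ratr x.1.1| < x.2.+1%:R^-1) && (`|p.2 - ratr x.1.2| < x.2.+1%:R^-1)) @^-1` [set true].
  by apply/seteqP; split => p /=; [case|].
rewrite -[X in measurable X]setTI.
have mm : measurable_fun [set: T] (fun p : T =>
  (`|p.1 - ratr x.1.1| < x.2.+1%:R^-1) && (`|p.2 - ratr x.1.2| < x.2.+1%:R^-1)).
  apply: measurable_and; apply: measurable_fun_ltr => //;
   apply: measurableT_comp => //; apply: measurable_funB => //.
exact: mm.
Qed.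

Lemma cmeas_cis : cmeas (fun t : measurableTypeR R => cis t).
Proof.
split.
  exact: (continuous_measurable_fun (@continuous_cos2pi R)).
exact: (continuous_measurable_fun (@continuous_sin2pi R)).
Qed.

Definition circle r t : C := r%:C%C * cis t.

Lemma cmeas_circle r : cmeas (fun t : measurableTypeR R => circle r t).
Proof. by apply: cmeasM; [exact: cmeas_cst|exact: cmeas_cis]. Qed.

Lemma n2_circle r t : n2 (circle r t) = r ^+ 2.
Proof. by rewrite n2M n2R n2_cis mulr1. Qed.

Lemma measurable_Qc_circle u r :
  measurable_fun [set: measurableTypeR R] (fun t => Qc u (circle r t)).
Proof.
apply: measurable_funM.
  apply: measurable_funM => //; apply: measurable_funB => //.
  by apply: measurable_n2; exact: cmeas_circle.
apply: measurable_inv; last by move=> x; exact: n2_ge0.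
apply: measurable_n2; apply: cmeasB; first exact: cmeas_cst.
by apply: cmeasM; [apply: cmeasJ; exact: cmeas_circle|exact: cmeas_cst].
Qed.

Definition pot r u : \bar R := (\int[leb]_(t in `[0%R, 1%R]) gser (Qc u (circle r t)))%E.

(** On the circle the Green function is lnc x - ln r - lnc y with x = r conj u and y = conj u / r.
    Both lie in the disk, so both logarithmic means vanish. *)
Lemma pot_in r u : 0 < r -> r < 1 -> cabs u < r -> pot r u = (- ln r)%:E.
Proof.
move=> r0 r1 ur.
have u1 : n2 u < 1.
  by rewrite -cabs_sqr expr_lt1 ?cabs_ge0//; exact: lt_trans r1.
have rr1 : r ^+ 2 < 1 by rewrite expr_lt1// ltW.
pose x := r%:C%C * conjc u; pose y := conjc u / r%:C%C.
have rC : r%:C%C != 0 :> C by rewrite -n2_eq0 n2R sqrf_eq0 gt_eqF.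
have x1 : cabs x < 1.
  rewrite cabsM cabsR ?(ltW r0)// cabsJ -[ltRHS]mul1r.
  by apply: ltr_pM; rewrite ?cabs_ge0 ?(ltW r0)//; exact: lt_trans r1.
have y1 : cabs y < 1.
  by rewrite cabsM cabsV cabsR ?(ltW r0)// cabsJ ltr_pdivrMr// mul1r.
have p1 t : 0 < cabs (1 - x * cis t).
  by have /andP[h _] := cabs_1B_cis x t; apply: lt_le_trans h; rewrite subr_gt0.
have p2 t : 0 < cabs (1 - y * cis t).
  by have /andP[h _] := cabs_1B_cis y t; apply: lt_le_trans h; rewrite subr_gt0.
have E t : gser (Qc u (circle r t)) = (lnc x t + (- ln r + -1 * lnc y t))%:E.
  rewrite -green_gser ?n2_circle// /green.
  have uv : u != circle r t.
    apply/eqP => uE; have := n2_circle r t; rewrite -uE -cabs_sqr => /eqP.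
    by rewrite eqrXn2 ?cabs_ge0 ?(ltW r0)// lt_eqF.
  rewrite (negbTE uv); congr (_%:E).
  have -> : cabs (1 - conjc (circle r t) * u) = cabs (1 - x * cis t).
    by rewrite -cabsJ conjcB conjcM conjcK conjc1 /circle /x; congr (cabs (1 - _)); ring.
  have -> : cabs (u - circle r t) = r * cabs (1 - y * cis t).
    have cisJ : conjc (cis t) * cis t = 1 by rewrite mulrC mulcJ n2_cis.
    have -> : u - circle r t = (- r%:C%C * cis t) * conjc (1 - y * cis t).
      rewrite conjcB conjc1 conjcM /y conjcM conjcV conjcR conjcK mulrBr mulr1.
      have -> : - r%:C%C * cis t * (u / r%:C%C * conjc (cis t)) =
         - (r%:C%C / r%:C%C) * u * (conjc (cis t) * cis t) by ring.
      by rewrite divff// cisJ /circle; ring.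
    rewrite !cabsM cabsN cabsR ?(ltW r0)// cabsJ.
    by rewrite [cabs (cis t)]cabsE n2_cis sqrtr1 mulr1.
  rewrite ln_div ?posrE ?mulr_gt0// lnM ?posrE// /lnc; lra.
rewrite /pot; under eq_integral do rewrite E.
have cx := continuous_lnc x1; have cy := continuous_lnc y1.
have c2 : continuous (fun t : R => - ln r + -1 * lnc y t).
  move=> t; apply: cvgD; first exact: cvg_cst.
  by apply: cvgM; [exact: cvg_cst|exact: cy].
have c1 : continuous (fun t : R => lnc x t + (- ln r + -1 * lnc y t)).
  by move=> t; apply: cvgD; [exact: cx|exact: c2].
have m1 : fine (leb (`[0, 1]%classic : set R)) = 1.
  by rewrite lebesgue_measure_itv /= lte_fin ltr01 oppr0 adde0.
rewrite -[LHS]fineK; last first.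
  by apply: (@integrable_fin_num _ _ _ leb) => //; exact: (integrable_itv 0 1 c1).
congr (_%:E); rewrite -/(Rintegral leb _ _).
rewrite RintegralD//; [|exact: integrable_itv..].
rewrite RintegralD//; last 2 first.
- by apply: integrable_itv => t; exact: cvg_cst.
- by apply: integrable_itv => t; apply: cvgM; [exact: cvg_cst|exact: cy].
rewrite RintegralZl//; last exact: integrable_itv.
rewrite Rintegral_cst// m1 -!/(cmean _) !cmean0//; lra.
Qed.

(** Shrinking [u] raises the numerator and moves 1 - conj v u by at most 1 - lam, while its modulus
    is at least 1 - r^2; so the modulus grows at most by the factor 1 + d. *)
Lemma Qc_scale u v (lam d r : R) : 0 <= lam -> lam <= 1 -> r < 1 -> 0 <= r ->
  cabs u <= r -> cabs v <= r -> 1 - lam <= d * (1 - r ^+ 2) ->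
  Qc u v <= (1 + d) ^+ 2 * Qc (lam%:C%C * u) v.
Proof.
move=> l0 l1 r1 r0 ur vr hd.
have rr : 0 < 1 - r ^+ 2 by rewrite subr_gt0 expr_lt1.
have d0 : 0 <= d by rewrite -(pmulr_lge0 _ rr); lra.
have nu : n2 u <= r ^+ 2 by rewrite -cabs_le.
have nv : n2 v <= r ^+ 2 by rewrite -cabs_le.
have u1 : n2 u < 1 by lra.
have v1 : n2 v < 1 by lra.
have nl : n2 (lam%:C%C * u) <= n2 u.
  by rewrite n2M n2R ler_piMl ?n2_ge0// expr_le1.
have lu1 := le_lt_trans nl u1.
have h1 : 0 < n2 (1 - conjc v * u) by rewrite n2_gt0 one_subM_neq0.
have h2 : 0 < n2 (1 - conjc v * (lam%:C%C * u)) by rewrite n2_gt0 one_subM_neq0.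
have xr : cabs (conjc v * u) <= r ^+ 2.
  by rewrite cabsM cabsJ expr2; apply: ler_pM; rewrite ?cabs_ge0.
have k1 : 1 - r ^+ 2 <= cabs (1 - conjc v * u).
  have := cabsD (1 - conjc v * u) (conjc v * u); rewrite subrK.
  by rewrite [cabs 1]cabsE n2_1 sqrtr1; lra.
have k2 : cabs (1 - conjc v * (lam%:C%C * u)) <= (1 + d) * cabs (1 - conjc v * u).
  have -> : 1 - conjc v * (lam%:C%C * u) = (1 - conjc v * u) + (1 - lam)%:C%C * (conjc v * u).
    by rewrite rmorphB rmorph1; ring.
  apply: (le_trans (cabsD _ _)); rewrite cabsM cabsR ?subr_ge0//.
  have : (1 - lam) * cabs (conjc v * u) <= 1 - lam.
    by rewrite ler_piMr ?subr_ge0//; lra.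
  have : d * (1 - r ^+ 2) <= d * cabs (1 - conjc v * u) by rewrite ler_wpM2l.
  by lra.
have k3 : n2 (1 - conjc v * (lam%:C%C * u)) <= (1 + d) ^+ 2 * n2 (1 - conjc v * u).
  rewrite -!cabs_sqr -exprMn ler_pXn2r ?nnegrE ?cabs_ge0//.
  by rewrite mulr_ge0 ?cabs_ge0//; lra.
rewrite /Qc [leRHS]mulrA ler_pdivrMr// [leRHS]mulrAC ler_pdivlMr//.
have -> : (1 + d) ^+ 2 * ((1 - n2 (lam%:C%C * u)) * (1 - n2 v)) * n2 (1 - conjc v * u) =
  ((1 - n2 (lam%:C%C * u)) * (1 - n2 v)) * ((1 + d) ^+ 2 * n2 (1 - conjc v * u)) by ring.
apply: ler_pM => //; rewrite ?n2_ge0 ?mulr_ge0 ?subr_ge0 ?(ltW u1) ?(ltW v1)//.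
by rewrite ler_pM2r ?subr_gt0//; lra.
Qed.

(* On the circle itself the potential is a limit of potentials at interior
   points, compared termwise in the series by [Qc_scale]. *)
Lemma pot_le r u : 0 < r -> r < 1 -> cabs u <= r -> (pot r u <= (- ln r)%:E)%E.
Proof.
move=> r0 r1 ur.
have nr : r ^+ 2 < 1 by rewrite expr_lt1// ltW.
have rr : 0 < 1 - r ^+ 2 by rewrite subr_gt0.
have Q01 x t : cabs x <= r -> 0 <= Qc x (circle r t).
  move=> xr; have x1 : n2 x < 1 by rewrite -cabs_sqr expr_lt1 ?cabs_ge0//; exact: le_lt_trans r1.
  by apply: ltW; apply: Qc_gt0 => //; rewrite n2_circle.
have mE x n : measurable_fun (`[0%R, 1%R]%classic : set (measurableTypeR R))
    (fun t : measurableTypeR R => (clog R n * Qc x (circle r t) ^+ n.+1)%:E).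
  apply: measurable_funTS; apply/measurable_EFinP; apply: measurable_funM => //.
  by apply: measurable_funX; exact: measurable_Qc_circle.
have pE x : cabs x <= r -> pot r x =
    (\sum_(0 <= n <oo) \int[leb]_(t in `[0%R, 1%R]) (clog R n * Qc x (circle r t) ^+ n.+1)%:E)%E.
  move=> xr; rewrite /pot /gser integral_nneseries//.
  by move=> n t _; rewrite lee_fin mulr_ge0 ?clog_ge0// exprn_ge0// Q01.
have tpos x n : cabs x <= r ->
   (0 <= \int[leb]_(t in `[0%R, 1%R]) (clog R n * Qc x (circle r t) ^+ n.+1)%:E)%E.
  by move=> xr; apply: integral_ge0 => t _; rewrite lee_fin mulr_ge0 ?clog_ge0// exprn_ge0// Q01.
rewrite pE//; apply: lime_le.
  by apply: is_cvg_nneseries => n _ _; exact: tpos.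
apply: nearW => N; rewrite big_mkord.
set P := (\sum_(n < N) _)%E.
have P0 : (0 <= P)%E by apply: sume_ge0 => n _; exact: tpos.
pose dk (k : nat) : R := (k.+1%:R)^-1.
(* Each factor Q costs D^2, hence at most D^(2N) for the first N terms; N stays fixed while k
   grows. *)
pose b k := (1 + dk k / (1 - r ^+ 2)) ^+ (2 * N) * - ln r.
have Pk k : (P <= (b k)%:E)%E.
  have dk0 : 0 < dk k by rewrite invr_gt0.
  have dk1 : dk k <= 1 by rewrite invf_le1// ler1n.
  pose lam := 1 - dk k.
  have lr : cabs (lam%:C%C * u) < r.
    rewrite cabsM cabsR ?subr_ge0//; apply: (@le_lt_trans _ _ (lam * r)).
      by rewrite ler_wpM2l ?subr_ge0.
    by rewrite gtr_pMl// gtrBl.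
  set D := 1 + dk k / (1 - r ^+ 2).
  have D1 : 1 <= D by rewrite lerDl divr_ge0 ?(ltW dk0) ?(ltW rr).
  have DN0 : 0 <= D ^+ (2 * N) by rewrite exprn_ge0//; lra.
  have h1 : ((D ^+ (2 * N))%:E * pot r (lam%:C%C * u)%R = (b k)%:E)%E.
    by rewrite pot_in// -EFinM.
  rewrite -h1.
  have h2 : (\sum_(n < N) \int[leb]_(t in `[0%R, 1%R])
      (clog R n * Qc (lam%:C%C * u) (circle r t) ^+ n.+1)%:E <= pot r (lam%:C%C * u)%R)%E.
    rewrite pE ?(ltW lr)// -(big_mkord xpredT (fun n => \int[leb]_(t in `[0%R, 1%R])
      (clog R n * Qc (lam%:C%C * u) (circle r t) ^+ n.+1)%:E)%E).
    by apply: nneseries_lim_ge => n _ _; apply: tpos; exact: ltW.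
  have DN0e : (0 <= (D ^+ (2 * N))%:E)%E by rewrite lee_fin.
  apply: (le_trans _ (lee_wpmul2l DN0e h2)).
  rewrite ge0_sume_distrr; last by move=> n _; apply: tpos; exact: ltW.
  apply: lee_sum => n _.
  rewrite -ge0_integralZl//; first last.
  - by move=> t _; rewrite lee_fin mulr_ge0 ?clog_ge0// exprn_ge0// Q01// ltW.
  apply: ge0_le_integral => //.
  - by move=> t _; rewrite lee_fin mulr_ge0 ?clog_ge0// exprn_ge0// Q01.
  - by apply: measurable_funeM; exact: mE.
  move=> t _; rewrite -EFinM lee_fin mulrCA ler_wpM2l ?clog_ge0//.
  have hs : Qc u (circle r t) <= D ^+ 2 * Qc (lam%:C%C * u) (circle r t).
    apply: (@Qc_scale u (circle r t) lam (dk k / (1 - r ^+ 2)) r) => //.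
    - by rewrite subr_ge0.
    - by rewrite gerBl ltW.
    - exact: ltW.
    - by rewrite cabs_le ?(ltW r0)// n2_circle.
    - by rewrite /lam divfK ?gt_eqF//; lra.
  apply: (@le_trans _ _ ((D ^+ 2 * Qc (lam%:C%C * u) (circle r t)) ^+ n.+1)).
    by apply: lerXn2r => //; rewrite nnegrE; [exact: Q01|apply: (le_trans _ hs); exact: Q01].
  rewrite exprMn ler_wpM2r ?exprn_ge0 ?Q01 ?(ltW lr)//.
  rewrite -exprM; apply: ler_weXn2l => //.
  by rewrite leq_mul2l ltn_ord orbT.
have bl : b @ \oo --> - ln r.
  have -> : - ln r = (1 + 0 * (1 - r ^+ 2)^-1) ^+ (2 * N) * - ln r.
    by rewrite mul0r addr0 expr1n mul1r.
  apply: cvgM; last exact: cvg_cst.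
  have h1 : (fun k => 1 + dk k / (1 - r ^+ 2)) @ \oo --> 1 + 0 * (1 - r ^+ 2)^-1.
    apply: cvgD; first exact: cvg_cst.
    by apply: cvgM; [exact: cvg_harmonic|exact: cvg_cst].
  exact: (cvg_comp _ _ h1 (@exprn_continuous R (2 * N) _)).
have : P \is a fin_num.
  by rewrite ge0_fin_numE//; apply: (le_lt_trans (Pk 0%N)); rewrite ltry.
move=> /fineK PE; rewrite -PE lee_fin.
apply: (cvg_ge_bound bl) => k; have := Pk k; by rewrite -PE lee_fin.
Qed.

Section Curve.
Context (d : measure_display) (X : measurableType d).

Lemma cmeasV (h : X -> C) : cmeas h -> cmeas (fun x => (h x)^-1).
Proof.
move=> hM; have nM := measurable_inv (measurable_n2 hM) (fun x => n2_ge0 (h x)).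
have hE x : (h x)^-1 = ((n2 (h x))^-1)%:C%C * conjc (h x).
  case: (eqVneq (h x) 0) => [->|h0]; first by rewrite n2_0 !invr0 mul0r.
  apply: (mulfI h0); rewrite divff// mulrCA mulcJ -rmorphM mulVf ?rmorph1//.
  by rewrite n2_eq0.
have -> : (fun x => (h x)^-1) = fun x => ((n2 (h x))^-1)%:C%C * conjc (h x).
  by apply/funext.
by apply: cmeasM; [split => //=; exact: measurable_cst|exact: cmeasJ].
Qed.

End Curve.

(** Parametrises the pseudo-hyperbolic circle of radius [r] about [w]; [bl (- w)] is the inverse of
    [bl w]. *)
Definition curve w r t : C := bl (- w) (circle r t).

Definition curveT w r (t : measurableTypeR R) : T :=
  (complex.Re (curve w r t), complex.Im (curve w r t)).

Lemma toC_curveT w r t : toC (curveT w r t) = curve w r t.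
Proof. by rewrite /toC /curveT /=; case: (curve w r t). Qed.

Lemma measurable_curveT w r : measurable_fun [set: measurableTypeR R] (curveT w r).
Proof.
have h : cmeas (fun t : measurableTypeR R => curve w r t).
  apply: cmeasM; first by apply: cmeasB; [exact: cmeas_circle|exact: cmeas_cst].
  apply: cmeasV; apply: cmeasB; first exact: cmeas_cst.
  by apply: cmeasM; [exact: cmeas_cst|exact: cmeas_circle].
by apply/measurable_fun_pairP; split; [exact: h.1|exact: h.2].
Qed.

HB.instance Definition _ w r :=
  isMeasurableFun.Build _ _ _ _ (curveT w r) (measurable_curveT w r).

Definition circ w r : probability T R :=
  distribution (uniform_prob (@ltr01 R)) (curveT w r).

Lemma circ_integral w r (f : T -> \bar R) : measurable_fun [set: T] f ->
  (forall p, 0 <= f p)%E ->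
  (\int[circ w r]_p f p = \int[leb]_(t in `[0%R, 1%R]) f (curveT w r t))%E.
Proof.
move=> mf f0; rewrite ge0_integral_distribution// integral_uniform//.
  by rewrite subr0 invr1 mul1e.
  by apply: measurableT_comp => //; exact: measurable_curveT.
by move=> t; exact: f0.
Qed.

(** A cutoff level, not the multiplier of the map. It bounds |bl (-w) v|^2 for |v| <= r, the 4
    coming from |1 + conj w v|^2 <= 4. *)
Definition rho w r : R := 1 - (1 - n2 w) * (1 - r ^+ 2) / 4.

Lemma rho_lt1 w r : n2 w < 1 -> 0 <= r -> r < 1 -> rho w r < 1.
Proof.
move=> w1 r0 r1; rewrite gtrBl divr_gt0// mulr_gt0 ?subr_gt0// expr_lt1//.
Qed.

Lemma rho_ge0 w r : n2 w < 1 -> 0 <= r -> r < 1 -> 0 <= rho w r.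
Proof.
move=> w1 r0 r1; have := n2_ge0 w; have := sqr_ge0 r => h1 h2.
have : r ^+ 2 < 1 by rewrite expr_lt1.
rewrite /rho; nra.
Qed.

Lemma bl_rho w r v : n2 w < 1 -> 0 <= r -> r < 1 -> n2 v <= r ^+ 2 ->
  n2 (bl (- w) v) <= rho w r.
Proof.
move=> w1 r0 r1 vr; have rr : r ^+ 2 < 1 by rewrite expr_lt1.
have v1 := le_lt_trans vr rr; have w1N : n2 (- w) < 1 by rewrite n2N.
have := bl_1B w1N v1; rewrite n2N => E.
have d0 : 0 < n2 (1 - conjc (- w) * v) by rewrite n2_gt0 one_subM_neq0.
have d4 : n2 (1 - conjc (- w) * v) <= 4.
  apply: (le_trans (n2D_le _ _)); rewrite n2_1 n2N n2M n2J n2N.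
  have : n2 w * n2 v <= 1 by rewrite mulr_ile1 ?n2_ge0// ltW.
  by lra.
suff : (1 - n2 w) * (1 - r ^+ 2) / 4 <= 1 - n2 (bl (- w) v) by rewrite /rho; lra.
rewrite E; apply: ler_pM.
- by rewrite mulr_ge0 ?subr_ge0 ?(ltW w1) ?(ltW rr).
- by rewrite invr_ge0.
- by rewrite ler_wpM2l ?subr_ge0 ?(ltW w1)//; lra.
- by rewrite lef_pV2 ?posrE.
Qed.

Lemma curve_rho w r t : n2 w < 1 -> 0 <= r -> r < 1 ->
  cdisk (rho w r) (curveT w r t).
Proof.
by move=> w1 r0 r1; rewrite /cdisk /= toC_curveT; apply: bl_rho => //; rewrite n2_circle.
Qed.

Lemma circ_conc w r : n2 w < 1 -> 0 <= r -> r < 1 -> circ w r (~` cdisk (rho w r)) = 0%E.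
Proof.
move=> w1 r0 r1; rewrite /circ /= /distribution /pushforward.
have -> : curveT w r @^-1` (~` cdisk (rho w r)) = set0.
  by apply/seteqP; split => // t /=; apply; exact: curve_rho.
by rewrite measure0.
Qed.

Lemma circ_pot w r p : n2 w < 1 -> 0 < r -> r < 1 -> cdisk (rho w r) p ->
  (\int[circ w r]_q gser (Qk (rho w r) p q) = pot r (bl w (toC p)))%E.
Proof.
move=> w1 r0 r1 pr; have r0' := ltW r0; have rho1 := rho_lt1 w1 r0' r1.
have rr : r ^+ 2 < 1 by rewrite expr_lt1.
have p1 : n2 (toC p) < 1 by exact: le_lt_trans pr rho1.
rewrite circ_integral; last 2 first.
- exact: (@measurable_fun_pair2 _ _ _ _ _ _
    (fun pq : T * T => gser (Qk (rho w r) pq.1 pq.2)) p (measurable_gser rho1)).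
- by move=> q; apply: gser_ge0; have /andP[] := Qk_01 p q rho1.
apply: eq_integral => t _; congr gser.
rewrite /Qk; have := curve_rho t w1 r0' r1; rewrite /cdisk /= => ct.
rewrite pr ct /= toC_curveT.
have c1 : n2 (circle r t) < 1 by rewrite n2_circle.
have v1 : n2 (curve w r t) < 1 by apply: bl_disk => //; rewrite n2N.
by rewrite -(Qc_bl w1 p1 v1) /curve bl_invol.
Qed.

Lemma energy_circ_kernel w r : n2 w < 1 -> 0 < r -> r < 1 ->
  (\int[circ w r]_p \int[circ w r]_q gser (Qk (rho w r) p q) <= (- ln r)%:E)%E.
Proof.
move=> w1 r0 r1; have r0' := ltW r0; have rho1 := rho_lt1 w1 r0' r1.
have rr : r ^+ 2 < 1 by rewrite expr_lt1.
have g0 p q : (0 <= gser (Qk (rho w r) p q))%E.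
  by apply: gser_ge0; have /andP[] := Qk_01 p q rho1.
have mi := @measurable_integral2 R (circ w r) _ (measurable_gser rho1).
rewrite circ_integral//; last by move=> p; exact: integral_ge0.
have l0 : 0 <= - ln r by rewrite oppr_ge0 ln_le0// ltW.
apply: (@le_trans _ _ (\int[leb]_(t in `[0%R, 1%R]) (- ln r)%:E)%E).
  apply: ge0_le_integral => //.
  - by move=> t _; apply: integral_ge0.
  - apply: measurable_funTS.
    by apply: (measurableT_comp mi); exact: measurable_curveT.
  move=> t _; rewrite circ_pot//; last exact: curve_rho.
  rewrite toC_curveT /curve bl_invol ?n2_circle//; apply: pot_le => //.
  by rewrite cabs_le// n2_circle.
have m1 : leb (`[0, 1]%classic : set R) = 1%E.
  by rewrite lebesgue_measure_itv /= lte_fin ltr01 oppr0 adde0.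
by rewrite integral_cst// [X in (_ * X)%E](_ : _ = 1%E) ?mule1.
Qed.

Lemma energy_circ w r : n2 w < 1 -> 0 < r -> r < 1 -> (energy (circ w r) <= (- ln r)%:E)%E.
Proof.
move=> w1 r0 r1; rewrite (energy_gser (rho_lt1 w1 (ltW r0) r1)).
  exact: energy_circ_kernel.
exact: circ_conc (ltW r0) r1.
Qed.

(** As r' > r, the set [A] lies strictly inside the circle of radius r', whose potential is there
    exactly - ln r'. Then I(mu) >= 2 (- ln r') - I(nu) and I(nu) <= - ln r'. *)
Lemma energy_lower mu (A : set T) w (r r' : R) : measurable A -> mu (~` A) = 0%E ->
  n2 w < 1 -> r < r' -> 0 < r' -> r' < 1 ->
  (forall p, A p -> n2 (toC p) < 1 /\ cabs (bl w (toC p)) <= r) ->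
  ((- ln r')%:E <= energy mu)%E.
Proof.
move=> mA A0 w1 rr' r'0 r'1 AP; have r0' := ltW r'0.
have rho1 := rho_lt1 w1 r0' r'1; have rho0 := rho_ge0 w1 r0' r'1.
have Acd : A `<=` cdisk (rho w r').
  move=> p /AP[p1 pr]; rewrite /cdisk /=.
  have wN : n2 (- w) < 1 by rewrite n2N.
  rewrite -(bl_invol wN p1) opprK; apply: bl_rho => //.
  by rewrite -cabs_le//; exact: le_trans pr (ltW rr').
have m0 : mu (~` cdisk (rho w r')) = 0%E.
  apply/eqP; rewrite eq_le measure_ge0 andbT -A0; apply: le_measure.
  - by rewrite inE; apply: measurableC; exact: measurable_cdisk.
  - by rewrite inE; apply: measurableC.
  - exact: subsetC.
rewrite (energy_gser rho1 m0).
have mixed : (\int[mu]_p \int[circ w r']_q gser (Qk (rho w r') p q) = (- ln r')%:E)%E.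
  transitivity (\int[mu]_p cst (- ln r')%:E p)%E.
    apply: ae_eq_integral => //.
      exact: (@measurable_integral2 R (circ w r') _ (measurable_gser rho1)).
    have neg : mu.-negligible (~` A) by exists (~` A); split => //; exact: measurableC.
    apply: (negligibleS _ neg) => p /= hp; apply: contra_not hp => Ap _.
    rewrite circ_pot//; last exact: Acd.
    have [p1 pr] := AP p Ap; apply: pot_in => //; exact: le_lt_trans pr rr'.
  rewrite integral_cst//; transitivity ((- ln r')%:E * 1%E)%E; last by rewrite mule1.
  congr (_ * _)%E; exact: probability_setT.
have := energy_posdef mu (circ w r') rho0 rho1; rewrite mixed.
have := energy_circ_kernel w1 r'0 r'1.
have : (0 <= \int[circ w r']_p \int[circ w r']_q gser (Qk (rho w r') p q))%E.
  apply: integral_ge0 => p _; apply: integral_ge0 => q _.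
  by apply: gser_ge0; have /andP[] := Qk_01 p q rho1.
case: (\int[circ w r']_p _)%E => [x| |]//.
case: (\int[mu]_p _)%E => [y| |]//; rewrite ?leey//.
by rewrite -EFinM -EFinD !lee_fin; lra.
Qed.

End EquilibriumMeasure.

(** * Capacity and conclusion *)

Section Capacity.
Variable R : realType.
Local Notation C := R[i].
Local Notation T := (R * R)%type.
Local Notation leb := (@lebesgue_measure R).
Implicit Types (mu : probability T R) (a b c d z w s P Q : C) (r t : R).

Lemma cvg_complex (X : Type) (F : set_system X) (FF : Filter F) (f : X -> C) (l : C) :
  (fun x => complex.Re (f x)) @ F --> complex.Re l ->
  (fun x => complex.Im (f x)) @ F --> complex.Im l ->
  (f : X -> C^o) @ F --> (l : C^o).
Proof.
move=> fR fI; apply/cvgrPdist_le => e e0.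
have e0R : 0 < complex.Re e by move: e0; rewrite ltcE => /andP[].
have eE : e = (complex.Re e)%:C%C.
  by move: e0; case: (e) => x y; rewrite ltcE /= => /andP[/eqP -> _].
have e20 : 0 < complex.Re e / 2 by rewrite divr_gt0.
move/cvgrPdist_le : fR => /(_ _ e20) fR; move/cvgrPdist_le : fI => /(_ _ e20) fI.
near=> x.
have h1 : `|complex.Re l - complex.Re (f x)| <= complex.Re e / 2 by near: x.
have h2 : `|complex.Im l - complex.Im (f x)| <= complex.Re e / 2 by near: x.
rewrite eE normc_cabs lecR cabs_le ?(ltW e0R)//.
have -> : n2 (l - f x) = `|complex.Re l - complex.Re (f x)| ^+ 2 +
   `|complex.Im l - complex.Im (f x)| ^+ 2.
  by rewrite !real_normK ?num_real//; case: (l) (f x) => [? ?] [? ?].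
by have := normr_ge0 (complex.Re l - complex.Re (f x));
   have := normr_ge0 (complex.Im l - complex.Im (f x)); nra.
Unshelve. all: by end_near. Qed.

Lemma continuous_circle r : continuous (circle r : R -> C^o).
Proof.
move=> t; apply: (@cvgM _ _ _ _ (cst (r%:C%C : C^o)) (@cis R : R -> C^o)); first exact: cvg_cst.
by apply: cvg_complex; [exact: continuous_cos2pi|exact: continuous_sin2pi].
Qed.

Lemma continuous_curve w r : n2 w < 1 -> 0 <= r -> r < 1 ->
  continuous (curve w r : R -> C^o).
Proof.
move=> w1 r0 r1 t; have cc := @continuous_circle r t.
have c1 : n2 (circle r t) < 1 by rewrite n2_circle expr_lt1.
have wN : n2 (- w) < 1 by rewrite n2N.
apply: (@cvgM _ _ _ _ (fun t => circle r t - - w : C^o)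
   (fun t => (1 - conjc (- w) * circle r t)^-1 : C^o)).
  exact: (@cvgB C C^o R _ _ (circle r) (cst (- w)) _ _ cc (cvg_cst _)).
pose x := conjc (- w) * r%:C%C.
have cd : (fun t => 1 - conjc (- w) * circle r t : C^o) @ t -->
    (1 - conjc (- w) * circle r t : C^o).
  have ReE u : complex.Re (1 - conjc (- w) * circle r u) =
     1 - (complex.Re x * cos (2 * pi * u) - complex.Im x * sin (2 * pi * u)).
    by rewrite /circle mulrA -/x; case: (x) => p q; rewrite /cis /=.
  have ImE u : complex.Im (1 - conjc (- w) * circle r u) =
     0 - (complex.Re x * sin (2 * pi * u) + complex.Im x * cos (2 * pi * u)).
    by rewrite /circle mulrA -/x; case: (x) => p q; rewrite /cis /=.
  have ck := @continuous_cos2pi R t; have cs := @continuous_sin2pi R t.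
  apply: cvg_complex; [rewrite ReE; under eq_fun do rewrite ReE|
    rewrite ImE; under eq_fun do rewrite ImE];
    (apply: cvgB; first exact: cvg_cst).
    by apply: cvgB; apply: cvgM; [exact: cvg_cst|exact: ck|exact: cvg_cst|exact: cs].
  by apply: cvgD; apply: cvgM; [exact: cvg_cst|exact: cs|exact: cvg_cst|exact: ck].
exact: (cvgV (one_subM_neq0 c1 wN) cd).
Qed.

Lemma circ_supported (E : set C) w r : n2 w < 1 -> 0 < r -> r < 1 ->
  (forall t, E (curve w r t)) -> supported_compact_in E (circ w r).
Proof.
move=> w1 r0 r1 EC; exists (curve w r @` `[0, 1]); split.
  apply: continuous_compact; last exact: segment_compact.
  by apply: continuous_subspaceT; exact: continuous_curve (ltW r0) r1.
split.
  move=> _ [t _ <-]; split; first exact: EC.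
  apply/diskE; apply: bl_disk; first by rewrite n2N.
  by rewrite n2_circle expr_lt1// ltW.
rewrite /circ /= /distribution /pushforward /= /uniform_prob integral_uniform_pdf.
set S := (X in (\int[_]_(x in X) _)%E).
have -> : S = set0.
  apply/seteqP; split => // t [/= h t01]; apply: h; exists t => //.
  by rewrite toC_curveT.
by rewrite integral_set0.
Qed.

Lemma Vcap_le_circ (E : set C) w r : n2 w < 1 -> 0 < r -> r < 1 ->
  (forall t, E (curve w r t)) -> (Vcap E <= (- ln r)%:E)%E.
Proof.
move=> w1 r0 r1 EC; apply: (le_trans _ (energy_circ w1 r0 r1)).
by apply: ereal_inf_lbound; exists (circ w r) => //; exact: circ_supported.
Qed.

Lemma closure_near (E : set C^o) z (e : R) : closure E z -> 0 < e ->
  exists z', E z' /\ cabs (z - z') < e.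
Proof.
move=> Ez e0; have e0C : (0 : C) < e%:C%C by rewrite ltcR.
have [z' [Ez' bz']] := Ez _ (nbhsx_ballx (z : C^o) _ e0C).
exists z'; split => //; move: bz'.
by rewrite -ball_normE /= normc_cabs ltcR.
Qed.

Lemma supported_measurable (E : set C) mu : supported_compact_in E mu ->
  exists A : set T, [/\ measurable A, mu (~` A) = 0%E &
    forall p, A p -> E (toC p) /\ n2 (toC p) < 1].
Proof.
move=> [A [cA [AE A0]]]; exists (@toC R @^-1` A); split => //.
  apply: closed_toC_measurable.
  exact: (compact_closed (@norm_hausdorff _ C^o) cA).
by move=> p /AE[Ep /diskE].
Qed.

Lemma Vcap_ge (E : set C) w r : n2 w < 1 -> 0 <= r ->
  (forall z, E z -> n2 z < 1 -> cabs (bl w z) <= r) ->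
  forall r', r < r' -> r' < 1 -> ((- ln r')%:E <= Vcap E)%E.
Proof.
move=> w1 r0 Er r' rr' r'1; apply: le_ereal_inf_tmp => _ [mu muE <-].
have [A [mA A0 AE]] := supported_measurable muE.
apply: (energy_lower mA A0 w1 rr' _ r'1); first exact: le_lt_trans rr'.
by move=> p /AE[Ep p1]; split => //; exact: Er.
Qed.

Lemma Vcap_ge0 (E : set C) : (0 <= Vcap E)%E.
Proof.
apply: le_ereal_inf_tmp => _ [mu muE <-].
have [A [mA A0 AE]] := supported_measurable muE.
by apply: (energy_ge0 mA A0) => p /AE[].
Qed.

(** Inside the disk the point is a pseudo-hyperbolic disk of radius 0, so V >= - ln r' for every
    small r'. Outside, no admissible measure exists and the infimum is over the empty set. *)
Lemma Vcap_point (lam : C) : Vcap (closure ([set lam] : set C^o)) = +oo%E.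
Proof.
have EP z : closure ([set lam] : set C^o) z -> z = lam.
  move=> Ez; apply/eqP; rewrite -subr_eq0 -cabs_eq0; apply/negPn/negP => h.
  have h0 : 0 < cabs (z - lam) by rewrite lt0r h cabs_ge0.
  by have [z' [-> ]] := closure_near Ez h0; rewrite ltxx.
have [l1|l1] := ltP (n2 lam) 1; last first.
  apply/eqP; rewrite -leye_eq; apply: le_ereal_inf_tmp => _ [mu muE <-]; exfalso.
  have [A [mA A0 AE]] := supported_measurable muE.
  have A00 : A = set0.
    apply/seteqP; split => // p /AE[/EP pl]; rewrite pl => h.
    by move: l1; rewrite leNgt h.
  move: A0; rewrite A00 setC0 => h.
  have : mu [set: T] = 1%E := probability_setT mu.
  by rewrite h => -[] /eqP; rewrite eq_sym oner_eq0.
have Er z : closure ([set lam] : set C^o) z -> n2 z < 1 -> cabs (bl lam z) <= 0.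
  by move=> /EP -> _; rewrite /bl subrr mul0r /cabs /= expr0n addr0 sqrtr0.
have key := Vcap_ge l1 (lexx 0) Er.
have V0 := Vcap_ge0 (closure ([set lam] : set C^o)).
case E : (Vcap _) key V0 => [v| |] // key v0; exfalso.
have := key (expR (- (`|v| + 1))) (expR_gt0 _) _.
rewrite expRK opprK lee_fin => /(_ _)/wrap[].
  by rewrite expR_lt1 oppr_lt0 ltr_wpDl.
by have := ler_norm v; lra.
Qed.

Lemma image_circle a b c d s w P Q r t : good a b c d -> center a b c d s w P Q ->
  0 < r -> r < cabs (P / Q) -> (flm a b c d @` @disk R) (curve w r t).
Proof.
move=> G H r0 rPQ; have [[s1 w1 P0 Q0 PQ] _] := H.
have PQ1 : cabs (P / Q) < 1.
  by rewrite cabs_lt// expr1n n2M n2V ltr_pdivrMr ?n2_gt0// mul1r.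
have r1 : r < 1 by exact: lt_trans rPQ PQ1.
have PQ0 : P / Q != 0 by rewrite mulf_neq0// invr_eq0.
pose v := circle r t; pose v' := (P / Q)^-1 * v.
have v1 : n2 v < 1 by rewrite n2_circle expr_lt1// ltW.
have v'1 : n2 v' < 1.
  rewrite /v' n2M n2V n2_circle mulrC ltr_pdivrMr ?n2_gt0// mul1r -cabs_sqr.
  by rewrite ltr_pXn2r// nnegrE ?cabs_ge0 ?(ltW r0).
have sN : n2 (- s) < 1 by rewrite n2N.
have wN : n2 (- w) < 1 by rewrite n2N.
have z1 : n2 (bl (- s) v') < 1 by exact: bl_disk.
exists (bl (- s) v'); first exact/diskE.
have f1 := good_disk G z1.
have E := center_bl G H z1; rewrite bl_invol// /v' mulVKf// in E.
by rewrite /curve -/v -E -{2}(opprK w) bl_invol.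
Qed.

(** On the image itself this is [center_bl]. Multiplied out, the inequality changes by at most 2 |z
    - z'| when z is replaced by a nearby image point z'. *)
Lemma image_bl a b c d s w P Q z : good a b c d -> center a b c d s w P Q ->
  closure ((flm a b c d @` @disk R) : set C^o) z -> n2 z < 1 ->
  cabs (bl w z) <= cabs (P / Q).
Proof.
move=> G H Kz z1; have [[s1 w1 P0 Q0 PQ] _] := H.
have PQ1 : cabs (P / Q) <= 1.
  by rewrite cabs_le// expr1n n2M n2V ler_pdivrMr ?n2_gt0// mul1r ltW.
rewrite /bl cabsM cabsV ler_pdivrMr ?cabs_gt0 ?one_subM_neq0//.
apply/ler_addgt0Pr => e e0.
have e20 : 0 < e / 2 by rewrite divr_gt0.
have [z' [[x /diskE x1 xz] zz']] := closure_near Kz e20.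
have z'1 : n2 z' < 1 by rewrite -xz; exact: good_disk.
have h : cabs (z' - w) <= cabs (P / Q) * cabs (1 - conjc w * z').
  rewrite -ler_pdivrMr ?cabs_gt0 ?one_subM_neq0// -cabsV -cabsM -/(bl w z') -xz.
  rewrite (center_bl G H x1) cabsM ler_piMr ?cabs_ge0//.
  by rewrite cabs_le// expr1n ltW// bl_disk.
have h1 : cabs (z - w) <= cabs (z - z') + cabs (z' - w).
  by rewrite (_ : z - w = (z - z') + (z' - w)) ?cabsD//; ring.
have h2 : cabs (1 - conjc w * z') <= cabs (1 - conjc w * z) + cabs (z - z').
  rewrite (_ : 1 - conjc w * z' = (1 - conjc w * z) + conjc w * (z - z')); last by ring.
  apply: (le_trans (cabsD _ _)); rewrite lerD2l cabsM cabsJ ler_piMl ?cabs_ge0//.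
  by rewrite cabs_le// expr1n ltW.
have h3 := cabs_ge0 (z - z'); have h4 := cabs_ge0 (P / Q).
have h5 : cabs (P / Q) * cabs (1 - conjc w * z') <=
   cabs (P / Q) * cabs (1 - conjc w * z) + cabs (z - z').
  apply: (le_trans (ler_wpM2l h4 h2)); rewrite mulrDr lerD2l ler_piMl//.
by lra.
Qed.

Lemma Vcap_disk a b c d s w P Q : good a b c d -> center a b c d s w P Q ->
  Vcap (closure ((flm a b c d @` @disk R) : set C^o)) = (- ln (cabs (P / Q)))%:E.
Proof.
move=> G H; have [[s1 w1 P0 Q0 PQ] _] := H.
set r := cabs (P / Q); set K := closure _.
have r0 : 0 < r by rewrite cabs_gt0 mulf_neq0// invr_eq0.
have r1 : r < 1.
  by rewrite /r cabs_lt// expr1n n2M n2V ltr_pdivrMr ?n2_gt0// mul1r.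
have lr : ln r < 0 by apply: ln_lt0; rewrite r0 r1.
apply/eqP; rewrite eq_le; apply/andP; split.
  apply/lee_addgt0Pr => e e0.
  have er : expR (- e) < 1 by rewrite expR_lt1 oppr_lt0.
  have h : 0 < r * expR (- e) by rewrite mulr_gt0// expR_gt0.
  have h' : r * expR (- e) < r by rewrite gtr_pMr.
  have := @Vcap_le_circ K w _ w1 h (lt_trans h' r1).
  rewrite lnM ?posrE ?expR_gt0// expRK opprD opprK EFinD; apply => t.
  by apply: subset_closure; exact: (image_circle t G H).
apply/lee_addgt0Pr => e e0.
(* The second bound keeps the enlarged radius r exp e' below 1. *)
pose e' := Num.min e (- ln r / 2).
have e'0 : 0 < e' by rewrite lt_min e0 divr_gt0// oppr_gt0.
have e'e : e' <= e by rewrite ge_min lexx.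
have e'r : e' <= - ln r / 2 by rewrite ge_min lexx orbT.
have h : r < r * expR e' by rewrite ltr_pMr// expR_gt1.
have h' : r * expR e' < 1.
  by rewrite -[X in X * _](lnK (r0 : r \is Num.pos)) -expRD expR_lt1; lra.
have := Vcap_ge w1 (ltW r0) (fun z => @image_bl a b c d s w P Q z G H) h h'.
rewrite -/K lnM ?posrE ?expR_gt0// expRK => hV.
apply: (@le_trans _ _ (Vcap K + e'%:E)%E); last by rewrite leeD2l// lee_fin.
have V0 := Vcap_ge0 K.
case: (Vcap K) hV V0 => [v| |]//; last by rewrite addye ?leey.
by rewrite -EFinD !lee_fin; lra.
Qed.

(** The value r = 1, met in the tangent case, goes through V = 0 and the convention Cap = +oo. *)
Lemma exp_neg_inv_Cap (E : set C) r : 0 < r -> r <= 1 -> Vcap E = (- ln r)%:E ->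
  exp_neg_inv (Cap E) = r.
Proof.
move=> r0; rewrite le_eqVlt => /orP[/eqP ->|r1] VE; rewrite /Cap VE.
  by rewrite ln1 oppr0 eqxx.
have lr : ln r < 0 by apply: ln_lt0; rewrite r0 r1.
have lr0 : - ln r != 0 by rewrite oppr_eq0 lt_eqF.
rewrite (negbTE lr0) /exp_neg_inv invr_eq0 (negbTE lr0) invrK opprK.
by rewrite lnK.
Qed.

End Capacity.

(** * Convergence of the roots in the strict and tangent cases *)

Section Assembly.
Variable R : realType.
Local Notation C := R[i].
Implicit Types (a b c d z w s P Q : C) (r t : R).

(** Composing with z |-> phi (t z) multiplies the k-th coefficient of the image under C_phi by
    t^k. *)
Lemma compop_dil a b c d (t M M' : R) x : 0 < t -> t < 1 -> good a b c d ->
  comp_bounded (flm a b c d) M ->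
  comp_bounded (flm (t%:C%C * a) b (t%:C%C * c) d) M' -> inH2 x ->
  hn2 (compop (flm (t%:C%C * a) b (t%:C%C * c) d) x) <= hn2 (compop (flm a b c d) x).
Proof.
move=> t0 t1 G BM BM' xH.
have [yH _ yE] := compopP BM xH; have [y'H _ y'E] := compopP BM' xH.
set y := compop (flm a b c d) x in yH yE *; set y' := compop _ _ in y'H y'E *.
pose u k := (t%:C%C : C) ^+ k * y k.
have uk n : ssum n u <= ssum n y.
  apply: ler_sum => k _; rewrite /u n2M ler_piMl ?n2_ge0// n2X n2R.
  by apply: exprn_ile1; rewrite ?sqr_ge0// expr_le1 ?(ltW t0)// ltW.
have uH : inH2 u by apply: inH2_bound => n; exact: le_trans (uk n) (ssum_hn2 n yH).
have -> : y' = u.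
  apply: (h2_unique y'H uH) => z /diskE z1.
  have tz1 : n2 (t%:C%C * z) < 1.
    rewrite n2M n2R; apply: le_lt_trans z1; rewrite ler_piMl ?n2_ge0//.
    by rewrite expr_le1 ?(ltW t0)// ltW.
  rewrite (y'E z z1).
  have -> : h2eval u z = h2eval y (t%:C%C * z).
    have E : (fun n => \sum_(k < n) u k * z ^+ k) =
        (fun n => \sum_(k < n) y k * (t%:C%C * z) ^+ k).
      by apply/funext => n; apply: eq_bigr => k _; rewrite /u exprMn; ring.
    by rewrite /h2eval E.
  rewrite (yE _ tz1); congr h2eval; rewrite /flm; congr ((_ + _) / (_ + _)); ring.
by apply: hn2_le => n; exact: le_trans (uk n) (ssum_hn2 n yH).
Qed.

Lemma approx_num_bounded a b c d (M : R) n : 0 <= M -> comp_bounded (flm a b c d) M ->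
  (approx_num n.+1 (compop (flm a b c d)) <= (Num.sqrt M)%:E)%E.
Proof.
move=> M0 BM; apply: ge_ereal_inf; eexists.
  exists (fun _ _ => 0); last reflexivity.
  split; first by move=> x _; exact: inH2_0.
  split; first by move=> x y _ _; apply/funext => k; rewrite addr0.
  split; first by move=> e x _; apply/funext => k; rewrite mulr0.
  exists 0%N; split => //; exists (fun=> fun=> 0); split; first by case.
  by move=> x _; exists (fun=> 0); apply/funext => k; rewrite big_ord0.
apply: opnorm_le; first exact: sqrtr_ge0.
move=> x xH; have [TH TM _] := compopP BM xH.
under eq_fun do rewrite subr0.
by rewrite sqr_sqrtr.
Qed.

Lemma fine_bounds (x : \bar R) (p q : R) : (p%:E <= x)%E -> (x <= q%:E)%E ->
  p <= fine x <= q.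
Proof. by case: x => [y| |]//=; rewrite !lee_fin => -> ->. Qed.

Lemma cvg_strict a b c d : good a b c d ->
  2 * cabs (conjc a * b - conjc c * d) < (n2 c - n2 a) + (n2 d - n2 b) ->
  (fun n : nat => fine (approx_num n (compop (flm a b c d))) `^ (n%:R)^-1)
    @ \oo --> exp_neg_inv (Cap (closure ((flm a b c d @` @disk R) : set C^o))).
Proof.
move=> G str; have [s [w [P [Q [H1 H2 _]]]]] := good_center G str.
have H : center a b c d s w P Q by split.
have [[s1 w1 P0 Q0 PQ] _] := H.
have r0 : 0 < cabs (P / Q) by rewrite cabs_gt0 mulf_neq0// invr_eq0.
have r1 : cabs (P / Q) < 1.
  by rewrite cabs_lt// expr1n n2M n2V ltr_pdivrMr ?n2_gt0// mul1r.
rewrite (exp_neg_inv_Cap r0 (ltW r1) (Vcap_disk G H)).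
have [M [M0 BM]] := good_bounded G.
have [kap [kap0 low]] := approx_num_lower G H BM
   (fun x xH => let: And3 h _ _ := compopP BM xH in conj h (lexx _)).
set r := cabs (P / Q) in r0 r1 low *.
have up N := approx_num_upper G H M0 BM N.
(* Division by [r] absorbs the index shift: the upper bound at n + 1 carries r^n. *)
apply: (@cvg_root _ _ (Num.sqrt M / r) r) => //.
- by rewrite divr_gt0// sqrtr_gt0.
- case=> // n _; have := @fine_bounds _ 0 (Num.sqrt M / r * r ^+ n.+1) (approx_num_ge0 _ _).
  apply; apply: (le_trans (up n)); rewrite lee_fin exprS mulrA divfK ?gt_eqF//.
  by rewrite mulrC.
- move=> r' /andP[r'0 r'r]; exists kap; split => // -[//|n] _.
  have /andP[h _] := @fine_bounds _ _ (cabs (P / Q) ^+ n * Num.sqrt M) (low n.+1) (up n).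
  apply: le_trans h; rewrite ler_pM2l//.
  by apply: lerXn2r; rewrite ?nnegrE ?(ltW r'0) ?(ltW r0)// ltW.
Qed.

(* In the tangent case the dilated maps [z |-> phi (t z)] have pseudo-hyperbolic
   radii tending to 1. *)
Lemma dil_radius a b c d r : good a b c d ->
  2 * cabs (conjc a * b - conjc c * d) = (n2 c - n2 a) + (n2 d - n2 b) ->
  r < 1 -> exists t, [/\ 0 < t, t < 1 & forall s w P Q,
    center (t%:C%C * a) b (t%:C%C * c) d s w P Q ->
    cabs P * cabs Q * (n2 d - n2 b - (n2 (t%:C%C * c) - n2 (t%:C%C * a))) =
    cabs (t%:C%C * a * d - b * (t%:C%C * c)) * (n2 P + n2 Q) ->
    r < cabs (P / Q)].
Proof.
move=> G tang r1; have mD := good_D G; have [_ AD _ D0] := G.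
set A := n2 c - n2 a in tang AD; set D := n2 d - n2 b in tang AD mD.
set m := cabs _ in tang mD.
have m0 : 0 <= m := cabs_ge0 _.
have De0 : 0 < D by exact: le_lt_trans mD.
set dl := cabs (a * d - b * c).
have dl0 : 0 < dl by rewrite cabs_gt0.
(* Tangency turns [n2_mu] into (D - A)^2 = 4 |ad - bc|^2. *)
have DA : D - A = 2 * dl.
  have := n2_mu a b c d; rewrite -cabs_sqr -/m -(cabs_sqr (a * d - b * c)) -/dl -/A -/D => E.
  apply/eqP; rewrite -(@eqrXn2 _ 2) ?subr_ge0 ?mulr_ge0 ?(ltW dl0)//; apply/eqP.
  have : (2 * m) ^+ 2 = (A + D) ^+ 2 by rewrite tang.
  by nra.
(* Chosen against the end of the proof: p <= r q would give (1 - r)^2 dl t <= 2 e D, whereas e <= k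
   and t >= 1/2 make the left side at least 4 e D. *)
pose k := (1 - r) ^+ 2 * dl / (8 * D).
have k0 : 0 < k.
  by apply: divr_gt0; apply: mulr_gt0 => //; rewrite exprn_gt0// subr_gt0.
pose e := Num.min (2^-1) k.
have e0 : 0 < e by rewrite /e lt_min k0 invr_gt0 ltr0n.
have e2 : e <= 2^-1 by rewrite /e ge_min lexx.
have ek : e <= k by rewrite /e ge_min lexx orbT.
pose t := 1 - e.
have t0 : 0 < t by rewrite /t; lra.
have t1 : t < 1 by rewrite /t; lra.
exists t; split => // s w P Q [[s1 w1 P0 Q0 PQ] _].
rewrite !n2M n2R -mulrBr -/A -/D.
have -> : t%:C%C * a * d - b * (t%:C%C * c) = t%:C%C * (a * d - b * c) by ring.
rewrite cabsM cabsR ?(ltW t0)// -/dl cabsM cabsV -!cabs_sqr.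
have cQ : 0 < cabs Q by rewrite cabs_gt0.
have cP : 0 < cabs P by rewrite cabs_gt0.
have pq : cabs P < cabs Q by rewrite cabs_lt ?cabs_ge0// cabs_sqr.
move: (cabs P) (cabs Q) cP cQ pq => p q p0 q0 pq E.
rewrite ltr_pdivlMr// ltNge; apply/negP => prq.
(* The last identity of [good_center] rearranged with [DA]: the gap between |P| and |Q| is
   controlled by e = 1 - t. *)
have key : (q - p) ^+ 2 * (t * dl) = p * q * (e * (D + t * A)).
  have -> : (q - p) ^+ 2 * (t * dl) = t * dl * (p ^+ 2 + q ^+ 2) - 2 * (p * q) * (t * dl) by ring.
  rewrite -E; have -> : 2 * (p * q) * (t * dl) = p * q * t * (D - A) by rewrite DA; ring.
  by rewrite /t; ring.
have k1 : ((1 - r) * q) ^+ 2 <= (q - p) ^+ 2.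
  have h1 : 0 <= (1 - r) * q by rewrite mulr_ge0 ?subr_ge0 ?(ltW r1) ?(ltW q0).
  have h2 : (1 - r) * q <= q - p by lra.
  by rewrite ler_pXn2r ?nnegrE//; exact: le_trans h2.
have k2 : p * q * (e * (D + t * A)) <= q * q * (e * (2 * D)).
  have g1 : 0 <= (1 - t) * D by apply: mulr_ge0; lra.
  have g2 : 0 <= t * (D + A) by apply: mulr_ge0; lra.
  have g3 : 0 <= t * (D - A) by apply: mulr_ge0; lra.
  have g4 : 0 <= D + t * A by lra.
  have g5 : D + t * A <= 2 * D by lra.
  apply: ler_pM.
  - by rewrite mulr_ge0// ltW.
  - by rewrite mulr_ge0// ltW.
  - by rewrite ler_pM2r// ltW.
  - by rewrite ler_pM2l.
have k3 : e * (8 * D) <= (1 - r) ^+ 2 * dl by rewrite -ler_pdivlMr// mulr_gt0.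
have k4 : (1 - r) ^+ 2 * dl * (q * q) * t <= e * (2 * D) * (q * q).
  have h1 : ((1 - r) * q) ^+ 2 * (t * dl) <= (q - p) ^+ 2 * (t * dl).
    by rewrite ler_pM2r// mulr_gt0.
  rewrite key in h1; have := le_trans h1 k2.
  have -> : ((1 - r) * q) ^+ 2 * (t * dl) = (1 - r) ^+ 2 * dl * (q * q) * t by ring.
  by have -> : q * q * (e * (2 * D)) = e * (2 * D) * (q * q) by ring.
have qq : 0 < q * q by rewrite mulr_gt0.
have k5 : (1 - r) ^+ 2 * dl * t <= e * (2 * D).
  by rewrite -(@ler_pM2r _ (q * q))//; lra.
have eD : 0 < e * D by rewrite mulr_gt0.
have k6 : e * (8 * D) * t <= (1 - r) ^+ 2 * dl * t by rewrite ler_pM2r.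
have : t >= 2^-1 by rewrite /t; lra.
by nra.
Qed.

Lemma cvg_tangent a b c d : good a b c d ->
  2 * cabs (conjc a * b - conjc c * d) = (n2 c - n2 a) + (n2 d - n2 b) ->
  (fun n : nat => fine (approx_num n (compop (flm a b c d))) `^ (n%:R)^-1)
    @ \oo --> exp_neg_inv (Cap (closure ((flm a b c d @` @disk R) : set C^o))).
Proof.
move=> G tang; set K := closure _.
have dat r : 0 < r -> r < 1 -> exists t s w P Q, [/\ 0 < t, t < 1,
    good (t%:C%C * a) b (t%:C%C * c) d,
    center (t%:C%C * a) b (t%:C%C * c) d s w P Q & r < cabs (P / Q)].
  move=> r0 r1; have [t [t0 t1 hr]] := dil_radius G tang r1.
  have [Gt st] := good_dil G t0 t1.
  have [s [w [P [Q [H1 H2 H3]]]]] := good_center Gt st.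
  exists t, s, w, P, Q; split => //; exact: (hr s w P Q (conj H1 H2) H3).
have VK : Vcap K = (- ln 1)%:E.
  apply/eqP; rewrite ln1 oppr0 eq_le Vcap_ge0 andbT.
  apply/lee_addgt0Pr => e e0; rewrite add0e.
  have h0 := expR_gt0 (- e).
  have h1 : expR (- e) < 1 by rewrite expR_lt1 oppr_lt0.
  have [t [s [w [P [Q [t0 t1 Gt H hr]]]]]] := dat _ h0 h1.
  have [[_ w1 _ _ _] _] := H.
  have := @Vcap_le_circ R K w _ w1 h0 h1; rewrite expRK opprK; apply => x.
  (* The circle lies in the image of the dilated map, hence in that of the original one. *)
  apply: subset_closure; have [z dz zE] := image_circle x Gt H h0 hr.
  exists (t%:C%C * z).
    move/diskE : dz => z1; apply/diskE; rewrite n2M n2R.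
    by apply: le_lt_trans z1; rewrite ler_piMl ?n2_ge0// expr_le1 ?(ltW t0)// ltW.
  rewrite -zE /flm; congr ((_ + _) / (_ + _)); ring.
rewrite (exp_neg_inv_Cap ltr01 (lexx 1) VK).
have [M [M0 BM]] := good_bounded G.
have up N := approx_num_bounded N (ltW M0) BM.
apply: (@cvg_root _ _ (Num.sqrt M) 1) => //; first by rewrite sqrtr_gt0.
- case=> // n _; rewrite expr1n mulr1.
  exact: (@fine_bounds _ 0 (Num.sqrt M) (approx_num_ge0 _ _) (up n)).
- move=> r /andP[r0 r1].
  have [t [s [w [P [Q [t0 t1 Gt H hr]]]]]] := dat _ r0 r1.
  have [M' [M'0 BM']] := good_bounded Gt.
  have TT x (xH : inH2 x) : inH2 (compop (flm a b c d) x) /\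
     hn2 (compop (flm (t%:C%C * a) b (t%:C%C * c) d) x) <= hn2 (compop (flm a b c d) x).
    by have [h _ _] := compopP BM xH; split; [exact: h|exact: (compop_dil t0 t1 G BM BM' xH)].
  have [kap [kap0 low]] := approx_num_lower Gt H BM' TT.
  exists kap; split => // -[//|n] _.
  have /andP[h _] := @fine_bounds _ _ (Num.sqrt M) (low n.+1) (up n).
  apply: le_trans h; rewrite ler_pM2l//.
  by apply: lerXn2r; rewrite ?nnegrE ?(ltW r0) ?cabs_ge0// ltW.
Qed.

End Assembly.

Theorem theorem3p2 (R : realType) (a b c d : R[i]) :
  cabs a ^+ 2 + cabs b ^+ 2 + 2 * cabs (conjc a * b - conjc c * d)
    <= cabs c ^+ 2 + cabs d ^+ 2 ->
  cabs c <= cabs d ->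
  let phi := flm a b c d in
  let K := closure ((phi @` @disk R) : set R[i]^o) in
  (fun n : nat => fine (approx_num n (compop phi)) `^ (n%:R)^-1)
    @ \oo --> exp_neg_inv (Cap K).
Proof.
move=> h cd phi K; have [D0|D0] := eqVneq (a * d - b * c) 0.
  have [lam [l1 phil]] := flm_const h cd D0.
  have KE : K = closure ([set lam] : set R[i]^o).
    rewrite /K; congr (closure _); apply/seteqP; split.
      by move=> _ [z dz <-]; exact: phil.
    move=> _ ->; have d0 : disk (0 : R[i]) by apply/diskE; rewrite n2_0.
    by exists 0 => //; exact: phil.
  have -> : exp_neg_inv (Cap K) = 0 by rewrite KE /Cap Vcap_point /exp_neg_inv /= eqxx.
  apply: cvg_near_cst; exists 2%N => // -[//|[//|n]] _ /=.
  (* For a constant on the unit circle the approximation number is +oo, and [fine] sends it to 0. *)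
  have -> : fine (approx_num n.+2 (compop phi)) = 0.
    move: l1; rewrite le_eqVlt => /orP[/eqP l1|l1].
      by rewrite (approx_num_const_bd _ phil l1).
    by rewrite (approx_num_const_in _ phil l1).
  by rewrite powR0// invr_eq0 pnatr_eq0.
have G := good_hyp h cd D0; have [_ _ mAD _] := G.
move: mAD; rewrite le_eqVlt => /orP[/eqP tang|str].
  exact: cvg_tangent.
exact: cvg_strict.
Qed.
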